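(* Let $\ell,T>0$ and let $\alpha,\beta,\gamma,\delta,a_1,a_2$ be positive constants. Let the initial-boundary value problem $$u_{tt}-\left(\alpha+\beta\int_0^\ell u_x(x,t)^2\,dx\right)u_{xx}+a_1v_x=f_1(x,t),\qquad v_{tt}-\gamma v_{xx}+\delta v-a_2u_x=f_2(x,t),$$ for $(x,t)\in(0,\ell)\times(0,T]$, with $$u(x,0)=\varphi_0(x),\ u_t(x,0)=\varphi_1(x),\ v(x,0)=\psi_0(x),\ v_t(x,0)=\psi_1(x),\qquad u(0,t)=u(\ell,t)=v(0,t)=v(\ell,t)=0,$$ be well-posed, with solution $(u,v)$. Suppose further that: (a) $\varphi_0,\psi_0\in D(\mathcal A_0)$ and $\varphi_1,\psi_1,\varphi_2,\psi_2\in C^1([0,\ell])$. The functions $u_x(x,t)$ and $v_x(x,t)$ possess a second-order continuous derivative with respect to the temporal variable. The right-hand sides $f_1(x,t)$ and $f_2(x,t)$ are continuous functions that vanish at the endpoints of the interval $[0,\ell]$, and they are continuously differentiable with respect to the spatial variable. (b) The solutions $u(x,t)$ and $v(x,t)$ are continuously differentiable up to and including third order with respect to the temporal variable, and the third temporal derivatives of $u$ and $v$ are Lipschitz continuous with respect to the temporal variable. (c) $u_{xx}(x,t)$ and $v_{xx}(x,t)$ are continuously differentiable with respect to the temporal variable, and the mixed partial derivatives $u_{xxt}(x,t)$ and $v_{xxt}(x,t)$ satisfy the Lipschitz condition with respect to the temporal variable. Let $u_k(x),v_k(x)$ be the approximations produced by the semi-discrete scheme with step $\tau=T/n$ described in the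 context. Then there exists $\overline T$ with $0<\overline T\le T$ such that the errors $z_{1,k}(x)=u(x,t_k)-u_k(x)$ and $z_{2,k}(x)=v(x,t_k)-v_k(x)$ satisfy $$\max_{1\le k\le m}\left\|\frac{dz_{j,k}}{dx}\right\|\le c_j\,\tau^2,\qquad \max_{1\le k\le m}\left\|\frac{\Delta z_{j,k-1}}{\tau}\right\|\le c_j'\,\tau^2,\qquad j=1,2,$$ where $m=[\overline T/\tau]$, $\Delta z_{j,k}(x)=z_{j,k+1}(x)-z_{j,k}(x)$, and $c_j,c_j'$ are positive constants independent of $\tau$.
   Context: $(\cdot,\cdot)$ and $\|\cdot\|$ are the inner product and norm of $L^2(0,\ell)$; $[\cdot]$ applied to a number denotes its integer part. The data $\varphi_0,\varphi_1,\psi_0,\psi_1$ are continuous with $\varphi_0(0)=\varphi_0(\ell)=\psi_0(0)=\psi_0(\ell)=0$. Operators: $\mathcal A_0=-d^2/dx^2$ with $D(\mathcal A_0)=\{u\in C^2([0,\ell]): u(0)=u(\ell)=0\}$, and $\mathcal B_0=d/dx$ with $D(\mathcal B_0)=C^1([0,\ell])$. $\mathcal A\supset\mathcal A_0$ is the self-adjoint positive definite extension of $\mathcal A_0$ in $L^2(0,\ell)$, and $\mathcal B$ is the closure of $\mathcal B_0$. $\mathcal L=\gamma\mathcal A+\delta\mathcal I$, with $\mathcal I$ the identity. Scheme: $n>1$ an integer, $\tau=T/n$, $t_k=k\tau$, $f_{i,k}(x)=f_i(x,t_k)$, $\Delta u_{k-1}=u_k-u_{k-1}$, $\Delta^2u_{k-1}=u_{k+1}-2u_k+u_{k-1}$,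 $q_k=\alpha+\beta\|\mathcal A^{1/2}u_k\|^2$ (which equals $\alpha+\beta\int_0^\ell(u_k'(x))^2dx$). The starting functions are $$u_0=\varphi_0,\quad u_1=\varphi_0+\tau\varphi_1+\tfrac{\tau^2}{2}\varphi_2,\quad \varphi_2=f_{1,0}-a_1\psi_0'+q_0\varphi_0'',$$ $$v_0=\psi_0,\quad v_1=\psi_0+\tau\psi_1+\tfrac{\tau^2}{2}\psi_2,\quad \psi_2=f_{2,0}+a_2\varphi_0'+\gamma\psi_0''-\delta\psi_0,$$ and for $k=1,\dots,n-1$ the functions $u_{k+1},v_{k+1}$ are determined by $$\frac{\Delta^2u_{k-1}}{\tau^2}+q_k\frac{\mathcal Au_{k+1}+\mathcal Au_{k-1}}{2}=f_{1,k}-a_1\mathcal Bv_k,\qquad \frac{\Delta^2v_{k-1}}{\tau^2}+\frac{\mathcal Lv_{k+1}+\mathcal Lv_{k-1}}{2}=f_{2,k}+a_2\mathcal Bu_k.$$ *)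

(* Defs.v *)
From HB Require Import structures.
From mathcomp Require Import all_boot all_order all_algebra.
From mathcomp Require Import all_classical all_reals all_analysis.

Set Implicit Arguments.
Unset Strict Implicit.
Unset Printing Implicit Defensive.

Import Order.TTheory GRing.Theory Num.Theory.
Import numFieldNormedType.Exports.

Local Open Scope classical_set_scope.
Local Open Scope ring_scope.

(* Derivatives of functions known only on a closed interval: y tends to x inside
   I, so the derivative is one-sided at an endpoint of I and the values of g
   outside I are irrelevant. *)
Section OneVariable.
Context {R : realType}.
Implicit Types (I : set R) (g : R -> R).

Definition diff_quot g (x y : R) : R := (g y - g x) / (y - x).

Definition derivable_in I g (x : R) : Prop :=
  cvg (diff_quot g x @ within I x^').

Definition derive_in I g (x : R) : R :=
  lim (diff_quot g x @ within I x^').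

Definition Ck_on I (k : nat) g : Prop :=
  (forall (j : nat) (x : R), (j < k)%N -> I x ->
     derivable_in I (iter j (derive_in I) g) x) /\
  (forall j : nat, (j <= k)%N -> {within I, continuous (iter j (derive_in I) g)}).

End OneVariable.

(* Functions w(x, t) on the closed rectangle [0, ell] x [0, T]. *)
Section TwoVariables.
Context {R : realType}.
Variables ell T : R.
Implicit Types w : R -> R -> R.

Definition dx w : R -> R -> R := fun x t => derive_in `[0, ell] (w ^~ t) x.
Definition dt w : R -> R -> R := fun x t => derive_in `[0, T] (w x) t.

Definition continuous_rect w : Prop :=
  {within [set` `[0, ell]] `*` [set` `[0, T]], continuous (fun p : R * R => w p.1 p.2)}.

Definition Ck_x (k : nat) w : Prop :=
  (forall (j : nat) (x t : R), (j < k)%N -> x \in `[0, ell] -> t \in `[0, T] ->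
     derivable_in `[0, ell] ((iter j dx w) ^~ t) x) /\
  (forall j : nat, (j <= k)%N -> continuous_rect (iter j dx w)).

Definition Ck_t (k : nat) w : Prop :=
  (forall (j : nat) (x t : R), (j < k)%N -> x \in `[0, ell] -> t \in `[0, T] ->
     derivable_in `[0, T] (iter j dt w x) t) /\
  (forall j : nat, (j <= k)%N -> continuous_rect (iter j dt w)).

Definition lipschitz_t w : Prop :=
  exists K : R, forall x : R, x \in `[0, ell] -> K.-lipschitz_(`[0, T]) (w x).

End TwoVariables.

(* L^2(0, ell): its elements are represented by functions R -> R whose values
   outside ]0, ell[ play no role, up to equality almost everywhere. *)
Section L2.
Context {R : realType}.
Variable ell : R.
Implicit Types f g u w : R -> R.

Definition eqL2 f g : Prop := f = g %[ae lebesgue_measure in `]0, ell[%classic].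

Definition inL2 f : Prop :=
  f \_ `]0, ell[ \in Lfun (@lebesgue_measure R) 2%:E.

Definition dotL2 f g : R :=
  \int[lebesgue_measure]_(x in `]0, ell[) (f x * g x).

Definition normL2 f : R := Num.sqrt (dotL2 f f).

(* A possibly unbounded operator; the values of app outside dom play no role. *)
Record operator := Operator {
  dom : set (R -> R);
  app :> (R -> R) -> (R -> R) }.

Implicit Types A S : operator.

(* inL2 w is not implied by inL2 u and eqL2 u w: lebesgue_measure lives on the
   Borel sets, for which a function equal almost everywhere to a measurable one
   need not be measurable. *)
Definition linear_operator A : Prop :=
  [/\ forall u, dom A u -> inL2 u /\ inL2 (A u),
      forall u w, dom A u -> inL2 w -> eqL2 u w -> dom A w /\ eqL2 (A u) (A w),
      dom A 0 &
      forall (c : R) u w, dom A u -> dom A w ->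
        dom A (c *: u + w) /\ eqL2 (A (c *: u + w)) (c *: A u + A w)].

Definition densely_defined A : Prop :=
  forall f, inL2 f -> forall e : R, 0 < e ->
    exists2 g, dom A g & normL2 (f - g) < e.

(* The equivalence says that A is equal to its adjoint: u is in D(A^* ) and
   A^* u = w iff (w, g) = (u, A g) for every g in D(A). *)
Definition self_adjoint A : Prop :=
  [/\ linear_operator A, densely_defined A &
      forall u w, inL2 u -> inL2 w ->
        (forall g, dom A g -> dotL2 w g = dotL2 u (A g)) <->
        (dom A u /\ eqL2 (A u) w)].

Definition nonnegative A : Prop :=
  forall u, dom A u -> 0 <= dotL2 (A u) u.

Definition positive_definite A : Prop :=
  exists2 c : R, 0 < c &
    forall u, dom A u -> c * normL2 u ^+ 2 <= dotL2 (A u) u.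

Definition extends A A0 : Prop :=
  forall u, dom A0 u -> dom A u /\ eqL2 (A u) (A0 u).

(* The square root A^(1/2) is the nonnegative self-adjoint S with S S = A,
   equality of domains included. *)
Definition is_sqrt S A : Prop :=
  [/\ self_adjoint S, nonnegative S,
      forall u, dom A u <-> dom S u /\ dom S (S u) &
      forall u, dom A u -> eqL2 (A u) (S (S u))].

Definition closure_graph A u w : Prop :=
  [/\ inL2 u, inL2 w &
      forall e : R, 0 < e ->
        exists2 g, dom A g & normL2 (g - u) < e /\ normL2 (A g - w) < e].

Definition closure_op A : operator :=
  Operator [set u | exists w, closure_graph A u w]
           (fun u => get [set w | closure_graph A u w]).

Definition opA0 : operator :=
  Operator [set u | [/\ Ck_on `[0, ell] 2 u, u 0 = 0 & u ell = 0]]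
           (fun u => - derive_in `[0, ell] (derive_in `[0, ell] u)).

Definition opB0 : operator :=
  Operator [set u | Ck_on `[0, ell] 1 u] (derive_in `[0, ell]).

Definition opB : operator := closure_op opB0.

Definition opL (gamma delta : R) A : operator :=
  Operator (dom A) (fun u => gamma *: A u + delta *: u).

End L2.

Section Problem.
Context {R : realType}.
Variables (ell T alpha beta gamma delta a1 a2 : R).
Variables (f1 f2 : R -> R -> R) (phi0 phi1 psi0 psi1 : R -> R).

Local Notation Dx := (dx ell).
Local Notation Dt := (dt T).

Definition classical_solution (u v : R -> R -> R) : Prop :=
  [/\ [/\ Ck_x ell T 2 u, Ck_t ell T 2 u, Ck_x ell T 2 v & Ck_t ell T 2 v],
      forall x t : R, 0 < x < ell -> 0 < t <= T ->
        Dt (Dt u) x t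
        - (alpha + beta * \int[lebesgue_measure]_(y in `]0, ell[) (Dx u y t) ^+ 2)
          * Dx (Dx u) x t
        + a1 * Dx v x t = f1 x t,
      forall x t : R, 0 < x < ell -> 0 < t <= T ->
        Dt (Dt v) x t - gamma * Dx (Dx v) x t + delta * v x t - a2 * Dx u x t
        = f2 x t,
      forall x : R, 0 <= x <= ell ->
        [/\ u x 0 = phi0 x, Dt u x 0 = phi1 x, v x 0 = psi0 x & Dt v x 0 = psi1 x] &
      forall t : R, 0 <= t <= T ->
        [/\ u 0 t = 0, u ell t = 0, v 0 t = 0 & v ell t = 0]].

(* Well-posedness is existence (u, v) and uniqueness in the class of functions
   that are C^2 in x and C^2 in t up to the boundary. Continuous dependence on
   the data is not required, so the hypothesis is the weaker for it. *)
Definition well_posed_with_solution (u v : R -> R -> R) : Prop :=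
  classical_solution u v /\
  forall u' v' : R -> R -> R, classical_solution u' v' ->
    forall x t : R, 0 <= x <= ell -> 0 <= t <= T -> u' x t = u x t /\ v' x t = v x t.

Variables A Ahalf : @operator R.

Definition q_of (w : R -> R) : R := alpha + beta * normL2 ell (Ahalf w) ^+ 2.

Definition phi2 (x : R) : R :=
  f1 x 0 - a1 * derive_in `[0, ell] psi0 x
  + q_of phi0 * derive_in `[0, ell] (derive_in `[0, ell] phi0) x.

Definition psi2 (x : R) : R :=
  f2 x 0 + a2 * derive_in `[0, ell] phi0 x
  + gamma * derive_in `[0, ell] (derive_in `[0, ell] psi0) x - delta * psi0 x.

Definition step (n : nat) : R := T / n%:R.

(* Only U k and V k with k <= n are constrained. *)
Definition scheme (n : nat) (U V : nat -> R -> R) : Prop :=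
  let tau := step n in
  let B := opB ell in
  let L := opL gamma delta A in
  [/\ eqL2 ell (U 0%N) phi0,
      eqL2 ell (U 1%N) (fun x => phi0 x + tau * phi1 x + tau ^+ 2 / 2 * phi2 x),
      eqL2 ell (V 0%N) psi0,
      eqL2 ell (V 1%N) (fun x => psi0 x + tau * psi1 x + tau ^+ 2 / 2 * psi2 x) &
      forall k : nat, (1 <= k <= n.-1)%N ->
        [/\ [/\ dom A (U k.+1), dom A (U k.-1), dom Ahalf (U k) & dom B (U k)],
            [/\ dom L (V k.+1), dom L (V k.-1) & dom B (V k)],
            eqL2 ell
              (fun x => (U k.+1 x - 2 * U k x + U k.-1 x) / tau ^+ 2
                        + q_of (U k) * ((A (U k.+1) x + A (U k.-1) x) / 2))
              (fun x => f1 x (k%:R * tau) - a1 * B (V k) x) &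
            eqL2 ell
              (fun x => (V k.+1 x - 2 * V k x + V k.-1 x) / tau ^+ 2
                        + (L (V k.+1) x + L (V k.-1) x) / 2)
              (fun x => f2 x (k%:R * tau) + a2 * B (U k) x)]].

End Problem.

Section Errors.
Context {R : realType}.
Variables ell T : R.

Definition error (w : R -> R -> R) (W : nat -> R -> R) (n k : nat) : R -> R :=
  fun x => w x (k%:R * step T n) - W k x.

(* The x-derivative of an error is taken in L^2(0, ell), i.e. with the closure
   of d/dx; belonging to its domain is part of the bound. *)
Definition dx_error_bounded (w : R -> R -> R) (W : nat -> R -> R)
    (n k : nat) (c : R) : Prop :=
  dom (opB ell) (error w W n k) /\
  normL2 ell (opB ell (error w W n k)) <= c * step T n ^+ 2.

Definition dt_error_bounded (w : R -> R -> R) (W : nat -> R -> R)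
    (n k : nat) (c : R) : Prop :=
  normL2 ell (fun x => (error w W n k x - error w W n k.-1 x) / step T n)
  <= c * step T n ^+ 2.

End Errors.

(* Main.v *)
Require Import Defs.
From HB Require Import structures.
From mathcomp Require Import all_boot all_order all_algebra.
From mathcomp Require Import all_classical all_reals all_analysis.
From mathcomp Require Import measurable_realfun zify ring lra.

(** Why the scheme converges with order two.

    The error [z = u - U] obeys the scheme itself with a small right-hand
    side. Taylor expansion in time shows that the exact solution satisfies
    the difference equations up to [O(tau^2)] ([consistency]), and that the
    first two levels are accurate to order [tau^3] in [L^2] and [tau^2] after
    one [x]-derivative ([start_consistency]). The latter needs the equations
    at [t = 0], where they hold by continuity, and the interchange of the two
    derivatives of [u] there ([mixed_derivative]).

    The energy method then closes the argument. Testing the error equation at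
    level [k] with [z_{k+1} - z_{k-1}] telescopes the second difference and,
    as [A] is symmetric, turns the averaged elliptic term into a difference
    of squares [|A^(1/2) z_{k+1}|^2 - |A^(1/2) z_{k-1}|^2] ([energy_step]).
    The coefficient [q_k] of the first equation varies with [k], so the energy
    moves by the extra term [(q_k - q_{k-1}) |A^(1/2) z|^2]; this is harmless
    as soon as [q_k - q_{k-1} = O(tau)], which holds if the error is already
    known to be at most of size [tau] at the previous levels. That circle is
    broken by induction on the level: on a time interval short enough,
    independently of [tau], an error bound [M tau^2] reproduces itself
    ([energy_bootstrap], [energy_system_bound]). As the interval [[0, Tbar]]
    may be chosen short, [tau <= Tbar] is small whenever there is a level to
    estimate; in particular there are at least three steps, and then every
    level of the scheme lies in the domain of [A].

    What remains is to compare the closure [B] of [d/dx] with [A^(1/2)], both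
    to estimate the coupling terms and to read the final bound. For [w] in
    [D(A0)] an integration by parts gives [|A^(1/2) w| = |w'|]
    ([normL2_sqrt_domA0]). Continuous functions are dense in [L^2]
    ([continuous_dense]) and [- w'' = f] is solvable for continuous [f]
    ([poisson]), so [A0] has dense range and, [A] being bounded below, every
    [z] in [D(A)] is approximated by [w] in [D(A0)] in the norm of
    [A^(1/2)] ([core_approx]). Testing against functions of [D(A0)] yields
    [|B z| <= |A^(1/2) z|] ([closure_deriv_le_sqrt]), which also shows that
    [B] is well defined; the reverse inequality for functions with a
    continuous derivative that vanish at both ends ([sqrt_le_deriv])
    controls the first step. *)

Set Implicit Arguments.
Unset Strict Implicit.
Unset Printing Implicit Defensive.

Import Order.TTheory GRing.Theory Num.Theory.
Import numFieldNormedType.Exports.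

Local Open Scope classical_set_scope.
Local Open Scope ring_scope.

(** * The semi-inner product of square integrable functions *)

Section L2lemmas.
Context {R : realType}.
Variable ell : R.
Implicit Types f g h : R -> R.
Notation mu := (@lebesgue_measure R).
Notation D := (`]0, ell[%classic : set (measurableTypeR R)).
Local Notation inL2 := (inL2 ell).
Local Notation eqL2 := (eqL2 ell).
Local Notation dot := (dotL2 ell).
Local Notation norm2 := (normL2 ell).

Let measD : measurable D. Proof. exact: measurable_itv. Qed.
Hint Resolve measD : core.
Let aeF := ae_filter_ringOfSetsType mu.

Lemma lebesgue_itv_lty : (mu D < +oo)%E.
Proof. by rewrite lebesgue_measure_itv/=; case: ifP => _; rewrite ?ltry// -EFinB ltry. Qed.

(** Square integrability is stated for the extension by zero outside the
    interval; all later arguments use measurability and the integral of the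
    square on the interval itself. *)
Lemma inL2P f : inL2 f <-> measurable_fun D f /\
  mu.-integrable D (EFin \o (fun x => f x ^+ 2)).
Proof.
have rsq : (EFin \o (fun x => f x ^+ 2)) \_ D = (EFin \o (fun x => (f \_ D) x ^+ 2)).
  apply/funext => x /=; rewrite !patchE; case: ifPn => //= _.
  by rewrite expr0n.
split=> [Lf|[mf intf]].
- split.
    have := sub_Lfun_mfun Lf; rewrite inE/= => mf.
    by apply/(measurable_restrictT _ measD).
  by apply/(integrable_mkcond _ measD); rewrite rsq; exact: Lfun2_integrable_sqr.
- rewrite /Defs.inL2 inE; apply/andP; split.
    by rewrite inE/=; apply/(measurable_restrictT _ measD).
  rewrite inE/= /finite_norm unlock /Lnorm.
  apply: poweR_lty.
  rewrite [ltLHS](_ : _ = (\int[mu]_(x in D) (f x ^+ 2)%:E)%E); last first.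
    rewrite [RHS]integral_mkcond; apply: eq_integral => x _.
    rewrite -[X in _ = X]/(((EFin \o (fun x => f x ^+ 2)) \_ D) x) rsq /=.
    by rewrite powR_mulrn// real_normK// num_real.
  have /integrableP[_] := intf; apply: le_lt_trans.
  apply: ge0_le_integral => //=.
  - by move=> x _; rewrite lee_fin sqr_ge0.
  - by case/integrableP: intf.
  - by apply/measurable_EFinP/measurableT_comp => //; exact: measurable_funX.
  - by move=> x _; rewrite lee_fin ler_norm.
Qed.

Lemma inL2_measurable f : inL2 f -> measurable_fun D f.
Proof. by move=> /inL2P[]. Qed.

Lemma inL2_sqr_integrable f : inL2 f -> mu.-integrable D (EFin \o (fun x => f x ^+ 2)).
Proof. by move=> /inL2P[]. Qed.

Lemma inL2_le f g : measurable_fun D f -> mu.-integrable D (EFin \o g) ->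
  (forall x, 0 < x < ell -> f x ^+ 2 <= g x) -> inL2 f.
Proof.
move=> mf ig fg; apply/inL2P; split => //.
apply: (le_integrable measD _ _ ig).
  by apply/measurable_EFinP; exact: measurable_funX.
move=> x; rewrite /= in_itv/= => xD; rewrite lee_fin ger0_norm ?sqr_ge0//.
by rewrite (le_trans (fg _ xD))// ler_norm.
Qed.

Lemma inL2D f g : inL2 f -> inL2 g -> inL2 (f + g).
Proof.
move=> /inL2P[mf f2] /inL2P[mg g2].
apply: (@inL2_le _ (fun x => 2 * (f x ^+ 2 + g x ^+ 2))).
- exact: measurable_funD.
- have := integrableZl measD 2 (integrableD measD f2 g2).
  by apply: eq_integrable => // x _.
- by move=> x _; rewrite /= fctE; have := sqr_ge0 (f x - g x); nra.
Qed.

Lemma inL2Z c f : inL2 f -> inL2 (c *: f).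
Proof.
move=> /inL2P[mf f2].
apply: (@inL2_le _ (fun x => c ^+ 2 * f x ^+ 2)).
- by apply: measurable_funM.
- have := integrableZl measD (c ^+ 2) f2.
  by apply: eq_integrable => // x _.
- by move=> x _; rewrite /= fctE /= -exprMn.
Qed.

Lemma inL2N f : inL2 f -> inL2 (- f).
Proof. by move=> Lf; rewrite -scaleN1r; exact: inL2Z. Qed.

Lemma inL2B f g : inL2 f -> inL2 g -> inL2 (f - g).
Proof. by move=> Lf Lg; apply: inL2D => //; exact: inL2N. Qed.

Lemma inL2_mul_integrable f g : inL2 f -> inL2 g ->
  mu.-integrable D (EFin \o (fun x => f x * g x)).
Proof.
move=> /inL2P[mf f2] /inL2P[mg g2].
apply: (le_integrable measD _ _ (integrableD measD f2 g2)).
  by apply/measurable_EFinP; exact: measurable_funM.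
move=> x _ /=; rewrite lee_fin [leRHS]ger0_norm ?addr_ge0 ?sqr_ge0//.
rewrite ler_norml; have := sqr_ge0 (f x - g x); have := sqr_ge0 (f x + g x).
by move=> *; apply/andP; split; nra.
Qed.

Lemma dotL2C f g : dot f g = dot g f.
Proof. by apply: eq_Rintegral => x _; rewrite mulrC. Qed.

Lemma dotL2Dl f g h : inL2 f -> inL2 g -> inL2 h -> dot (f + g) h = dot f h + dot g h.
Proof.
move=> Lf Lg Lh; rewrite /dotL2 -RintegralD//; [|exact: inL2_mul_integrable..].
by apply: eq_Rintegral => x _; rewrite /= mulrDl.
Qed.

Lemma dotL2Zl c f g : inL2 f -> inL2 g -> dot (c *: f) g = c * dot f g.
Proof.
move=> Lf Lg; rewrite /dotL2 -RintegralZl//; last exact: inL2_mul_integrable.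
by apply: eq_Rintegral => x _; rewrite /= mulrA.
Qed.

Lemma dotL2Nl f g : inL2 f -> inL2 g -> dot (- f) g = - dot f g.
Proof. by move=> Lf Lg; rewrite -scaleN1r dotL2Zl// mulN1r. Qed.

Lemma dotL2Dr f g h : inL2 f -> inL2 g -> inL2 h -> dot h (f + g) = dot h f + dot h g.
Proof. by move=> *; rewrite dotL2C dotL2Dl// !(dotL2C h). Qed.

Lemma dotL2Zr c f g : inL2 f -> inL2 g -> dot g (c *: f) = c * dot g f.
Proof. by move=> *; rewrite dotL2C dotL2Zl// (dotL2C g). Qed.

Lemma dotL2Nr f g : inL2 f -> inL2 g -> dot g (- f) = - dot g f.
Proof. by move=> *; rewrite dotL2C dotL2Nl// (dotL2C g). Qed.

Lemma dotL2_ge0 f : 0 <= dot f f.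
Proof. by apply: Rintegral_ge0 => x _; rewrite -expr2 sqr_ge0. Qed.

Lemma normL2_ge0 f : 0 <= norm2 f. Proof. exact: sqrtr_ge0. Qed.

Lemma normL2_sqr f : norm2 f ^+ 2 = dot f f.
Proof. by rewrite /normL2 sqr_sqrtr// dotL2_ge0. Qed.

(** Cauchy-Schwarz: the quadratic polynomial [t |-> |f + t g|^2] has no
    negative value. If [|g| = 0] it is affine, so its slope vanishes; otherwise
    it is evaluated at its minimum. *)
Lemma dotL2_sqr_le f g : inL2 f -> inL2 g -> dot f g ^+ 2 <= dot f f * dot g g.
Proof.
move=> Lf Lg.
have key t : 0 <= dot f f + 2 * t * dot f g + t ^+ 2 * dot g g.
  have := dotL2_ge0 (f + t *: g).
  have Lt := inL2Z t Lg; have Ls := inL2D Lf Lt.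
  rewrite dotL2Dl// !dotL2Dr// !dotL2Zl// !dotL2Zr// (dotL2C g f) => /le_trans; apply.
  by rewrite le_eqVlt; apply/orP; left; apply/eqP; ring.
have [g0|g0] := eqVneq (dot g g) 0.
  rewrite g0 mulr0.
  suff -> : dot f g = 0 by rewrite expr0n.
  apply/eqP; apply: contraT => fg0.
  have := key (- (dot f f + 1) / (2 * dot f g)).
  rewrite g0 mulr0 addr0.
  rewrite (_ : 2 * _ * _ = - (dot f f + 1)); last by field.
  by rewrite opprD addrA subrr add0r; rewrite lerNr oppr0 ler10.
have gp : 0 < dot g g by rewrite lt_neqAle eq_sym g0 dotL2_ge0.
have := key (- dot f g / dot g g).
have -> : dot f f + 2 * (- dot f g / dot g g) * dot f g
   + (- dot f g / dot g g) ^+ 2 * dot g g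
   = (dot f f * dot g g - dot f g ^+ 2) / dot g g by field.
by rewrite pmulr_lge0 ?invr_gt0// subr_ge0.
Qed.

Lemma dotL2_le_normL2 f g : inL2 f -> inL2 g -> `|dot f g| <= norm2 f * norm2 g.
Proof.
move=> Lf Lg; rewrite -(@ler_pXn2r _ 2)// ?nnegrE ?mulr_ge0 ?normL2_ge0//.
by rewrite exprMn !normL2_sqr real_normK ?num_real//; exact: dotL2_sqr_le.
Qed.

Lemma normL2_leD f g : inL2 f -> inL2 g -> norm2 (f + g) <= norm2 f + norm2 g.
Proof.
move=> Lf Lg; rewrite -(@ler_pXn2r _ 2)// ?nnegrE ?addr_ge0 ?normL2_ge0//.
have Ls := inL2D Lf Lg.
rewrite normL2_sqr dotL2Dl// !dotL2Dr// -!normL2_sqr (dotL2C g f).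
have := dotL2_le_normL2 Lf Lg; rewrite ler_norml => /andP[_].
by rewrite sqrrD; nra.
Qed.

Lemma normL2Z c f : inL2 f -> norm2 (c *: f) = `|c| * norm2 f.
Proof.
move=> Lf; rewrite /normL2 dotL2Zl ?dotL2Zr//; last exact: inL2Z.
by rewrite mulrA -expr2 sqrtrM ?sqr_ge0// sqrtr_sqr.
Qed.

Lemma normL2N f : inL2 f -> norm2 (- f) = norm2 f.
Proof. by move=> Lf; rewrite -scaleN1r normL2Z// normrN1 mul1r. Qed.

Lemma normL2_leB f g : inL2 f -> inL2 g -> norm2 (f - g) <= norm2 f + norm2 g.
Proof.
by move=> Lf Lg; rewrite (le_trans (normL2_leD _ _))// ?normL2N//; exact: inL2N.
Qed.

Lemma eqL2_dotl f f' g : inL2 f -> inL2 f' -> inL2 g -> eqL2 f f' ->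
  dot f g = dot f' g.
Proof.
move=> Lf Lf' Lg ff'; rewrite /dotL2 /Rintegral; congr fine.
apply: ae_eq_integral => //.
- by apply/measurable_EFinP; apply: measurable_funM; exact: inL2_measurable.
- by apply/measurable_EFinP; apply: measurable_funM; exact: inL2_measurable.
- apply: (@filterS _ _ aeF) ff' => x /= e Dx; by rewrite (e Dx).
Qed.

Lemma eqL2_dotr f f' g : inL2 f -> inL2 f' -> inL2 g -> eqL2 f f' ->
  dot g f = dot g f'.
Proof. by move=> *; rewrite dotL2C (@eqL2_dotl f f')// dotL2C. Qed.

Lemma eqL2_norm f f' : inL2 f -> inL2 f' -> eqL2 f f' -> norm2 f = norm2 f'.
Proof.
by move=> Lf Lf' e; rewrite /normL2 (eqL2_dotl Lf Lf')// (eqL2_dotr Lf Lf').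
Qed.

Lemma eqL2_refl f : eqL2 f f.
Proof. by apply: (@filterE _ _ aeF) => x _. Qed.

Lemma eqL2_on f g : (forall x, 0 < x < ell -> f x = g x) -> eqL2 f g.
Proof. by move=> fg; apply: (@filterE _ _ aeF) => x; rewrite /= in_itv/=; exact: fg. Qed.

Lemma eqL2_trans f g h : eqL2 f g -> eqL2 g h -> eqL2 f h.
Proof. by apply: (@filterS2 _ _ aeF) => x e e' Dx; rewrite e// e'. Qed.

Lemma eqL2D f f' g g' : eqL2 f f' -> eqL2 g g' -> eqL2 (f + g) (f' + g').
Proof. by apply: (@filterS2 _ _ aeF) => x e e' Dx; rewrite /= !fctE e// e'. Qed.

Lemma eqL2N f f' : eqL2 f f' -> eqL2 (- f) (- f').
Proof. by apply: (@filterS _ _ aeF) => x e Dx; rewrite /= !fctE e. Qed.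

Lemma eqL2B f f' g g' : eqL2 f f' -> eqL2 g g' -> eqL2 (f - g) (f' - g').
Proof. by move=> ef eg; apply: eqL2D => //; exact: eqL2N. Qed.

Lemma continuous_integrable f : {within `[0, ell], continuous f} ->
  mu.-integrable D (EFin \o f).
Proof.
move=> cf; have sub : D `<=` (`[0, ell]%classic : set (measurableTypeR R))
  by exact: subset_itv_oo_cc.
apply: (integrableS _ measD sub); first exact: measurable_itv.
exact: (continuous_compact_integrable (@segment_compact _ _ _)).
Qed.

Lemma continuous_inL2 f : {within `[0, ell], continuous f} -> inL2 f.
Proof.
move=> cf; apply/inL2P; split.
  by apply/measurable_EFinP; case/integrableP: (continuous_integrable cf).
apply: continuous_integrable => x.
by rewrite (_ : (fun x => _) = (fun x => f x * f x))//; apply: continuousM; exact: cf.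
Qed.

Lemma normL2_le_bound f M : 0 <= ell -> inL2 f -> 0 <= M ->
  (forall x, 0 < x < ell -> `|f x| <= M) -> norm2 f <= M * Num.sqrt ell.
Proof.
move=> l0 Lf M0 fM.
have -> : M * Num.sqrt ell = Num.sqrt (M ^+ 2 * ell).
  by rewrite sqrtrM ?sqr_ge0// sqrtr_sqr ger0_norm.
rewrite /normL2 ler_sqrt ?mulr_ge0 ?sqr_ge0//.
have -> : M ^+ 2 * ell = \int[mu]_(x in D) (M ^+ 2).
  rewrite Rintegral_cst//= lebesgue_measure_itv/= lte_fin.
  case: ltP => [|l0']; first by rewrite /= oppr0 addr0.
  by rewrite (_ : ell = 0) ?mulr0//; apply/eqP; rewrite eq_le l0 l0'.
apply: le_Rintegral => //.
- exact: inL2_mul_integrable.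
- apply: continuous_integrable; apply: continuous_subspaceT => ?; exact: cst_continuous.
- move=> x; rewrite /= in_itv/= => /fM fxM.
  rewrite -expr2 -real_normK ?num_real// ler_pXn2r// ?nnegrE//.
Qed.

End L2lemmas.

(** * Density of continuous functions *)

Section Density.
Context {R : realType}.
Variable ell : R.
Implicit Types f g h : R -> R.
Notation mu := (@lebesgue_measure R).
Notation D := (`]0, ell[%classic : set (measurableTypeR R)).
Local Notation inL2 := (inL2 ell).
Local Notation dot := (dotL2 ell).
Local Notation norm2 := (normL2 ell).

Let measD : measurable D. Proof. exact: measurable_itv. Qed.
Hint Resolve measD : core.

Definition clamp (M x : R) : R := Num.max (- M) (Num.min x M).

Lemma clamp_bound M x : 0 <= M -> `|clamp M x| <= M.
Proof.
move=> M0; rewrite /clamp ler_norml.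
by rewrite le_max lexx/= ge_max ge_min lexx orbT; lra.
Qed.

Lemma clamp_id M x : `|x| <= M -> clamp M x = x.
Proof.
by rewrite ler_norml => /andP[a b]; rewrite /clamp (min_idPl b) (max_idPr a).
Qed.

Lemma clamp_lipschitz M x y : `|clamp M x - clamp M y| <= `|x - y|.
Proof.
have h1 := ler_norm (x - y); have := ler_norm (y - x); rewrite distrC => h2.
have h3 := normr_ge0 (x - y).
rewrite /clamp !maxEle !minEle ler_norml.
by apply/andP; split; do ?case: ifPn; rewrite -?ltNge => *; lra.
Qed.

Lemma clamp_sqr_le M x : 0 <= M -> (x - clamp M x) ^+ 2 <= x ^+ 2.
Proof.
move=> M0; rewrite /clamp !maxEle !minEle.
by do ?case: ifPn; rewrite -?ltNge => *; nra.
Qed.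

Lemma continuous_clamp M f : continuous f -> continuous (clamp M \o f).
Proof.
move=> cf x; apply: (@continuous_max _ _ (fun=> - M) (fun x => Num.min (f x) M)).
  exact: cst_continuous.
by apply: (@continuous_min _ _ f (fun=> M)); [exact: cf|exact: cst_continuous].
Qed.

Lemma measurable_clamp M f : measurable_fun D f -> measurable_fun D (clamp M \o f).
Proof.
move=> mf; apply: (@measurable_maxr _ _ _ D (fun=> - M) (fun x => Num.min (f x) M)).
  exact: measurable_cst.
by apply: (@measurable_minr _ _ _ D f (fun=> M)) => //; exact: measurable_cst.
Qed.

Lemma inL2_bounded f M : measurable_fun D f -> (forall x, `|f x| <= M) -> inL2 f.
Proof.
move=> mf fM; apply: (@inL2_le _ _ _ (fun=> M ^+ 2)) => //.
  by apply: continuous_integrable; apply: continuous_subspaceT => ?; exact: cst_continuous.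
move=> x _; rewrite -real_normK ?num_real// ler_pXn2r ?nnegrE//.
by rewrite (le_trans _ (fM x)).
Qed.

Lemma inL2_clamp f M : 0 <= M -> inL2 f -> inL2 (clamp M \o f).
Proof.
move=> M0 Lf; apply: (@inL2_bounded _ M) => [|x]; last exact: clamp_bound.
by apply: measurable_clamp; apply: inL2_measurable.
Qed.

(** Dominated convergence: at each point the truncation is eventually the
    identity, and the remainder never exceeds [|f|]. *)
Lemma clamp_dotL2_cvg f : inL2 f ->
  dot (f - (clamp n%:R \o f)) (f - (clamp n%:R \o f)) @[n --> \oo] --> 0.
Proof.
move=> Lf; have Lc n : inL2 (f - (clamp n%:R \o f)) by apply: inL2B => //;
  apply: inL2_clamp.
pose F n := (\int[mu]_(x in D) (((f - (clamp n%:R \o f)) x) * ((f - (clamp n%:R \o f))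
  x))%:E)%E.
suff : F n @[n --> \oo] --> 0%:E by exact: fine_cvg.
rewrite /F -[X in _ --> X](@integral0 _ _ _ mu D).
apply: (@dominated_cvg _ _ _ mu D measD _ _ (EFin \o (fun x => f x ^+ 2))).
- by move=> n; case/integrableP: (inL2_mul_integrable (Lc n) (Lc n)).
- move=> x _; apply: cvg_near_cst; near=> n.
  rewrite !fctE/= clamp_id ?subrr ?mulr0//.
  by near: n; exact: nbhs_infty_ger.
- by [].
- exact: inL2_sqr_integrable.
- by move=> n x _ /=; rewrite lee_fin -expr2 ger0_norm ?sqr_ge0// clamp_sqr_le.
Unshelve. all: by end_near. Qed.

Lemma normL2_lt f e : 0 < e -> dot f f < e ^+ 2 -> norm2 f < e.
Proof.
by move=> e0 fe; rewrite -(@ltr_pXn2r _ 2)// ?nnegrE ?normL2_ge0 ?ltW// normL2_sqr.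
Qed.

Lemma clamp_dense f e : inL2 f -> 0 < e ->
  exists2 M, 0 < M & norm2 (f - (clamp M \o f)) < e.
Proof.
move=> Lf e0; have /cvgrPdist_lt/(_ (e ^+ 2)) := clamp_dotL2_cvg Lf.
rewrite exprn_gt0// => /(_ isT) [N _ HN].
exists N.+1%:R; rewrite ?ltr0Sn//; apply: normL2_lt => //.
have := HN N.+1 (leqnSn _); rewrite sub0r normrN.
by apply: le_lt_trans; rewrite ler_norm.
Qed.

(** Density in [L^1] is enough once the function is bounded by [M], because
    [(a - b)^2 <= 2 M |a - b|] for [a] and [b] in [[- M, M]]; clamping the
    approximation keeps it continuous and in that range. *)
Lemma continuous_dense f e : inL2 f -> 0 < e ->
  exists2 g, continuous g & norm2 (f - g) < e.
Proof.
move=> Lf e0.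
have e20 : 0 < e / 2 by rewrite divr_gt0.
have [M M0 HM] := clamp_dense Lf e20.
have LM := inL2_clamp (ltW M0) Lf.
set fM := clamp M \o f in HM LM.
have ifM : mu.-integrable D (EFin \o fM).
  have L1 : inL2 (fun=> 1) by apply: (@inL2_bounded _ 1) => [|x]; rewrite ?normr1.
  have := inL2_mul_integrable LM L1.
  by apply: eq_integrable => // x _ /=; rewrite mulr1.
have [g [cg ig gcv]] := approximation_continuous_integrable measD (lebesgue_itv_lty
  ell) ifM.
have d0 : 0 < (e / 2) ^+ 2 / (2 * M) by rewrite divr_gt0 ?exprn_gt0 ?mulr_gt0.
have [n Hn] : exists n,
  (\int[mu]_(z in D) `|(fM z - g n z)%:E| < ((e / 2) ^+ 2 / (2 * M))%:E)%E.
  move/fine_cvgP: gcv => [_ /cvgrPdist_lt/(_ _ d0)] [N _ HN].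
  exists N; have := HN N (leqnn _).
  rewrite /= sub0r normrN -lte_fin => /(le_lt_trans _); apply.
  have := integrableB measD ifM (ig N).
  move=> /integrable_abse/integrable_fin_num => /(_ measD) /fineK <-.
  by rewrite lee_fin ler_norm.
exists (clamp M \o g n); first exact: continuous_clamp.
have Lg : inL2 (clamp M \o g n).
  apply: (@inL2_bounded _ M) => [|x]; last exact: clamp_bound (ltW M0).
  by apply: measurable_clamp; apply/measurable_EFinP; case/integrableP: (ig n).
have Lh := inL2B LM Lg.
have -> : f - (clamp M \o g n) = (f - fM) + (fM - (clamp M \o g n)).
  by rewrite addrA subrK.
rewrite (le_lt_trans (normL2_leD _ _))//; first exact: inL2B.
rewrite [ltRHS]splitr ltrD//.
apply: normL2_lt => //.
have iab : mu.-integrable D (EFin \o (fun z => `|fM z - g n z|)).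
  by have := integrable_abse (integrableB measD ifM (ig n)).
apply: (@le_lt_trans _ _ (\int[mu]_(x in D) (2 * M * `|fM x - g n x|))).
  apply: le_Rintegral => //.
  - exact: inL2_mul_integrable.
  - by have := integrableZl measD (2 * M) iab.
  - move=> x _; rewrite !fctE /=.
    have := @clamp_lipschitz M (fM x) (g n x).
    rewrite (@clamp_id M (fM x)); last exact: clamp_bound (ltW M0).
    move=> h1.
    have := clamp_bound (f x) (ltW M0); have := clamp_bound (g n x) (ltW M0).
    rewrite -/(fM x) => h2 h3.
    rewrite -expr2 -real_normK ?num_real// expr2 ler_pM ?normr_ge0//.
    rewrite (le_trans (ler_normB _ _))// /fM /=; lra.
rewrite RintegralZl// mulrC -ltr_pdivlMr ?mulr_gt0//.
rewrite -lte_fin /Rintegral fineK//.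
exact: integrable_fin_num iab.
Qed.

End Density.

(** * One-sided derivatives and Taylor remainders on an interval *)

Section OneVariableCalculus.
Context {R : realType}.
Implicit Types (I : set R) (g h : R -> R) (a b x y t : R).

(** Errors need only be made small along parameters [e <= T], which is how
    they occur when [e] is a time step. *)
Lemma ler_of_small_error T x y C : 0 < T -> 0 <= C ->
  (forall e : R, 0 < e <= T -> x <= y + e * C) -> x <= y.
Proof.
move=> T0 C0 H; apply/ler_addgt0Pr => e e0.
have C1 : 0 < C + 1 by rewrite ltr_wpDl.
have d0 : 0 < Num.min T (e / (C + 1)) by rewrite lt_min T0 divr_gt0.
apply: (le_trans (H (Num.min T (e / (C + 1))) _)); first by rewrite d0 ge_min lexx.
rewrite lerD2l (le_trans (ler_wpM2r C0 (_ : _ <= e / (C + 1))))//.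
  by rewrite ge_min lexx orbT.
by rewrite mulrAC ler_pdivrMr// ler_wpM2l ?ltW//; lra.
Qed.

Lemma is_derive_diff_quot g x d :
  is_derive x (1 : R) g d <-> diff_quot g x y @[y --> x^'] --> d.
Proof.
split=> [[ex <-]|H].
- apply/cvgrPdist_lt => e e0; have /cvgrPdist_lt/(_ e e0) [r r0 Hr] := ex.
  exists r => // y /= yr yx; rewrite /diff_quot.
  have /= := Hr (y - x); rewrite sub0r normrN distrC => /(_ yr).
  rewrite subr_eq0 => /(_ yx).
  by rewrite /= scaler1 subrK /derive mulrC.
- have {}H : h^-1 *: ((g \o shift x) (h *: (1 : R)) - g x) @[h --> 0^'] --> d.
    apply/cvgrPdist_lt => e e0; have /cvgrPdist_lt/(_ e e0) [r r0 Hr] := H.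
    exists r => // h /= hr h0.
    have e1 : `|x - (h + x)| < r.
      by move: hr; rewrite /= sub0r normrN opprD addrCA subrr addr0 normrN.
    have e2 : h + x != x by rewrite -subr_eq0 addrK.
    by have := Hr _ e1 e2; rewrite /diff_quot addrK /= [h%:A]scaler1 mulrC.
  split; first by apply/cvg_ex; exists d.
  exact: cvg_lim H.
Qed.

Lemma within_itv_proper a b x : a < b -> x \in `[a, b] ->
  ProperFilter (within `[a, b] x^').
Proof.
move=> ab; rewrite in_itv/= => /andP[ax xb].
apply: Build_ProperFilter_ex => P [r /= r0 H].
have [xb'|bx] := ltP x b.
- exists (Num.min (x + r / 2) b); apply: H; rewrite /= ?in_itv/=.
  + rewrite distrC ger0_norm ?subr_ge0 ?le_min ?ltW//=; last by rewrite ltrDl divr_gt0.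
    by rewrite ltrBlDr gt_min; apply/orP; left; lra.
  + by rewrite gt_eqF// lt_min xb' andbT ltrDl divr_gt0.
  + by rewrite le_min (ltW ab) ge_min lexx orbT !andbT (le_trans ax)// lerDl divr_ge0// ltW.
- exists (Num.max (x - r / 2) a); apply: H; rewrite /= ?in_itv/=.
  + rewrite ger0_norm ?subr_ge0 ?ge_max ?ltW ?(lt_le_trans ab)//=;
    last by rewrite gtrBl divr_gt0.
    by rewrite ltrBlDl -ltrBlDr lt_max; apply/orP; left; lra.
  + by rewrite lt_eqF// gt_max (lt_le_trans ab bx) andbT gtrBl divr_gt0.
  + by rewrite ge_max (ltW ab) le_max lexx orbT !andbT (le_trans _ xb)//
    gerBl divr_ge0// ltW.
Qed.

(** The two notions of derivative meet in two ways: a two-sided derivative is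
    a derivative in the interval at every point, endpoints included, and a
    derivative in the interval is two-sided at interior points
    ([derive_in_interior]). *)
Lemma is_derive_in a b g x d : a < b -> x \in `[a, b] ->
  is_derive x (1 : R) g d ->
  derivable_in `[a, b] g x /\ derive_in `[a, b] g x = d.
Proof.
move=> ab xab /is_derive_diff_quot gd.
have PF := within_itv_proper ab xab.
have H : diff_quot g x y @[y --> within `[a, b] x^'] --> d by exact: cvg_within_filter.
split; first by apply/cvg_ex; exists d.
exact: cvg_lim H.
Qed.

Lemma derive_in_interior a b g x : x \in `]a, b[ -> derivable_in `[a, b] g x ->
  is_derive x (1 : R) g (derive_in `[a, b] g x).
Proof.
move=> xab gx; apply/is_derive_diff_quot.
have {}gx : diff_quot g x y @[y --> within `[a, b] x^'] --> derive_in `[a, b] g x by [].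
move=> P /gx; rewrite /= /within /=.
have : \forall y \near x, y \in `]a, b[ by exact: near_in_itvoo.
move=> xnear; rewrite !nbhs_simpl /= /dnbhs /within /=.
move: xnear; apply: filterS2 => y yab H yx; apply: (H yx).
by apply: subset_itv_oo_cc; rewrite /= yab.
Qed.

Lemma eq_diff_quot_near I g h x : {in I, g =1 h} -> I x ->
  diff_quot g x @ within I x^' = diff_quot h x @ within I x^'.
Proof.
move=> gh Ix; apply/funext => P; apply/propext.
have e y : I y -> diff_quot g x y = diff_quot h x y.
  by move=> Iy; rewrite /diff_quot !gh// inE.
split; rewrite /= /within /=; apply: (@filterS _ x^' _) => y H Iy;
  by have := H Iy; rewrite /= e.
Qed.

Lemma eq_derivable_in I g h x : {in I, g =1 h} -> I x ->
  derivable_in I g x -> derivable_in I h x.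
Proof. by move=> gh Ix; rewrite /derivable_in (eq_diff_quot_near gh Ix). Qed.

Lemma eq_derive_in I g h x : {in I, g =1 h} -> I x ->
  derive_in I g x = derive_in I h x.
Proof. by move=> gh Ix; rewrite /derive_in (eq_diff_quot_near gh Ix). Qed.

(** The setting of the mean value theorem: nothing is required of the
    derivative at the endpoints. *)
Definition has_deriv a b g g' : Prop :=
  {within `[a, b], continuous g} /\
  (forall x, x \in `]a, b[ -> is_derive x (1 : R) g (g' x)).

Lemma Ck_on_has_deriv a b k g j : Ck_on `[a, b] k g -> (j < k)%N ->
  has_deriv a b (iter j (derive_in `[a, b]) g) (iter j.+1 (derive_in `[a, b]) g).
Proof.
move=> [dg cg] jk; split; first exact/cg/ltnW.
move=> x xab; apply: derive_in_interior => //; apply: dg => //.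
exact: subset_itv_oo_cc.
Qed.

Lemma Ck_onW I j k g : (j <= k)%N -> Ck_on I k g -> Ck_on I j g.
Proof.
move=> jk [dg cg]; split=> i; first by move=> x ij; apply: dg; exact: leq_trans jk.
by move=> ij; apply: cg; exact: leq_trans jk.
Qed.

Lemma has_deriv_of_is_derive a b g g' :
  (forall x, x \in `[a, b] -> is_derive x (1 : R) g (g' x)) -> has_deriv a b g g'.
Proof.
move=> H; split; last by move=> x xab; apply: H; exact: subset_itv_oo_cc.
by apply: derivable_within_continuous => x /H [].
Qed.

Lemma within_continuousB a b g h : {within `[a, b], continuous g} ->
  {within `[a, b], continuous h} -> {within `[a, b], continuous (fun x => g x - h x)}.
Proof. by move=> cg ch x; apply: continuousB; [exact: cg|exact: ch]. Qed.

Lemma within_continuousZ a b c g : {within `[a, b], continuous g} ->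
  {within `[a, b], continuous (fun x => c * g x)}.
Proof. by move=> cg x; apply: continuousM; [exact: cst_continuous|exact: cg]. Qed.

Lemma has_derivB a b g g' h h' : has_deriv a b g g' -> has_deriv a b h h' ->
  has_deriv a b (fun x => g x - h x) (fun x => g' x - h' x).
Proof.
move=> [cg dg] [ch dh]; split; last first.
  by move=> x xab; have dgx := dg x xab; have dhx := dh x xab; exact: is_deriveB.
exact: within_continuousB.
Qed.

Lemma has_derivZ a b c g g' : has_deriv a b g g' ->
  has_deriv a b (fun x => c * g x) (fun x => c * g' x).
Proof.
move=> [cg dg]; split; last first.
  by move=> x xab; have dgx := dg x xab; exact: is_deriveZ.
exact: within_continuousZ.
Qed.

Lemma has_deriv_cubic a b t c0 c1 c2 c3 :
  has_deriv a b (fun s => c0 + c1 * (s - t) + c2 / 2 * (s - t) ^+ 2 + c3 / 6 * (s - t) ^+ 3)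
    (fun s => c1 + c2 * (s - t) + c3 / 2 * (s - t) ^+ 2).
Proof.
apply: has_deriv_of_is_derive => s _.
have d1 : is_derive s (1 : R) (fun s => s - t) 1.
  by apply: (is_derive_eq (is_deriveB (is_derive_id _ _) (is_derive_cst t s 1)));
    rewrite subr0.
have d2 := is_deriveX 2 d1; have d3 := is_deriveX 3 d1.
have e1 := is_deriveZ c1 d1.
have e2 := is_deriveZ (c2 / 2) d2.
have e3 := is_deriveZ (c3 / 6) d3.
apply: (is_derive_eq (is_deriveD (is_deriveD (is_deriveD (is_derive_cst c0 s 1) e1) e2)
  e3)).
rewrite /= /GRing.scale /=; by field.
Qed.

(** The mean value theorem in the form that raises the order of a remainder
    by one. Dropping the factor [1 / (p + 1)] that integration would give
    spares all factorials in the Taylor estimates below. *)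
Lemma mvt_bound a b g g' s t K p : has_deriv a b g g' -> 0 <= K ->
  s \in `[a, b] -> t \in `[a, b] ->
  (forall c, c \in `]a, b[ -> `|g' c| <= K * `|c - t| ^+ p) ->
  `|g s - g t| <= K * `|s - t| ^+ p.+1.
Proof.
move=> [cg dg] K0 sab tab Hc.
have key x y : x < y -> x \in `[a, b] -> y \in `[a, b] ->
    exists2 c, x < c < y & g y - g x = g' c * (y - x) /\ c \in `]a, b[.
  move=> xy; rewrite !in_itv/= => /andP[ax xb] /andP[ay yb].
  have sub c : c \in `]x, y[ -> c \in `]a, b[.
    rewrite !in_itv/= => /andP[xc cy].
    by rewrite (le_lt_trans ax xc) (lt_le_trans cy yb).
  have cxy : {within `[x, y], continuous g}.
    by apply: continuous_subspaceW cg; apply: subset_itvScc; rewrite bnd_simp.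
  have [c {}cxy ->] := MVT xy (fun c cxy => dg c (sub c cxy)) cxy.
  by exists c; [move: cxy; rewrite in_itv|split => //; exact: sub].
have fin c : c \in `]a, b[ -> `|c - t| <= `|s - t| ->
    `|g' c * (s - t)| <= K * `|s - t| ^+ p.+1.
  move=> cab ct; rewrite normrM exprS mulrCA [leLHS]mulrC.
  rewrite ler_wpM2l// (le_trans (Hc _ cab))// ler_wpM2l//.
  by rewrite lerXn2r ?nnegrE.
have [st|ts|->] := ltgtP s t; last by rewrite !subrr normr0 expr0n mulr0.
- have [c /andP[sc ct] [gE cab]] := key s t st sab tab.
  have -> : g s - g t = g' c * (s - t) by rewrite -opprB gE -mulrN opprB.
  by apply: fin => //; rewrite !ltr0_norm ?subr_lt0//; lra.
- have [c /andP[tc cs] [-> cab]] := key t s ts tab sab.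
  by apply: fin => //; rewrite !gtr0_norm ?subr_gt0//; lra.
Qed.

(** Each Taylor remainder has the previous one as its derivative, so the
    three estimates follow from one another by [mvt_bound], starting from a
    Lipschitz bound on the last derivative. *)
Lemma taylor1 a b g g1 s t K : has_deriv a b g g1 -> 0 <= K ->
  s \in `[a, b] -> t \in `[a, b] ->
  (forall c, c \in `[a, b] -> `|g1 c - g1 t| <= K * `|c - t|) ->
  `|g s - (g t + g1 t * (s - t))| <= K * `|s - t| ^+ 2.
Proof.
move=> dg K0 sab tab H.
have D := has_derivB dg (@has_deriv_cubic a b t (g t) (g1 t) 0 0).
have := mvt_bound (p := 1) D K0 sab tab.
rewrite !subrr !mul0r !mulr0 !addr0 subrr subr0; apply.
move=> c cab; rewrite !mul0r !addr0 expr1; apply: H.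
exact: subset_itv_oo_cc.
Qed.

Lemma taylor2 a b g g1 g2 s t K : has_deriv a b g g1 -> has_deriv a b g1 g2 -> 0 <= K ->
  s \in `[a, b] -> t \in `[a, b] ->
  (forall c, c \in `[a, b] -> `|g2 c - g2 t| <= K * `|c - t|) ->
  `|g s - (g t + g1 t * (s - t) + g2 t / 2 * (s - t) ^+ 2)| <= K * `|s - t| ^+ 3.
Proof.
move=> dg dg1 K0 sab tab H.
have D := has_derivB dg (@has_deriv_cubic a b t (g t) (g1 t) (g2 t) 0).
have := mvt_bound (p := 2) D K0 sab tab.
rewrite !subrr expr0n/= !mul0r !mulr0 !addr0 subrr subr0; apply.
move=> c cab; rewrite !mul0r !addr0; apply: (taylor1 dg1) => //.
exact: subset_itv_oo_cc.
Qed.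

Lemma taylor3 a b g g1 g2 g3 s t K : has_deriv a b g g1 -> has_deriv a b g1 g2 ->
  has_deriv a b g2 g3 -> 0 <= K ->
  s \in `[a, b] -> t \in `[a, b] ->
  (forall c, c \in `[a, b] -> `|g3 c - g3 t| <= K * `|c - t|) ->
  `|g s - (g t + g1 t * (s - t) + g2 t / 2 * (s - t) ^+ 2 + g3 t / 6 * (s - t) ^+ 3)|
  <= K * `|s - t| ^+ 4.
Proof.
move=> dg dg1 dg2 K0 sab tab H.
have D := has_derivB dg (@has_deriv_cubic a b t (g t) (g1 t) (g2 t) (g3 t)).
have := mvt_bound (p := 3) D K0 sab tab.
rewrite !subrr !expr0n/= !mulr0 !addr0 subrr subr0; apply.
move=> c cab; apply: (taylor2 dg1 dg2) => //.
exact: subset_itv_oo_cc.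
Qed.

Lemma within_continuous0 a b h : a < b -> {within `[a, b], continuous h} ->
  (forall x, x \in `]a, b[ -> h x = 0) -> forall x, x \in `[a, b] -> h x = 0.
Proof.
move=> ab ch h0 x; rewrite in_itv/= => /andP[ax xb].
have [_ ha hb] := (continuous_within_itvP _ ab).1 ch.
move: ax; rewrite le_eqVlt => /predU1P[<-|ax].
  have H : h x @[x --> a^'+] --> 0.
    apply: cvg_near_cst; near=> y; apply: h0; rewrite in_itv/=; apply/andP; split; near: y.
      exact: nbhs_right_gt.
    exact: nbhs_right_lt.
  exact: (cvg_unique _ ha H).
move: xb; rewrite le_eqVlt => /predU1P[->|xb]; last by apply: h0; rewrite in_itv/= ax.
have H : h x @[x --> b^'-] --> 0.
  apply: cvg_near_cst; near=> y; apply: h0; rewrite in_itv/=; apply/andP; split; near: y.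
    exact: nbhs_left_gt.
  exact: nbhs_left_lt.
exact: (cvg_unique _ hb H).
Unshelve. all: by end_near. Qed.

(** The differential equations are known for positive times only; this is
    how they are extended to time [0]. *)
Lemma within_continuous_left0 b h K : 0 < b -> {within `[0, b], continuous h} ->
  (forall t, 0 < t <= b -> `|h t| <= K * t) -> h 0 = 0.
Proof.
move=> b0 ch hK; have [_ ha _] := (continuous_within_itvP _ b0).1 ch.
have H : h x @[x --> 0^'+] --> 0.
  apply/norm_cvg0P.
  apply: (@squeeze_cvgr _ _ _ _ (fun=> 0) (fun t => K * t)).
  - near=> t; rewrite normr_ge0/=; apply: hK; apply/andP; split; near: t.
      exact: nbhs_right_gt.
    exact: nbhs_right_le.
  - exact: cvg_cst.
  - rewrite -[X in _ --> X](mulr0 K); apply: cvgM; first exact: cvg_cst.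
    exact: cvg_at_right_filter.
exact: (cvg_unique _ ha H).
Unshelve. all: by end_near. Qed.

End OneVariableCalculus.

(** * Integration by parts and the Poisson problem *)

Section Dirichlet.
Context {R : realType}.
Variable ell : R.
Hypothesis ell_gt0 : 0 < ell.
Implicit Types f g h u w z : R -> R.
Notation mu := (@lebesgue_measure R).
Notation D := (`]0, ell[%classic : set (measurableTypeR R)).
Local Notation inL2 := (inL2 ell).
Local Notation eqL2 := (eqL2 ell).
Local Notation dot := (dotL2 ell).
Local Notation norm2 := (normL2 ell).
Local Notation deriv := (derive_in `[0, ell]).

Lemma dotL2_itvcc g h : {within `[0, ell], continuous g} -> {within `[0, ell],
  continuous h} ->
  dot g h = \int[mu]_(x in `[0, ell]) (g x * h x).
Proof.
move=> cg ch.
have cgh : {within `[0, ell], continuous (fun x => g x * h x)}.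
  by move=> x; apply: continuousM; [exact: cg|exact: ch].
rewrite /dotL2 Rintegral_itv_bndo_bndc; last exact: continuous_integrable.
rewrite Rintegral_itv_obnd_cbnd//.
have sub : (`]0, ell]%classic : set (measurableTypeR R)) `<=` `[0, ell]%classic.
  exact: subset_itv_oc_cc.
apply: (integrableS _ _ sub); [exact: measurable_itv|exact: measurable_itv|].
exact: (continuous_compact_integrable (@segment_compact _ _ _)).
Qed.

Lemma has_deriv_LR g g' : has_deriv 0 ell g g' -> derivable_oo_LRcontinuous g 0 ell.
Proof.
move=> [cg dg]; have [_ h0 h1] := (continuous_within_itvP _ ell_gt0).1 cg.
by split => // x /dg [].
Qed.

Lemma dotL2_by_parts g g' h h' :
  has_deriv 0 ell g g' -> {within `[0, ell], continuous g'} ->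
  has_deriv 0 ell h h' -> {within `[0, ell], continuous h'} ->
  dot g h' = g ell * h ell - g 0 * h 0 - dot g' h.
Proof.
move=> dg cg' dh ch'.
rewrite !dotL2_itvcc//; [|by case: dh|by case: dg].
apply: Rintegration_by_parts => //.
- exact: has_deriv_LR dg.
- by move=> x xl; rewrite derive1E; case: dg => _ /(_ _ xl) [].
- exact: has_deriv_LR dh.
- by move=> x xl; rewrite derive1E; case: dh => _ /(_ _ xl) [].
Qed.

Lemma is_derive_integral f (a x : R) : a < x ->
  (forall y, a < y -> {for y, continuous f}) -> {within `[a, x + 1], continuous f} ->
  is_derive x (1 : R) (fun y => \int[mu]_(t in `[a, y]) f t) (f x).
Proof.
move=> ax cf cwf.
have xu : x < x + 1 by rewrite ltrDl.
have intf : mu.-integrable `[a, x + 1] (EFin \o f).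
  exact: (continuous_compact_integrable (@segment_compact _ _ _)).
have [H1 H2] := continuous_FTC1_closed xu intf ax (cf x ax).
by split; [exact: H1|rewrite -derive1E; exact: H2].
Qed.

(** The primitives start at [-2] and [-1], to the left of the interval, so
    that they are differentiable on both sides of every point of [[0, ell]]. *)
Lemma poisson f : continuous f -> exists w w1,
  [/\ forall x, x \in `[0, ell] -> is_derive x (1 : R) w (w1 x),
      forall x, x \in `[0, ell] -> is_derive x (1 : R) w1 (- f x),
      w 0 = 0 & w ell = 0].
Proof.
move=> cf.
pose F y := \int[mu]_(t in `[-2, y]) f t.
pose W y := \int[mu]_(t in `[-1, y]) F t.
have dF (x : R) : -2 < x -> is_derive x (1 : R) F (f x).
  move=> x2; apply: is_derive_integral => //; first by move=> y _; exact: cf.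
  exact: continuous_subspaceT.
have dW (x : R) : -1 < x -> is_derive x (1 : R) W (F x).
  move=> x1; apply: is_derive_integral => //.
    move=> y y1; have [dy _] : is_derive y (1 : R) F (f y) by apply: dF; lra.
    by apply/differentiable_continuous/derivable1_diffP.
  apply: derivable_within_continuous => y; rewrite in_itv/= => /andP[y1 _].
  by have [] : is_derive y (1 : R) F (f y) by apply: dF; lra.
pose c := (W ell - W 0) / ell.
exists (fun x => c * x - (W x - W 0)), (fun x => c - F x); split.
- move=> x; rewrite in_itv/= => /andP[x0 _].
  have dx : is_derive x (1 : R) W (F x) by apply: dW; lra.
  have dc := is_deriveZ c (is_derive_id x (1 : R)).
  apply: (is_derive_eq (is_deriveB dc (is_deriveB dx (is_derive_cst (W 0) x 1)))).
  by rewrite subr0 /GRing.scale /= mulr1.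
- move=> x; rewrite in_itv/= => /andP[x0 _].
  have dx : is_derive x (1 : R) F (f x) by apply: dF; lra.
  apply: (is_derive_eq (is_deriveB (is_derive_cst c x 1) dx)).
  by rewrite sub0r.
- by rewrite mulr0 !subrr.
- by rewrite /c divfK ?gt_eqF// subrr.
Qed.

Lemma domA0_C2 w w1 w2 :
  (forall x, x \in `[0, ell] -> is_derive x (1 : R) w (w1 x)) ->
  (forall x, x \in `[0, ell] -> is_derive x (1 : R) w1 (w2 x)) ->
  {within `[0, ell], continuous w2} -> w 0 = 0 -> w ell = 0 ->
  dom (opA0 ell) w /\ (forall x, 0 < x < ell -> opA0 ell w x = - w2 x).
Proof.
move=> dw dw1 cw2 w0 wl.
have e1 : {in `[0, ell]%classic, deriv w =1 w1}.
  by move=> x; rewrite inE => xl; have [] := is_derive_in ell_gt0 xl (dw x xl).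
have e2 : {in `[0, ell]%classic, deriv (deriv w) =1 w2}.
  move=> x; rewrite inE => xl; rewrite (eq_derive_in e1 xl).
  by have [] := is_derive_in ell_gt0 xl (dw1 x xl).
have [cw _] := has_deriv_of_is_derive dw.
have [cw1 _] := has_deriv_of_is_derive dw1.
split; last first.
  move=> x /andP[x0 xl]; rewrite /= fctE e2//.
  by rewrite inE/= in_itv/= !ltW.
split => //; split.
- case=> [|[|//]] x _ xl /=; first by have [] := is_derive_in ell_gt0 xl (dw x xl).
  apply: (@eq_derivable_in _ _ w1) => //.
    by move=> y yl; rewrite e1.
  by have [] := is_derive_in ell_gt0 xl (dw1 x xl).
- case=> [_|[_|[_|//]]] //=.
  + by apply: subspace_eq_continuous cw1 => y yl; exact/esym/e1.
  + by apply: subspace_eq_continuous cw2 => y yl; exact/esym/e2.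
Qed.

End Dirichlet.

(** * The Dirichlet operator, its square root and the closed derivative *)

Section Operators.
Context {R : realType}.
Variable ell : R.
Hypothesis ell_gt0 : 0 < ell.
Implicit Types f g h u w z : R -> R.
Local Notation inL2 := (inL2 ell).
Local Notation eqL2 := (eqL2 ell).
Local Notation dot := (dotL2 ell).
Local Notation norm2 := (normL2 ell).
Local Notation deriv := (derive_in `[0, ell]).

Section OneOperator.
Variable A : operator (R := R).
Hypothesis A_linear : linear_operator ell A.

Lemma dom_inL2 u : dom A u -> inL2 u.
Proof. by case: A_linear => H _ _ _ /H[]. Qed.

Lemma app_inL2 u : dom A u -> inL2 (A u).
Proof. by case: A_linear => H _ _ _ /H[]. Qed.

Lemma dom_appB u w : dom A u -> dom A w ->
  dom A (u - w) /\ eqL2 (A (u - w)) (A u - A w).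
Proof.
move=> du dw; case: A_linear => _ _ _ /(_ (-1) w u dw du).
by rewrite !scaleN1r addrC [X in eqL2 _ X]addrC.
Qed.

End OneOperator.

Lemma self_adjoint_sym A u w : self_adjoint ell A -> dom A u -> dom A w ->
  dot (A u) w = dot u (A w).
Proof.
move=> [lA _ H] du dw.
have [_ K] := H u (A u) (dom_inL2 lA du) (app_inL2 lA du).
by apply: K => //; split => //; exact: eqL2_refl.
Qed.

Lemma normL2_0 : norm2 0 = 0.
Proof.
have L0 : inL2 0 by apply: (@inL2_bounded _ _ _ 0) => [|x];
  [exact: measurable_cst|rewrite normr0].
by rewrite -(scale0r (0 : R -> R)) normL2Z// normr0 mul0r.
Qed.

Lemma domA0_has_deriv w : dom (opA0 ell) w ->
  [/\ has_deriv 0 ell w (deriv w), has_deriv 0 ell (deriv w) (deriv (deriv w)),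
      {within `[0, ell], continuous (deriv w)} &
      {within `[0, ell], continuous (deriv (deriv w))}].
Proof.
move=> [Cw _ _]; split.
- exact: (Ck_on_has_deriv Cw (ltn0Sn 1)).
- exact: (Ck_on_has_deriv Cw (ltnSn 1)).
- by case: Cw => _ /(_ 1%N isT).
- by case: Cw => _ /(_ 2%N isT).
Qed.

Section SquareRoot.
Variables A S : operator (R := R).
Hypothesis A_sa : self_adjoint ell A.
Hypothesis A_ext : extends ell A (opA0 ell).
Hypothesis A_pos : positive_definite ell A.
Hypothesis S_sqrt : is_sqrt ell S A.

Let lA : linear_operator ell A. Proof. by case: A_sa. Qed.
Let S_sa : self_adjoint ell S. Proof. by case: S_sqrt. Qed.
Let lS : linear_operator ell S. Proof. by case: S_sa. Qed.

Lemma dom_sqrt u : dom A u -> dom S u.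
Proof. by case: S_sqrt => _ _ H _ /H[]. Qed.

Lemma dotL2_sqrt u w : dom A u -> dom S w -> dot (A u) w = dot (S u) (S w).
Proof.
move=> du dw; have [_ _ H K] := S_sqrt.
have [d1 d2] := (H u).1 du.
rewrite -(self_adjoint_sym S_sa d2 dw).
apply: eqL2_dotl; [exact: app_inL2|exact: app_inL2|exact: dom_inL2 dw|exact: K].
Qed.

Lemma sqrt_inL2 u : dom A u -> inL2 (S u).
Proof. by move=> /dom_sqrt; exact: app_inL2. Qed.

Lemma normL2_sqrt_sqr u : dom A u -> norm2 (S u) ^+ 2 = dot (A u) u.
Proof. by move=> du; rewrite normL2_sqr dotL2_sqrt//; exact: dom_sqrt. Qed.

Lemma normL2_sqrtB u w : dom A u -> dom A w -> norm2 (S (u - w)) = norm2 (S u - S w).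
Proof.
move=> du dw; have [d e] := dom_appB lS (dom_sqrt du) (dom_sqrt dw).
apply: eqL2_norm => //; first exact: app_inL2.
by apply: inL2B; exact: sqrt_inL2.
Qed.

(** [D(A0)] is a core: solve [- w'' = f] for a continuous [f] close to [A z].
    Then [A (z - w)] is small, and positive definiteness bounds first
    [|z - w|] and then [|S (z - w)|^2 = (A (z - w), z - w)]. *)
Lemma core_approx z e : dom A z -> 0 < e -> exists w,
  [/\ dom (opA0 ell) w, norm2 (z - w) <= e & norm2 (S z - S w) <= e].
Proof.
move=> dz e0; have [c c0 Hc] := A_pos.
(* with [c |z|^2 <= (A z, z)], an error [e c] in [A z] is an error [e] in [z] *)
have m0 : 0 < Num.min (e * c) e by rewrite lt_min mulr_gt0.
have [f cf Hf] := continuous_dense (app_inL2 lA dz) m0.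
have [w [w1 [dw dw1 w0 wl]]] := poisson ell_gt0 cf.
have cf' : {within `[0, ell], continuous (fun x => - f x)}.
  by apply: continuous_subspaceT => x; apply: continuousN; exact: cf.
have [d0w Ew] := domA0_C2 ell_gt0 dw dw1 cf' w0 wl.
exists w; have [dAw eAw] := A_ext d0w.
have [dzw ezw] := dom_appB lA dz dAw.
have Lzw := dom_inL2 lA dzw; have LAzw := app_inL2 lA dzw.
have Lf : inL2 f by apply: continuous_inL2; exact: continuous_subspaceT.
have LAz := app_inL2 lA dz.
have nA : norm2 (A (z - w)) <= Num.min (e * c) e.
  rewrite (@eqL2_norm _ _ _ (A z - f)) ?ltW//; first exact: inL2B.
  apply: (eqL2_trans ezw); apply: eqL2B; first exact: eqL2_refl.
  by apply: (eqL2_trans eAw); apply: eqL2_on => x xl; rewrite Ew// opprK.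
have [nA1 nA2] : norm2 (A (z - w)) <= e * c /\ norm2 (A (z - w)) <= e.
  by move: nA; rewrite le_min => /andP[].
have n0 := normL2_ge0 ell (z - w); have nA0 := normL2_ge0 ell (A (z - w)).
have H1 : dot (A (z - w)) (z - w) <= norm2 (A (z - w)) * norm2 (z - w).
  by rewrite (le_trans (ler_norm _))// dotL2_le_normL2.
have H2 : norm2 (z - w) <= e.
  have [->|nz] := eqVneq (norm2 (z - w)) 0; first exact: ltW.
  have np : 0 < norm2 (z - w) by rewrite lt_neqAle eq_sym nz.
  have := le_trans (Hc _ dzw) H1.
  rewrite expr2 mulrA ler_pM2r// => H3.
  by rewrite -(ler_pM2l c0) (le_trans H3)// mulrC.
split => //; rewrite -normL2_sqrtB// -(@ler_pXn2r _ 2)// ?nnegrE ?normL2_ge0 ?(ltW e0)//.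
rewrite normL2_sqrt_sqr// (le_trans H1)// expr2 ler_pM//.
Qed.

Lemma normL2_sqrt_domA0 w : dom (opA0 ell) w -> norm2 (S w) = norm2 (deriv w).
Proof.
move=> d0w; have [dw ew] := A_ext d0w.
have [hw hw1 cw1 cw2] := domA0_has_deriv d0w; have [_ w0 wl] := d0w.
have Lw := dom_inL2 lA dw; have L2 := continuous_inL2 cw2; have L1 := continuous_inL2 cw1.
suff e : norm2 (S w) ^+ 2 = norm2 (deriv w) ^+ 2.
  by apply/eqP; rewrite -(@eqrXn2 _ 2) ?normL2_ge0// e.
rewrite normL2_sqrt_sqr// normL2_sqr (eqL2_dotl _ _ _ ew)//;
  [|exact: app_inL2|exact: inL2N].
by rewrite dotL2Nl// dotL2C (dotL2_by_parts ell_gt0 hw cw1 hw1 cw2)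
  w0 wl !mul0r subrr sub0r opprK.
Qed.

(** The domain of [A] is dense and its elements are approximated by
    [core_approx]; this provides test functions without any mollification. *)
Lemma domA0_dense w e : inL2 w -> 0 < e ->
  exists2 h, dom (opA0 ell) h & norm2 (w - h) <= e.
Proof.
move=> Lw e0; have e20 : 0 < e / 2 by rewrite divr_gt0.
have [_ dA _] := A_sa; have [z dz Hz] := dA w Lw _ e20.
have [h [d0h Hh _]] := core_approx dz e20.
have Lz := dom_inL2 lA dz; have Lh : inL2 h by case: (A_ext d0h) => /(dom_inL2 lA).
exists h => //; rewrite -(subrK z w) -addrA (splitr e).
by rewrite (le_trans (normL2_leD (inL2B Lw Lz) (inL2B Lz Lh)))// lerD// ltW.
Qed.

(** For a test function [h] in [D(A0)], integrating by parts in a sequence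
    [g] with [g -> z], [g' -> w], and back in a sequence [wn] of [D(A0)] tending
    to [z], gives [(w, h) = - (z, h') = lim (wn', h)], hence
    [|(w, h)| <= |S z| |h|]; then let [h] tend to [w]. No boundary value of [g] enters,
    because [h] vanishes at both ends. For [z = 0] the inequality says that
    [d/dx] is closable. *)
Lemma closure_deriv_le_sqrt z w : dom A z -> closure_graph ell (opB0 ell) z w ->
  norm2 w <= norm2 (S z).
Proof.
move=> dz [Lz Lw cl].
have Sz0 := normL2_ge0 ell (S z); have w0 := normL2_ge0 ell w.
have test h : dom (opA0 ell) h -> `|dot w h| <= norm2 (S z) * norm2 h.
  move=> d0h; have [hh _ ch1 _] := domA0_has_deriv d0h; have [_ h0 hl] := d0h.
  have Lh := continuous_inL2 hh.1; have Lh1 := continuous_inL2 ch1.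
  apply: (@ler_of_small_error _ 1 _ _ (2 * norm2 h + 2 * norm2 (deriv h))) => //.
    by rewrite addr_ge0// mulr_ge0// normL2_ge0.
  move=> e /andP[e0 _]; have [g Cg [gz gw]] := cl e e0.
  have [wn [d0n nz nS]] := core_approx dz e0.
  have [hn _ cn1 _] := domA0_has_deriv d0n; have Ln := continuous_inL2 hn.1.
  have Ln1 := continuous_inL2 cn1.
  have hg := Ck_on_has_deriv Cg (ltn0Sn 0); have Lg := continuous_inL2 hg.1.
  have cg1 : {within `[0, ell], continuous (deriv g)} by case: Cg => _ /(_ 1%N isT).
  have Lg1 := continuous_inL2 cg1; rewrite /= in gw hg.
  (* [(w, h)] is [(wn', h)] up to three errors; the boundary terms vanish with [h] *)
  have E : dot w h = - dot (deriv g - w) h - dot (g - z) (deriv h)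
                    - dot (z - wn) (deriv h) + dot (deriv wn) h.
    have e1 := dotL2_by_parts ell_gt0 hg cg1 hh ch1.
    have e2 := dotL2_by_parts ell_gt0 hn cn1 hh ch1.
    rewrite h0 hl !mulr0 subrr sub0r in e1 e2.
    rewrite !(dotL2Dl _ (inL2N _))// !dotL2Nl// e1 e2; ring.
  have b1 := dotL2_le_normL2 (inL2B Lg1 Lw) Lh.
  have b2 := dotL2_le_normL2 (inL2B Lg Lz) Lh1.
  have b3 := dotL2_le_normL2 (inL2B Lz Ln) Lh1.
  have b4 := dotL2_le_normL2 Ln1 Lh.
  have S4 : norm2 (deriv wn) <= norm2 (S z) + e.
    rewrite -normL2_sqrt_domA0// -[S wn](subKr (S z)).
    have [dn _] := A_ext d0n.
    by rewrite (le_trans (normL2_leB _ _)) ?lerD2l//; [exact: sqrt_inL2|apply: inL2B;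
      exact: sqrt_inL2].
  have n1 := normL2_ge0 ell h; have n2 := normL2_ge0 ell (deriv h).
  have c1 : `|dot (deriv g - w) h| <= e * norm2 h
    by rewrite (le_trans b1)// ler_wpM2r// ltW.
  have c2 : `|dot (g - z) (deriv h)| <= e * norm2 (deriv h)
    by rewrite (le_trans b2)// ler_wpM2r// ltW.
  have c3 : `|dot (z - wn) (deriv h)| <= e * norm2 (deriv h)
    by rewrite (le_trans b3)// ler_wpM2r.
  have c4 : `|dot (deriv wn) h| <= (norm2 (S z) + e) * norm2 h
    by rewrite (le_trans b4)// ler_wpM2r.
  rewrite [leRHS](_ : _ = e * norm2 h + e * norm2 (deriv h) + e * norm2 (deriv h)
    + (norm2 (S z) + e) * norm2 h); last by ring.
  rewrite E (le_trans (ler_normD _ _))// lerD// (le_trans (ler_normB _ _))// lerD//.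
  by rewrite (le_trans (ler_normB _ _))// lerD// normrN.
(* density of [D(A0)] allows [h] to be replaced by [w] *)
have : norm2 w ^+ 2 <= norm2 (S z) * norm2 w.
  apply: (@ler_of_small_error _ 1 _ _ (norm2 w + norm2 (S z))) => //;
    first by rewrite addr_ge0.
  move=> e /andP[e0 _]; have [h d0h nh] := domA0_dense Lw e0.
  have Lh : inL2 h by case: (A_ext d0h) => /(dom_inL2 lA).
  have E : norm2 w ^+ 2 = dot w (w - h) + dot w h.
    by rewrite normL2_sqr dotL2Dr ?dotL2Nr//; [rewrite subrK|exact: inL2N].
  have b1 := dotL2_le_normL2 Lw (inL2B Lw Lh).
  have b2 := test h d0h.
  have b3 : norm2 h <= norm2 w + e.
    rewrite -[X in norm2 X <= _](subKr w) (le_trans (normL2_leB _ _)) ?lerD2l//.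
    exact: inL2B.
  have b4 := ler_norm (dot w (w - h)); have b5 := ler_norm (dot w h).
  have b6 : norm2 w * norm2 (w - h) <= norm2 w * e by rewrite ler_wpM2l.
  have b7 : norm2 (S z) * norm2 h <= norm2 (S z) * (norm2 w + e) by rewrite ler_wpM2l.
  rewrite E; lra.
have [->//|wn] := eqVneq (norm2 w) 0.
by rewrite expr2 ler_pM2r// lt_neqAle eq_sym wn.
Qed.

(** With [wn] in [D(A0)] tending to [z], integration by parts gives
    [(S wn, S z) = (- wn'', h) = (wn', h')], which is at most
    [|S wn| |h'|]; pass to the limit. *)
Lemma sqrt_le_deriv z h h' : dom A z -> eqL2 z h -> has_deriv 0 ell h h' ->
  {within `[0, ell], continuous h'} -> h 0 = 0 -> h ell = 0 ->
  norm2 (S z) <= norm2 h'.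
Proof.
move=> dz zh dh ch' h0 hl.
have Lz := dom_inL2 lA dz; have Lh := continuous_inL2 dh.1; have Lh' := continuous_inL2 ch'.
have Sz0 := normL2_ge0 ell (S z); have h'0 := normL2_ge0 ell h'.
have LSz := sqrt_inL2 dz.
have : norm2 (S z) ^+ 2 <= norm2 h' * norm2 (S z).
  apply: (@ler_of_small_error _ 1 _ _ (norm2 h' + norm2 (S z))) => //;
    first by rewrite addr_ge0.
  move=> e /andP[e0 _]; have [w [d0w _ nS]] := core_approx dz e0.
  have [dw ew] := A_ext d0w; have LSw := sqrt_inL2 dw.
  have [hw hw1 cw1 cw2] := domA0_has_deriv d0w.
  have L1 := continuous_inL2 cw1; have L2 := continuous_inL2 cw2.
  have E : norm2 (S z) ^+ 2 = dot (S z - S w) (S z) + dot h' (deriv w).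
    have -> : dot h' (deriv w) = dot (S w) (S z).
      rewrite -(dotL2_sqrt dw (dom_sqrt dz)).
      rewrite (eqL2_dotl (app_inL2 lA dw) (inL2N L2) Lz ew) (eqL2_dotr Lz Lh (inL2N L2) zh).
      by rewrite dotL2Nl// (dotL2C _ (deriv (deriv w)))
        (dotL2_by_parts ell_gt0 dh ch' hw1 cw2) h0 hl !mul0r subrr sub0r opprK.
    by rewrite normL2_sqr dotL2Dl ?dotL2Nl// ?subrK//; exact: inL2N.
  have b1 := dotL2_le_normL2 (inL2B LSz LSw) LSz.
  have b2 := dotL2_le_normL2 Lh' L1.
  have b3 : norm2 (deriv w) <= norm2 (S z) + e.
    rewrite -normL2_sqrt_domA0// -[S w](subKr (S z)).
    by rewrite (le_trans (normL2_leB _ _)) ?lerD2l//; exact: inL2B.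
  have b4 := ler_norm (dot (S z - S w) (S z)); have b5 := ler_norm (dot h' (deriv w)).
  have b6 : norm2 (S z - S w) * norm2 (S z) <= e * norm2 (S z) by rewrite ler_wpM2r.
  have b7 : norm2 h' * norm2 (deriv w) <= norm2 h' * (norm2 (S z) + e) by rewrite ler_wpM2l.
  rewrite E; lra.
have [->//|wn] := eqVneq (norm2 (S z)) 0.
by rewrite expr2 ler_pM2r// lt_neqAle eq_sym wn.
Qed.

End SquareRoot.

Lemma closure_graph_C1 g : Ck_on `[0, ell] 1 g -> closure_graph ell (opB0 ell) g (deriv g).
Proof.
move=> Cg; have cg0 : {within `[0, ell], continuous g} by case: Cg => _ /(_ 0%N isT).
have cg1 : {within `[0, ell], continuous (deriv g)} by case: Cg => _ /(_ 1%N isT).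
split; [exact: continuous_inL2|exact: continuous_inL2|].
by move=> e e0; exists g => //; rewrite /= !subrr normL2_0.
Qed.

Lemma derive_inB g h x : x \in `[0, ell] ->
  derivable_in `[0, ell] g x -> derivable_in `[0, ell] h x ->
  derivable_in `[0, ell] (g - h) x /\ deriv (g - h) x = deriv g x - deriv h x.
Proof.
move=> xl dg dh; have PF := within_itv_proper ell_gt0 xl.
have H : diff_quot (g - h) x y @[y --> within `[0, ell] x^'] --> deriv g x - deriv h x.
  have -> : diff_quot (g - h) x = (fun y => diff_quot g x y - diff_quot h x y).
    by apply/funext => y; rewrite /diff_quot !fctE; ring.
  exact: cvgB dg dh.
split; first by apply/cvg_ex; eexists; exact: H.
exact: cvg_lim H.
Qed.

Lemma Ck_on1B g h : Ck_on `[0, ell] 1 g -> Ck_on `[0, ell] 1 h ->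
  Ck_on `[0, ell] 1 (g - h) /\ {in `[0, ell]%classic, deriv (g - h) =1 deriv g - deriv h}.
Proof.
move=> [dg cg] [dh ch].
have E : {in `[0, ell]%classic, deriv (g - h) =1 deriv g - deriv h}.
  move=> x; rewrite inE => xl.
  by have [] := derive_inB xl (dg 0%N x isT xl) (dh 0%N x isT xl).
split => //; split.
  case=> [|//] x _ xl.
  by have [] := derive_inB xl (dg 0%N x isT xl) (dh 0%N x isT xl).
have cB (k1 k2 : R -> R) : {within `[0, ell], continuous k1} ->
    {within `[0, ell], continuous k2} -> {within `[0, ell], continuous (k1 - k2)}.
  move=> c1 c2; rewrite (_ : k1 - k2 = fun x => k1 x - k2 x)//.
  exact: within_continuousB.
case=> [_|[_|//]] /=; first exact: (cB _ _ (cg 0%N isT) (ch 0%N isT)).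
have := cB _ _ (cg 1%N isT) (ch 1%N isT).
by apply: subspace_eq_continuous => x xl; exact/esym/E.
Qed.

Lemma closure_graphB z w z' w' : closure_graph ell (opB0 ell) z w ->
  closure_graph ell (opB0 ell) z' w' -> closure_graph ell (opB0 ell) (z - z') (w - w').
Proof.
move=> [Lz Lw H] [Lz' Lw' H']; split; [exact: inL2B|exact: inL2B|].
move=> e e0; have e20 : 0 < e / 2 by rewrite divr_gt0.
have [g Cg [gz gw]] := H _ e20; have [g' Cg' [gz' gw']] := H' _ e20.
have [C E] := Ck_on1B Cg Cg'; exists (g - g') => //.
have L k : Ck_on `[0, ell] 1 k -> inL2 k /\ inL2 (deriv k).
  by move=> Ck; have [? ? _] := closure_graph_C1 Ck.
have [Lg Lg1] := L _ Cg; have [Lg' Lg1'] := L _ Cg'.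
have sub k1 k2 k3 k4 : k1 - k2 - (k3 - k4) = (k1 - k3) - (k2 - k4) :> (R -> R).
  by apply/funext => x; rewrite !fctE; ring.
rewrite (splitr e); split.
  rewrite sub (le_lt_trans (normL2_leB (inL2B Lg Lz) (inL2B Lg' Lz')))// ltrD//.
rewrite (@eqL2_norm _ _ _ (deriv g - deriv g' - (w - w'))).
- by rewrite sub (le_lt_trans (normL2_leB (inL2B Lg1 Lw) (inL2B Lg1' Lw')))// ltrD.
- by apply: inL2B; [exact: (L _ C).2|exact: inL2B].
- by apply: inL2B; exact: inL2B.
- apply: eqL2_on => x /andP[x0 xl]; rewrite -[LHS]/(deriv (g - g') x - (w - w') x) E//.
  by rewrite inE/= in_itv/= !ltW.
Qed.

Lemma opB_graph z : dom (opB ell) z -> closure_graph ell (opB0 ell) z (opB ell z).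
Proof. by move=> H; exact: (getPex H). Qed.

End Operators.

(** * The discrete energy identity *)

Section EnergyStep.
Context {R : realType}.
Variable ell : R.
Implicit Types f g z : R -> R.
Local Notation inL2 := (inL2 ell).
Local Notation eqL2 := (eqL2 ell).
Local Notation dot := (dotL2 ell).
Local Notation norm2 := (normL2 ell).

(** Test with [z2 - z0 = a + b] where [a = z2 - z1] and [b = z1 - z0]: the
    second difference is [a - b], so it contributes [|a|^2 - |b|^2], and the
    cross terms of the elliptic part cancel by symmetry. *)
Lemma energy_step z0 z1 z2 b0 b2 g (q tau : R) : 0 < tau ->
  inL2 z0 -> inL2 z1 -> inL2 z2 -> inL2 b0 -> inL2 b2 -> inL2 g ->
  eqL2 (fun x => (z2 x - 2 * z1 x + z0 x) / tau ^+ 2 + q * ((b2 x + b0 x) / 2)) g ->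
  dot b2 z0 = dot b0 z2 ->
  (norm2 (z2 - z1) / tau) ^+ 2 - (norm2 (z1 - z0) / tau) ^+ 2
  + q / 2 * (dot b2 z2 - dot b0 z0)
  <= tau * norm2 g * (norm2 (z2 - z1) / tau + norm2 (z1 - z0) / tau).
Proof.
move=> t0 L0 L1 L2 Lb0 Lb2 Lg eg sym.
set a := z2 - z1; set b := z1 - z0.
have La : inL2 a by exact: inL2B.
have Lb : inL2 b by exact: inL2B.
have Lab : inL2 (a + b) by exact: inL2D.
have tn : tau != 0 by rewrite gt_eqF.
have eg' : eqL2 ((tau ^- 2) *: (a - b) + (q / 2) *: (b2 + b0)) g.
  apply: eqL2_trans eg; apply: eqL2_on => x _.
  by rewrite /a /b !fctE /GRing.scale /=; field.
have L3 : inL2 (tau ^- 2 *: (a - b)) by apply: inL2Z; exact: inL2B.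
have L4 : inL2 ((q / 2) *: (b2 + b0)) by apply: inL2Z; exact: inL2D.
have := eqL2_dotl (inL2D L3 L4) Lg Lab eg'.
rewrite (dotL2Dl L3 L4 Lab) dotL2Zl//; last exact: inL2B.
rewrite (dotL2Zl _ (inL2D Lb2 Lb0) Lab).
have -> : dot (a - b) (a + b) = norm2 a ^+ 2 - norm2 b ^+ 2.
  rewrite (dotL2Dl La (inL2N Lb) Lab) (dotL2Nl Lb Lab) (dotL2Dr La Lb La)
    (dotL2Dr La Lb Lb).
  by rewrite !normL2_sqr (dotL2C _ b a); ring.
have -> : dot (b2 + b0) (a + b) = dot b2 z2 - dot b0 z0.
  have -> : a + b = z2 - z0 by rewrite /a /b addrA subrK.
  have L20 := inL2B L2 L0.
  rewrite (dotL2Dl Lb2 Lb0 L20) !(dotL2Dr L2 (inL2N L0))// !(dotL2Nr L0)// sym; ring.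
move=> E.
have -> : (norm2 a / tau) ^+ 2 - (norm2 b / tau) ^+ 2 =
  tau ^- 2 * (norm2 a ^+ 2 - norm2 b ^+ 2) by field.
rewrite E (le_trans (ler_norm _))// (le_trans (dotL2_le_normL2 Lg Lab))//.
have -> : tau * norm2 g * (norm2 a / tau + norm2 b / tau)
  = norm2 g * (norm2 a + norm2 b) by field.
by rewrite ler_wpM2l ?normL2_ge0// normL2_leD.
Qed.

End EnergyStep.

(** * Discrete Gronwall argument for the energy *)

Section Bootstrap.
Context {R : realType}.
Implicit Types (tau C : R).

(** Divide by [e' + e]: an inequality between energies becomes one between
    their square roots. *)
Lemma sqr_gronwall_step (e e' X : R) : 0 <= e -> 0 <= e' -> 0 <= X ->
  e' ^+ 2 - e ^+ 2 <= X * (e' + e) -> e' <= e + X.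
Proof.
move=> e0 e'0 X0 H; have [s0|s0] := eqVneq (e' + e) 0; first lra.
have sp : 0 < e' + e by rewrite lt_neqAle eq_sym s0 addr_ge0.
by rewrite -lerBlDl -(ler_pM2r sp) (le_trans _ H)// subr_sqr.
Qed.

(** What the energy method knows about the errors of a run with step [tau].
    Here [D] and [F] are the norms of the difference quotients in time of the
    two errors, [s] and [p] those of [A^(1/2)] applied to the errors, [y] the
    norm of the second error; [q] is the discrete coefficient and [Q] the exact
    one; [G] and [H] bound the right-hand sides of the error equations. *)
Record energy_system (alpha gamma delta C tau : R) (m : nat)
    (D F s p y q Q G H : nat -> R) : Prop := EnergySystem {
  es_ge0 : forall k, [/\ 0 <= D k, 0 <= F k, 0 <= s k & 0 <= p k];
  es_coercive : forall k, alpha <= q k;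
  es_step_u : forall k, (0 < k < m)%N ->
    D k ^+ 2 - D k.-1 ^+ 2 + q k / 2 * (s k.+1 ^+ 2 - s k.-1 ^+ 2)
    <= tau * G k * (D k + D k.-1);
  es_step_v : forall k, (0 < k < m)%N ->
    F k ^+ 2 - F k.-1 ^+ 2 + (gamma * (p k.+1 ^+ 2 - p k.-1 ^+ 2)
      + delta * (y k.+1 ^+ 2 - y k.-1 ^+ 2)) / 2
    <= tau * H k * (F k + F k.-1);
  es_source_u : forall k, (0 < k < m)%N -> G k <= C * (tau ^+ 2 + s k + s k ^+ 2 + p k);
  es_source_v : forall k, (0 < k < m)%N -> H k <= C * (tau ^+ 2 + s k);
  es_coefficient : forall k, (k < m)%N -> `|q k - Q k| <= C * (s k + s k ^+ 2);
  es_lipschitz : forall k, (0 < k < m)%N -> `|Q k - Q k.-1| <= C * tau }.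

(** Let [e_k] be the square root of the energy. If [e_k <= M tau^2], then
    [s_k] and [s_{k+1}] are at most [tau], so that [q_{k+1} - q_k = O(tau)] and
    the nonlinear source terms are of the order of [e_k]; then
    [e_{k+1} <= e_k + C2 tau (tau^2 + e_k) <= e_k + C2 (1 + M) tau^3]. Summing
    over [k < m] keeps [e_k <= (C0 + 1) tau^2 = M tau^2] as long as
    [m tau C2 (1 + M) <= 1], which is the smallness of the time interval. The
    number [kappa] is such that the energy controls [s] and [p]. *)
Lemma energy_bootstrap (m : nat) (tau alpha gamma delta kappa C C0 : R)
    (D F s p y q Q G H : nat -> R) :
  let E k := D k ^+ 2 + F k ^+ 2 + q k / 2 * (s k.+1 ^+ 2 + s k ^+ 2)
    + (gamma * (p k.+1 ^+ 2 + p k ^+ 2) + delta * (y k.+1 ^+ 2 + y k ^+ 2)) / 2 in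
  let C2 := 2 * (C * (1 + 3 * kappa)) + 5 * C * kappa ^+ 2 in
  let M := C0 + 1 in
  0 < tau -> tau <= 1 -> 0 < alpha -> 0 < gamma -> 0 <= delta ->
  0 <= kappa -> 2 <= kappa ^+ 2 * alpha -> 2 <= kappa ^+ 2 * gamma ->
  0 <= C -> 0 <= C0 -> kappa * M * tau <= 1 -> m%:R * tau * (C2 * (1 + M)) <= 1 ->
  energy_system alpha gamma delta C tau m D F s p y q Q G H ->
  E 0%N <= (C0 * tau ^+ 2) ^+ 2 ->
  forall k, (k < m)%N ->
    [/\ s k.+1 <= kappa * (M * tau ^+ 2), p k.+1 <= kappa * (M * tau ^+ 2),
        D k <= M * tau ^+ 2 & F k <= M * tau ^+ 2].
Proof.
move=> E C2 M t0 t1 a0 g0 d0 k0 ka kg C_0 C00 kM mT.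
move=> [nn hq step1 step2 hG hH hqQ hQ] E0.
have t2 : 0 <= tau ^+ 2 by rewrite sqr_ge0.
have q0 k : 0 <= q k by rewrite (le_trans _ (hq k))// ltW.
have M0 : 0 <= M by rewrite /M; lra.
have C20 : 0 <= C2.
  by rewrite /C2 addr_ge0// !mulr_ge0// ?addr_ge0 ?mulr_ge0// sqr_ge0.
have term k : [/\ 0 <= D k ^+ 2, 0 <= F k ^+ 2, 0 <= q k / 2 * s k.+1 ^+ 2,
    0 <= q k / 2 * s k ^+ 2 & 0 <= gamma * p k.+1 ^+ 2 /\ 0 <= gamma * p k ^+ 2
    /\ 0 <= delta * y k.+1 ^+ 2 /\ 0 <= delta * y k ^+ 2].
  have q2 : 0 <= q k / 2 by rewrite divr_ge0.
  split; rewrite ?sqr_ge0 ?(mulr_ge0 q2 (sqr_ge0 _))//.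
  by rewrite !(mulr_ge0 (ltW g0) (sqr_ge0 _)) !(mulr_ge0 d0 (sqr_ge0 _)).
have Ege0 k : 0 <= E k by have [? ? ? ? [? [? [? ?]]]] := term k; rewrite /E; lra.
pose e k := Num.sqrt (E k).
have e0 k : 0 <= e k by exact: sqrtr_ge0.
have eE k : e k ^+ 2 = E k by rewrite sqr_sqrtr.
have De k : D k <= e k.
  have [Dk _ _ _] := nn k; rewrite -(@ler_pXn2r _ 2)// ?nnegrE// eE.
  have [? ? ? ? [? [? [? ?]]]] := term k; rewrite /E; lra.
have Fe k : F k <= e k.
  have [_ Fk _ _] := nn k; rewrite -(@ler_pXn2r _ 2)// ?nnegrE// eE.
  have [? ? ? ? [? [? [? ?]]]] := term k; rewrite /E; lra.
(* a weight [w >= 2 / kappa ^+ 2] on [a ^+ 2 / 2] inside the energy bounds [a] *)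
have root (w a : R) k : 0 <= a -> 2 <= kappa ^+ 2 * w -> w / 2 * a ^+ 2 <= E k ->
  a <= kappa * e k.
  move=> an kw wE; rewrite -(@ler_pXn2r _ 2)// ?nnegrE ?mulr_ge0// exprMn eE.
  apply: (@le_trans _ _ (kappa ^+ 2 * (w / 2 * a ^+ 2)));
    last by rewrite ler_wpM2l// sqr_ge0.
  have h : 1 <= kappa ^+ 2 * (w / 2) by lra.
  by rewrite [leRHS]mulrA -[leLHS]mul1r ler_wpM2r// sqr_ge0.
have wq k : alpha / 2 * s k.+1 ^+ 2 <= E k /\ alpha / 2 * s k ^+ 2 <= E k.
  have [? ? ? ? [? [? [? ?]]]] := term k.
  have h1 : alpha / 2 * s k.+1 ^+ 2 <= q k / 2 * s k.+1 ^+ 2.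
    by rewrite ler_wpM2r ?sqr_ge0// ler_pM2r.
  have h2 : alpha / 2 * s k ^+ 2 <= q k / 2 * s k ^+ 2.
    by rewrite ler_wpM2r ?sqr_ge0// ler_pM2r.
  by rewrite /E; split; lra.
have s1e k : s k.+1 <= kappa * e k.
  by have [_ _ ? _] := nn k.+1; apply: (root alpha) => //; have [] := wq k.
have s0e k : s k <= kappa * e k.
  by have [_ _ ? _] := nn k; apply: (root alpha) => //; have [] := wq k.
have p1e k : p k.+1 <= kappa * e k.
  have [_ _ _ ?] := nn k.+1; apply: (root gamma) => //.
  by have [? ? ? ? [? [? [? ?]]]] := term k; rewrite /E; lra.
have step k : (k.+1 < m)%N -> e k <= M * tau ^+ 2 ->
  e k.+1 <= e k + tau * (C2 * (tau ^+ 2 + e k)).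
  move=> km eM; have km' := ltnW km.
  have ks : (0 < k.+1 < m)%N by [].
  have small : kappa * e k <= tau.
    apply: (@le_trans _ _ (kappa * (M * tau ^+ 2))); first by rewrite ler_wpM2l.
    by rewrite expr2 !mulrA -[leRHS]mul1r ler_pM2r.
  have sk1 := le_trans (s1e k) small; have sk0 := le_trans (s0e k) small.
  have [_ _ sp1 _] := nn k.+1; have [_ _ sp0 _] := nn k.
  have sq1 : s k.+1 ^+ 2 <= s k.+1.
    by rewrite expr2 ler_piMr//; lra.
  have sq0 : s k ^+ 2 <= s k by rewrite expr2 ler_piMr//; lra.
  set X := tau ^+ 2 + e k; have X0 : 0 <= X by rewrite addr_ge0.
  have kX : kappa * e k <= kappa * X by rewrite ler_wpM2l// /X lerDr.
  have ktX : 0 <= kappa * X by rewrite mulr_ge0.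
  have GX : G k.+1 <= C * (1 + 3 * kappa) * X.
    rewrite (le_trans (hG _ ks))// -mulrA ler_wpM2l//.
    have := s1e k; have := p1e k; have : tau ^+ 2 <= X by rewrite /X lerDl.
    lra.
  have HX : H k.+1 <= C * (1 + 3 * kappa) * X.
    rewrite (le_trans (hH _ ks))// -mulrA ler_wpM2l//.
    have := s1e k; have : tau ^+ 2 <= X by rewrite /X lerDl.
    lra.
  have dq : `|q k.+1 - q k| <= 5 * C * tau.
    have h1 := hqQ _ km; have h2 := hqQ _ km'; have h3 := hQ _ ks.
    have -> : q k.+1 - q k = (q k.+1 - Q k.+1) + (Q k.+1 - Q k) + (Q k - q k) by ring.
    have c1 : C * (s k.+1 + s k.+1 ^+ 2) <= C * (2 * tau) by rewrite ler_wpM2l//; lra.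
    have c2 : C * (s k + s k ^+ 2) <= C * (2 * tau) by rewrite ler_wpM2l//; lra.
    rewrite (le_trans (ler_normD _ _))// [`|Q k - q k|]distrC.
    have := ler_normD (q k.+1 - Q k.+1) (Q k.+1 - Q k); rewrite /= in h3; lra.
  have c1 : tau * G k.+1 * (D k.+1 + D k) <= tau * (C * (1 + 3 * kappa) * X)
    * (e k.+1 + e k).
    have [? _ _ _] := nn k; have [? _ _ _] := nn k.+1.
    apply: (@le_trans _ _ (tau * (C * (1 + 3 * kappa) * X) * (D k.+1 + D k))).
      by rewrite ler_wpM2r ?addr_ge0// ler_wpM2l// ltW.
    rewrite ler_wpM2l ?lerD// !mulr_ge0 ?(ltW t0)//; lra.
  have c2 : tau * H k.+1 * (F k.+1 + F k) <= tau * (C * (1 + 3 * kappa) * X)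
    * (e k.+1 + e k).
    have [_ ? _ _] := nn k; have [_ ? _ _] := nn k.+1.
    apply: (@le_trans _ _ (tau * (C * (1 + 3 * kappa) * X) * (F k.+1 + F k))).
      by rewrite ler_wpM2r ?addr_ge0// ler_wpM2l// ltW.
    rewrite ler_wpM2l ?lerD// !mulr_ge0 ?(ltW t0)//; lra.
  have c3 : (q k.+1 - q k) / 2 * (s k.+1 ^+ 2 + s k ^+ 2)
      <= tau * (5 * C * kappa ^+ 2 * X) * (e k.+1 + e k).
    have ss : s k.+1 ^+ 2 + s k ^+ 2 <= 2 * (kappa ^+ 2 * (X * (e k.+1 + e k))).
      have ee : e k ^+ 2 <= X * (e k.+1 + e k).
        by rewrite expr2 ler_pM// ?lerDr// /X lerDr.
      have b1 : s k.+1 ^+ 2 <= (kappa * e k) ^+ 2 by rewrite lerXn2r ?nnegrE ?mulr_ge0.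
      have b0 : s k ^+ 2 <= (kappa * e k) ^+ 2 by rewrite lerXn2r ?nnegrE ?mulr_ge0.
      have b2 : kappa ^+ 2 * e k ^+ 2 <= kappa ^+ 2 * (X * (e k.+1 + e k)).
        by rewrite ler_wpM2l// sqr_ge0.
      by rewrite exprMn in b1 b0; lra.
    have ss0 : 0 <= s k.+1 ^+ 2 + s k ^+ 2 by rewrite addr_ge0// sqr_ge0.
    apply: (@le_trans _ _ (5 * C * tau / 2 * (s k.+1 ^+ 2 + s k ^+ 2))).
      by rewrite ler_wpM2r// ler_pM2r// (le_trans (ler_norm _)).
    apply: (@le_trans _ _ (5 * C * tau / 2 * (2 * (kappa ^+ 2 * (X * (e k.+1 + e k)))))).
      by rewrite ler_wpM2l// divr_ge0// !mulr_ge0// ltW.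
    by rewrite le_eqVlt; apply/orP; left; apply/eqP; field.
  have h1 := step1 _ ks; have h2 := step2 _ ks; rewrite /= in h1 h2.
  apply: sqr_gronwall_step => //; first by rewrite !mulr_ge0// ltW.
  rewrite !eE -/X.
  have -> : tau * (C2 * X) * (e k.+1 + e k) = 
    tau * (C * (1 + 3 * kappa) * X) * (e k.+1 + e k)
    + tau * (C * (1 + 3 * kappa) * X) * (e k.+1 + e k)
    + tau * (5 * C * kappa ^+ 2 * X) * (e k.+1 + e k) by rewrite /C2; ring.
  apply: le_trans (lerD (lerD c1 c2) c3).
  apply: le_trans (lerD (lerD h1 h2) (lexx _)).
  by rewrite /E le_eqVlt; apply/orP; left; apply/eqP; field.
have lin k : (k < m)%N -> k%:R * tau * (C2 * (1 + M)) <= 1.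
  move=> km; apply: le_trans mT; apply: ler_wpM2r; first by rewrite mulr_ge0// addr_ge0.
  by rewrite ler_pM2r// ler_nat ltnW.
have bound k : (k < m)%N -> e k <= (C0 + k%:R * tau * (C2 * (1 + M))) * tau ^+ 2.
  elim: k => [|k IH] km.
    have C0t : 0 <= C0 * tau ^+ 2 by rewrite mulr_ge0.
    by rewrite !mul0r addr0 -(@ler_pXn2r _ 2)// ?nnegrE// eE.
  have ek := IH (ltnW km); have l := lin _ (ltnW km).
  have eM : e k <= M * tau ^+ 2.
    by apply: (le_trans ek); rewrite ler_wpM2r// /M lerD2l.
  apply: (le_trans (step k km eM)).
  have h : tau * (C2 * (tau ^+ 2 + e k)) <= tau * (C2 * ((1 + M) * tau ^+ 2)).
    rewrite ler_pM2l// ler_wpM2l// mulrDl mul1r lerD2l//.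
  apply: (le_trans (lerD ek h)).
  by rewrite -natr1 le_eqVlt; apply/orP; left; apply/eqP; ring.
move=> k km; have eM : e k <= M * tau ^+ 2.
  by apply: (le_trans (bound k km)); rewrite ler_wpM2r// /M lerD2l lin.
split.
- by rewrite (le_trans (s1e k))// ler_wpM2l.
- by rewrite (le_trans (p1e k))// ler_wpM2l.
- exact: le_trans (De k) eM.
- exact: le_trans (Fe k) eM.
Qed.

(** As [(1 + B)^2 >= B], the number [1 + B] serves as the constant [C0] of
    [energy_bootstrap]. *)
Lemma initial_energy (gamma delta K C0 t d f s p y q : R) :
  0 <= gamma -> 0 <= delta -> 0 <= q -> q <= K -> 0 <= C0 -> 0 <= t ->
  0 <= d -> 0 <= f -> 0 <= s -> 0 <= p -> 0 <= y ->
  d <= C0 * t -> f <= C0 * t -> s <= C0 * t -> p <= C0 * t -> y <= C0 * t ->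
  d ^+ 2 + f ^+ 2 + q / 2 * s ^+ 2 + (gamma * p ^+ 2 + delta * y ^+ 2) / 2
  <= ((1 + (2 + K / 2 + (gamma + delta) / 2) * C0 ^+ 2) * t) ^+ 2.
Proof.
move=> g0 dl0 q0 qK C00 t0 d0 f0 s0 p0 y0 dC fC sC pC yC.
have sq (a : R) : 0 <= a -> a <= C0 * t -> a ^+ 2 <= C0 ^+ 2 * t ^+ 2.
  by move=> a0 aC; rewrite -exprMn lerXn2r ?nnegrE// mulr_ge0.
set B := (2 + K / 2 + (gamma + delta) / 2) * C0 ^+ 2.
have B0 : 0 <= B by apply: mulr_ge0; [lra|exact: sqr_ge0].
apply: (@le_trans _ _ (B * t ^+ 2)).
  have hs : q / 2 * s ^+ 2 <= K / 2 * (C0 ^+ 2 * t ^+ 2).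
    by rewrite ler_pM ?sqr_ge0 ?sq// ?divr_ge0// ler_pM2r.
  have hp := ler_wpM2l g0 (sq p p0 pC); have hy := ler_wpM2l dl0 (sq y y0 yC).
  have hd := sq d d0 dC; have hf := sq f f0 fC.
  rewrite [leRHS](_ : _ = C0 ^+ 2 * t ^+ 2 + C0 ^+ 2 * t ^+ 2 + K / 2 * (C0 ^+ 2 * t ^+ 2)
    + (gamma * (C0 ^+ 2 * t ^+ 2) + delta * (C0 ^+ 2 * t ^+ 2)) / 2);
      last by rewrite /B; field.
  by rewrite lerD// ?lerD// ler_pM2r// lerD.
rewrite [leRHS]exprMn; apply: ler_wpM2r; first exact: sqr_ge0.
by rewrite expr2 (le_trans (_ : _ <= 1 + B)) ?lerDr// ler_peMl ?addr_ge0// lerDl.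
Qed.

(** The constants of [energy_bootstrap] depend on the data only: [Tb] meets its
    smallness conditions for all steps [tau <= Tb] at once. *)
Lemma energy_system_bound (alpha gamma delta C C0 K : R) :
  0 < alpha -> 0 < gamma -> 0 <= delta -> 0 <= C -> 0 <= C0 -> 0 <= K ->
  exists Tb M, [/\ 0 < Tb, 0 < M &
    forall (m : nat) (tau : R) (D F s p y q Q G H : nat -> R),
    0 < tau -> tau <= Tb -> m%:R * tau <= Tb ->
    energy_system alpha gamma delta C tau m D F s p y q Q G H ->
    q 0%N <= K -> s 0%N = 0 -> p 0%N = 0 -> y 0%N = 0 -> 0 <= y 1%N ->
    D 0%N <= C0 * tau ^+ 2 -> F 0%N <= C0 * tau ^+ 2 ->
    s 1%N <= C0 * tau ^+ 2 -> p 1%N <= C0 * tau ^+ 2 -> y 1%N <= C0 * tau ^+ 2 ->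
    forall k, (k < m)%N -> [/\ s k.+1 <= M * tau ^+ 2, p k.+1 <= M * tau ^+ 2,
      D k <= M * tau ^+ 2 & F k <= M * tau ^+ 2]].
Proof.
move=> a0 g0 d0 C_0 C00 K0.
pose kappa := Num.sqrt (2 / alpha + 2 / gamma).
have kappa0 : 0 <= kappa by exact: sqrtr_ge0.
have a2inv : 0 <= 2 / alpha by rewrite divr_ge0// ltW.
have g2inv : 0 <= 2 / gamma by rewrite divr_ge0// ltW.
have kappaE : kappa ^+ 2 = 2 / alpha + 2 / gamma by rewrite sqr_sqrtr// addr_ge0.
have ka : 2 <= kappa ^+ 2 * alpha.
  by rewrite kappaE mulrDl divfK ?gt_eqF// lerDl (mulr_ge0 g2inv (ltW a0)).
have kg : 2 <= kappa ^+ 2 * gamma.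
  by rewrite kappaE mulrDl divfK ?gt_eqF// lerDr (mulr_ge0 a2inv (ltW g0)).
(* the constant of [initial_energy] *)
pose B := 1 + (2 + K / 2 + (gamma + delta) / 2) * C0 ^+ 2.
have B0 : 0 <= B.
  by rewrite addr_ge0// mulr_ge0 ?sqr_ge0// !addr_ge0// ?divr_ge0// addr_ge0// ltW.
pose C2 := 2 * (C * (1 + 3 * kappa)) + 5 * C * kappa ^+ 2.
have C20 : 0 <= C2.
  apply: addr_ge0; last by rewrite !mulr_ge0// sqr_ge0.
  by rewrite mulr_ge0// mulr_ge0// addr_ge0// mulr_ge0.
pose M := B + 1.
have M0 : 0 < M by rewrite ltr_wpDl.
have k1 : 0 < kappa * M + 1 by rewrite ltr_wpDl// mulr_ge0// ltW.
have c1 : 0 < C2 * (1 + M) + 1 by rewrite ltr_wpDl// mulr_ge0// addr_ge0// ltW.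
pose Tb := Num.min 1 (Num.min (1 / (kappa * M + 1)) (1 / (C2 * (1 + M) + 1))).
have [Tb1 Tb2 Tb3] : [/\ Tb <= 1, Tb <= 1 / (kappa * M + 1) & Tb <= 1 / (C2 * (1 + M) + 1)].
  by rewrite /Tb; split; rewrite !ge_min lexx ?orbT.
exists Tb, (kappa * M + M); split.
- by rewrite !lt_min ltr01 (divr_gt0 ltr01 k1) (divr_gt0 ltr01 c1).
- by rewrite ltr_wpDl// mulr_ge0// ltW.
move=> m tau D F s p y q Q G H t0 tT mT sys q0K s00 p00 y00 y1 dC fC sC pC yC k km.
have t2 : 0 <= tau ^+ 2 by rewrite sqr_ge0.
have tau1 := le_trans tT Tb1.
have kM : kappa * M * tau <= 1.
  have := le_trans tT Tb2; rewrite ler_pdivlMr//; apply: le_trans.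
  by rewrite mulrC ler_pM2l// lerDl.
have mC : m%:R * tau * (C2 * (1 + M)) <= 1.
  have := le_trans mT Tb3; rewrite ler_pdivlMr//; apply: le_trans.
  by rewrite ler_wpM2l ?lerDl// mulr_ge0// ltW.
have [[D0 F0 _ _] [_ _ s1 p1]] := (es_ge0 sys 0%N, es_ge0 sys 1%N).
have qa : 0 <= q 0%N by rewrite (le_trans (ltW a0))// (es_coercive sys).
have E0 := initial_energy (ltW g0) d0 qa q0K C00 t2 D0 F0 s1 p1 y1 dC fC sC pC yC.
have [|b1 b2 b3 b4] := energy_bootstrap t0 tau1 a0 g0 d0 kappa0 ka kg C_0 B0 kM mC sys _ km.
  by rewrite s00 p00 y00 expr0n/= !addr0.
have big : M * tau ^+ 2 <= (kappa * M + M) * tau ^+ 2.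
  by rewrite ler_wpM2r// lerDr mulr_ge0// ltW.
have kbig : kappa * (M * tau ^+ 2) <= (kappa * M + M) * tau ^+ 2.
  by rewrite mulrA ler_wpM2r// lerDl ltW.
by split; [exact: le_trans b1 kbig|exact: le_trans b2 kbig|exact: le_trans b3
  big|exact: le_trans b4 big].
Qed.

End Bootstrap.

(** * Taylor expansion in time on the rectangle *)

Section Rectangle.
Context {R : realType}.
Variables ell T : R.
Hypothesis T_gt0 : 0 < T.
Implicit Types (w : R -> R -> R) (x t s tau : R).
Local Notation Dx := (dx ell).
Local Notation Dt := (dt T).

Lemma continuous_rect_x w t : continuous_rect ell T w -> t \in `[0, T] ->
  {within `[0, ell], continuous (w ^~ t)}.
Proof.
move=> /subspace_continuousP cw tT; apply/subspace_continuousP => x xl P nP.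
have [|[U V] /= [nU nV] UV] := cw (x, t) _ P nP; first by split.
apply: (@filterS _ (nbhs x) _ U) => // y Uy yl.
apply: (UV (y, t)); last by split.
by split => //; exact: nbhs_singleton nV.
Qed.

Lemma continuous_rect_t w x : continuous_rect ell T w -> x \in `[0, ell] ->
  {within `[0, T], continuous (w x)}.
Proof.
move=> /subspace_continuousP cw xl; apply/subspace_continuousP => t tT P nP.
have [|[U V] /= [nU nV] UV] := cw (x, t) _ P nP; first by split.
apply: (@filterS _ (nbhs t) _ V) => // s Vs sT.
apply: (UV (x, s)); last by split.
by split => //; exact: nbhs_singleton nU.
Qed.

(** The rectangle is compact. *)
Lemma continuous_rect_bounded w : continuous_rect ell T w -> exists2 M, 0 <= M &
  forall x t, x \in `[0, ell] -> t \in `[0, T] -> `|w x t| <= M.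
Proof.
move=> cw.
have cK : compact ([set` `[0, ell]] `*` [set` `[0, T]]).
  by apply: compact_setX; exact: segment_compact.
have /ex_strict_bound_gt0[k k0 /= Hk] :
    bounded_set ((fun p : R * R => w p.1 p.2) @` ([set` `[0, ell]] `*` [set` `[0, T]])).
  exact/compact_bounded/continuous_compact.
exists k; first exact: ltW.
by move=> x t xl tT; apply/ltW/Hk; exists (x, t).
Qed.

Lemma Ck_t_has_deriv k w j x : Ck_t ell T k w -> (j < k)%N -> x \in `[0, ell] ->
  has_deriv 0 T (iter j Dt w x) (iter j.+1 Dt w x).
Proof.
move=> [dw cw] jk xl; split.
  by apply: continuous_rect_t => //; exact/cw/ltnW.
move=> t tT; apply: derive_in_interior => //; apply: dw => //.
exact: subset_itv_oo_cc.
Qed.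

Lemma Ck_xW k j w : (j <= k)%N -> Ck_x ell T k w -> Ck_x ell T j w.
Proof.
move=> jk [dw cw]; split => i; first by move=> x t ij; apply: dw; exact: leq_trans jk.
by move=> ij; apply: cw; exact: leq_trans jk.
Qed.

Lemma iter_dx_slice w j t : iter j Dx w ^~ t = iter j (derive_in `[0, ell]) (w ^~ t).
Proof. by elim: j => //= j <-. Qed.

Lemma Ck_x_slice k w t : Ck_x ell T k w -> t \in `[0, T] -> Ck_on `[0, ell] k (w ^~ t).
Proof.
move=> [dw cw] tT; split.
  by move=> j x jk xl; rewrite -iter_dx_slice; exact: dw.
by move=> j jk; rewrite -iter_dx_slice; apply: continuous_rect_x => //; exact: cw.
Qed.

Definition lipschitz_bound w : Prop := exists2 K, 0 <= K &
  forall x s t, x \in `[0, ell] -> s \in `[0, T] -> t \in `[0, T] ->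
    `|w x s - w x t| <= K * `|s - t|.

Lemma lipschitz_tP w : lipschitz_t ell T w -> lipschitz_bound w.
Proof.
move=> [K H]; exists `|K| => // x s t xl sT tT.
by apply: (le_trans (H x xl (s, t) _)) => //=; rewrite ler_wpM2r// ler_norm.
Qed.

Lemma lipschitz_Ck_t w : Ck_t ell T 1 w -> lipschitz_bound w.
Proof.
move=> Cw; have [M M0 HM] := continuous_rect_bounded (Cw.2 1%N isT).
exists M => // x s t xl sT tT; rewrite -[`|s - t|]expr1.
apply: (mvt_bound (p := 0) (Ck_t_has_deriv Cw (ltnSn 0) xl)) => // c cT.
by rewrite expr0 mulr1 HM//; exact: subset_itv_oo_cc.
Qed.

Lemma Ck_t_dt k w : Ck_t ell T k.+1 w -> Ck_t ell T k (Dt w).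
Proof.
move=> [dw cw]; split.
  by move=> j x t jk; rewrite -iterSr; exact: dw.
by move=> j jk; rewrite -iterSr; exact: cw.
Qed.

Lemma Ck_tW k j w : (j <= k)%N -> Ck_t ell T k w -> Ck_t ell T j w.
Proof.
move=> jk [dw cw]; split => i; first by move=> x t ij; apply: dw; exact: leq_trans jk.
by move=> ij; apply: cw; exact: leq_trans jk.
Qed.

(** The odd terms of the two third-order expansions at [t + tau] and
    [t - tau] cancel. *)
Lemma second_difference_error w : Ck_t ell T 3 w -> lipschitz_t ell T (Dt (Dt (Dt w))) ->
  exists2 C, 0 <= C & forall x t tau, x \in `[0,
    ell] -> 0 < tau -> 0 <= t - tau -> t + tau <= T ->
    `|(w x (t + tau) - 2 * w x t + w x (t - tau)) / tau ^+ 2 - Dt (Dt w)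
      x t| <= C * tau ^+ 2.
Proof.
move=> Cw /lipschitz_tP[K K0 HK]; exists (2 * K); first by rewrite mulr_ge0.
move=> x t tau xl tau0 tm tp.
have h1 := Ck_t_has_deriv Cw (isT : (0 < 3)%N) xl.
have h2 := Ck_t_has_deriv Cw (isT : (1 < 3)%N) xl.
have h3 := Ck_t_has_deriv Cw (isT : (2 < 3)%N) xl.
have tT : t \in `[0, T] by rewrite in_itv/=; apply/andP; split; lra.
have pT : t + tau \in `[0, T] by rewrite in_itv/=; apply/andP; split; lra.
have mT : t - tau \in `[0, T] by rewrite in_itv/=; apply/andP; split; lra.
have HKt c : c \in `[0, T] -> `|Dt (Dt (Dt w)) x c - Dt (Dt (Dt w)) x t| <= K * `|c - t|.
  by move=> cT; exact: HK.
have := taylor3 h1 h2 h3 K0 pT tT HKt; have := taylor3 h1 h2 h3 K0 mT tT HKt.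
rewrite /= [t + tau]addrC addrK [t - tau]addrC addrK [- tau + t]addrC [tau + t]addrC.
rewrite normrN (gtr0_norm tau0).
set a := _ - _ => ha; set b := _ - _ => hb.
have -> : (w x (t + tau) - 2 * w x t + w x (t - tau)) / tau ^+ 2 - Dt (Dt w) x t
  = (a + b) / tau ^+ 2 by rewrite /a /b; field; rewrite gt_eqF.
rewrite normrM normfV [`|tau ^+ 2|]ger0_norm ?sqr_ge0// ler_pdivrMr ?exprn_gt0//.
rewrite (le_trans (ler_normD _ _))//.
have -> : 2 * K * tau ^+ 2 * tau ^+ 2 = K * tau ^+ 4 + K * tau ^+ 4 by ring.
exact: lerD.
Qed.

(** The first-order terms of the expansions at [t + tau] and [t - tau]
    cancel. *)
Lemma average_error w : Ck_t ell T 1 w -> lipschitz_bound (Dt w) ->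
  exists2 C, 0 <= C & forall x t tau, x \in `[0,
    ell] -> 0 < tau -> 0 <= t - tau -> t + tau <= T ->
    `|(w x (t + tau) + w x (t - tau)) / 2 - w x t| <= C * tau ^+ 2.
Proof.
move=> Cw [K K0 HK]; exists K => // x t tau xl tau0 tm tp.
have h1 := Ck_t_has_deriv Cw (isT : (0 < 1)%N) xl.
have tT : t \in `[0, T] by rewrite in_itv/=; apply/andP; split; lra.
have pT : t + tau \in `[0, T] by rewrite in_itv/=; apply/andP; split; lra.
have mT : t - tau \in `[0, T] by rewrite in_itv/=; apply/andP; split; lra.
have HKt c : c \in `[0, T] -> `|Dt w x c - Dt w x t| <= K * `|c - t|.
  by move=> cT; exact: HK.
have := taylor1 h1 K0 pT tT HKt; have := taylor1 h1 K0 mT tT HKt.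
rewrite /= [t + tau]addrC addrK [t - tau]addrC addrK [- tau + t]addrC [tau + t]addrC.
rewrite normrN (gtr0_norm tau0).
set a := _ - _ => ha; set b := _ - _ => hb.
have -> : (w x (t + tau) + w x (t - tau)) / 2 - w x t = (a + b) / 2 by rewrite /a /b; field.
rewrite normrM (@ger0_norm _ 2^-1) ?invr_ge0// ler_pdivrMr//.
by rewrite (le_trans (ler_normD _ _))//; lra.
Qed.

Lemma start_error2 w : Ck_t ell T 3 w ->
  exists2 C, 0 <= C & forall x tau, x \in `[0, ell] -> 0 <= tau <= T ->
    `|w x tau - (w x 0 + tau * Dt w x 0 + tau ^+ 2 / 2 * Dt (Dt w) x 0)| <= C * tau ^+ 3.
Proof.
move=> Cw; have [K K0 HK] := lipschitz_Ck_t (Ck_t_dt (Ck_t_dt Cw)).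
exists K => // x tau xl tauT.
have h1 := Ck_t_has_deriv Cw (isT : (0 < 3)%N) xl.
have h2 := Ck_t_has_deriv Cw (isT : (1 < 3)%N) xl.
have T0 : 0 \in `[0, T] by rewrite in_itv/= lexx ltW.
have tT : tau \in `[0, T] by rewrite in_itv.
have := taylor2 h1 h2 K0 tT T0 (fun c cT => HK x c 0 xl cT T0).
rewrite /= subr0 (ger0_norm (proj1 (andP tauT))).
by congr (`|_ - _| <= _); ring.
Qed.

Lemma start_error1 w : Ck_t ell T 2 w ->
  exists2 C, 0 <= C & forall x tau, x \in `[0, ell] -> 0 <= tau <= T ->
    `|w x tau - (w x 0 + tau * Dt w x 0)| <= C * tau ^+ 2.
Proof.
move=> Cw; have [K K0 HK] := lipschitz_Ck_t (Ck_t_dt Cw).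
exists K => // x tau xl tauT.
have h1 := Ck_t_has_deriv Cw (isT : (0 < 2)%N) xl.
have T0 : 0 \in `[0, T] by rewrite in_itv/= lexx ltW.
have tT : tau \in `[0, T] by rewrite in_itv.
have := taylor1 h1 K0 tT T0 (fun c cT => HK x c 0 xl cT T0).
rewrite /= subr0 (ger0_norm (proj1 (andP tauT))).
by congr (`|_ - _| <= _); ring.
Qed.

End Rectangle.

(** * Consistency of the difference equations *)

Section GenericSolution.
Context {R : realType}.
Variables ell T : R.
Hypothesis ell_gt0 : 0 < ell.
Hypothesis T_gt0 : 0 < T.
Implicit Types (w : R -> R -> R) (p : R -> R) (x t s tau : R).
Local Notation Dx := (dx ell).
Local Notation Dt := (dt T).
Local Notation inL2 := (inL2 ell).
Local Notation norm2 := (normL2 ell).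
Local Notation deriv := (derive_in `[0, ell]).

Let T0 : 0 \in `[0, T]. Proof. by rewrite in_itv/= lexx ltW. Qed.

Lemma dt_zero w x : (forall t, t \in `[0, T] -> w x t = 0) ->
  forall t, t \in `[0, T] -> Dt w x t = 0.
Proof.
move=> w0 t tT; rewrite /dt (@eq_derive_in _ _ _ (fun=> 0))//.
  by have [] := is_derive_in T_gt0 tT (is_derive_cst (0 : R) t 1).
by move=> s; rewrite inE; exact: w0.
Qed.

(** The derivative [p'] of [w_t(., 0)] exists by assumption, but nothing
    relates it yet to [w_xt(., 0)]. Suppose that [rho = w_xt(., 0) - p'] does
    not vanish at [x0]; by continuity it stays away from [0] on some
    [[x0, y]]. The function [w(., tau) - w(., 0) - tau p] is [O(tau^2)],
    whereas its derivative is [tau rho + O(tau^2)]; the mean value theorem on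
    [[x0, y]] gives a contradiction as [tau] tends to [0]. *)
Lemma mixed_derivative w p : Ck_x ell T 1 w -> Ck_t ell T 2 w -> Ck_t ell T 2 (Dx w) ->
  Ck_on `[0, ell] 1 p -> (forall x, x \in `[0, ell] -> p x = Dt w x 0) ->
  forall x, x \in `]0, ell[ -> deriv p x = Dt (Dx w) x 0.
Proof.
move=> Cx Ct Cxt Cp pE x0 x0l.
have [K1 K10 H1] := start_error1 T_gt0 Ct.
have [K2 K20 H2] := start_error1 T_gt0 Cxt.
have cont : {within `[0, ell], continuous (fun x => Dt (Dx w) x 0 - deriv p x)}.
  have c1 := continuous_rect_x (Cxt.2 1%N isT) T0.
  exact: (within_continuousB c1 (Cp.2 1%N isT)).
set rho := fun x => _ in cont.
apply/esym/eqP; rewrite -subr_eq0 -/(rho x0); apply: contraT => rho0.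
have c0 : 0 < `|rho x0| / 2 by rewrite divr_gt0// normr_gt0.
have [cio _ _] := (continuous_within_itvP _ ell_gt0).1 cont.
have /cvgrPdist_lt/(_ _ c0) near1 := cio _ x0l.
have near2 : \forall y \near x0, y \in `]0, ell[ by exact: near_in_itvoo.
have [r /= r0 Hr] : nbhs x0 (fun y => `|rho x0 - rho y| < `|rho x0| / 2 /\ y \in `]0, ell[).
  by apply: filterS2 near1 near2 => y; split.
have ball y : x0 <= y -> y <= x0 + r / 2 -> `|rho x0| / 2 <= `|rho y| /\ y \in `]0, ell[.
  move=> y1 y2; have [|h ?] := Hr y.
    by rewrite /= distrC ger0_norm ?subr_ge0//; lra.
  split=> //; have := ler_normD (rho x0 - rho y) (rho y); rewrite subrK; lra.
set y := x0 + r / 2; set c := `|rho x0| / 2 in c0 ball.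
have xy : x0 < y by rewrite ltrDl divr_gt0.
have [_ yl] := ball y (ltW xy) (lexx _).
have x0l' : x0 \in `[0, ell] by exact: subset_itv_oo_cc.
have yl' : y \in `[0, ell] by exact: subset_itv_oo_cc.
have cr : 0 < c * (r / 2) by rewrite mulr_gt0// divr_gt0.
suff : c * (r / 2) <= 0 by rewrite leNgt cr.
apply: (@ler_of_small_error _ T _ _ (2 * K1 + K2 * (r / 2))) => //.
  by rewrite addr_ge0 ?mulr_ge0 ?invr_ge0 ?(ltW r0).
move=> tau /andP[tau0 tauT].
have tT : tau \in `[0, T] by rewrite in_itv/= (ltW tau0).
have tT' : 0 <= tau <= T by rewrite (ltW tau0).
have hw := Ck_on_has_deriv (Ck_x_slice Cx tT) (ltn0Sn 0).
have hw0 := Ck_on_has_deriv (Ck_x_slice Cx T0) (ltn0Sn 0).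
have hp := Ck_on_has_deriv Cp (ltn0Sn 0).
have [cR dR] := has_derivB (has_derivB hw hw0) (has_derivZ tau hp).
rewrite /= in cR dR.
have sub z : z \in `]x0, y[ -> x0 <= z /\ z <= x0 + r / 2.
  by rewrite in_itv/= => /andP[/ltW ? /ltW ?].
have cR' : {within `[x0, y], continuous (fun x => w x tau - w x 0 - tau * p x)}.
  apply: continuous_subspaceW cR; apply: subset_itvScc; rewrite bnd_simp.
    by move: x0l'; rewrite in_itv/= => /andP[].
  by move: yl'; rewrite in_itv/= => /andP[].
have [z zxy E] := MVT xy (fun z zxy => dR z (ball z (sub z zxy).1 (sub z zxy).2).2) cR'.
have [rz zl] := ball z (sub z zxy).1 (sub z zxy).2.
have zl' : z \in `[0, ell] by exact: subset_itv_oo_cc.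
have A1 := H1 y tau yl' tT'; have A0 := H1 x0 tau x0l' tT'; have A2 := H2 z tau zl' tT'.
rewrite -pE// in A1; rewrite -pE// in A0.
have yx : y - x0 = r / 2 by rewrite /y addrC addKr.
rewrite yx in E.
have r2 : 0 < r / 2 by rewrite divr_gt0.
rewrite -(ler_pM2l tau0) add0r.
have E2 : tau * rho z * (r / 2) = (w y tau - (w y 0 + tau * p y))
  - (w x0 tau - (w x0 0 + tau * p x0))
   - (Dx w z tau - (Dx w z 0 + tau * Dt (Dx w) z 0)) * (r / 2).
  have -> : (w y tau - (w y 0 + tau * p y)) - (w x0 tau - (w x0 0 + tau * p x0)) =
    w y tau - w y 0 - tau * p y - (w x0 tau - w x0 0 - tau * p x0) by ring.
  by rewrite E /rho /dx; ring.
have E3 : tau * `|rho z| * (r / 2) = `|tau * rho z * (r / 2)|.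
  by rewrite [RHS]normrM [`|tau * rho z|]normrM (gtr0_norm tau0) (gtr0_norm r2).
apply: (@le_trans _ _ (tau * `|rho z| * (r / 2))).
  by rewrite -mulrA ler_pM2l// ler_pM2r.
rewrite E3 E2 (le_trans (ler_normB _ _))//.
have := ler_normB (w y tau - (w y 0 + tau * p y)) (w x0 tau - (w x0 0 + tau * p x0)).
have A2' : `|(Dx w z tau - (Dx w z 0 + tau * Dt (Dx w) z 0))
  * (r / 2)| <= K2 * tau ^+ 2 * (r / 2).
  by rewrite normrM (gtr0_norm r2) ler_pM2r.
have -> : tau * (tau * (2 * K1 + K2 * (r / 2)))
  = K1 * tau ^+ 2 + K1 * tau ^+ 2 + K2 * tau ^+ 2 * (r / 2) by ring.
lra.
Qed.

(** The exact function satisfies the difference equation centred at [t] up to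
    a remainder of order [tau^2]. Both equations have this form: [d = 0] and
    [kappa] the nonlocal coefficient at time [t] for the first, [d = delta] and
    [kappa = gamma] for the second. *)
Definition consistent w (Kmax d C : R) : Prop :=
  forall kappa t tau, `|kappa| <= Kmax -> 0 < tau -> 0 <= t - tau -> t + tau <= T ->
  exists r : R -> R, [/\ inL2 r, norm2 r <= C * tau ^+ 2 & forall x, 0 < x < ell ->
    (w x (t + tau) - 2 * w x t + w x (t - tau)) / tau ^+ 2
    - kappa * ((Dx (Dx w) x (t + tau) + Dx (Dx w) x (t - tau)) / 2)
    + d * ((w x (t + tau) + w x (t - tau)) / 2)
    = Dt (Dt w) x t - kappa * Dx (Dx w) x t + d * w x t + r x].

Lemma consistency w (Kmax d : R) : 0 <= Kmax ->
  Ck_x ell T 2 w -> Ck_t ell T 3 w -> lipschitz_t ell T (Dt (Dt (Dt w))) ->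
  Ck_t ell T 1 (Dx (Dx w)) -> lipschitz_t ell T (Dt (Dx (Dx w))) ->
  exists2 C, 0 <= C & consistent w Kmax d C.
Proof.
move=> Kmax0 Cx Ct lt Cxx lxx.
have [C1 C10 H1] := second_difference_error Ct lt.
have [C2 C20 H2] := average_error Cxx (lipschitz_tP lxx).
have lw : lipschitz_bound ell T (Dt w).
  by apply: lipschitz_Ck_t; apply: Ck_t_dt; exact: Ck_tW Ct.
have [C3 C30 H3] := average_error (Ck_tW (isT : (1 <= 3)%N) Ct) lw.
exists ((C1 + Kmax * C2 + `|d| * C3) * Num.sqrt ell).
  by rewrite mulr_ge0 ?sqrtr_ge0// !addr_ge0// mulr_ge0.
move=> kappa t tau kK tau0 tm tp.
have tT : t \in `[0, T] by rewrite in_itv/=; apply/andP; split; lra.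
have pT : t + tau \in `[0, T] by rewrite in_itv/=; apply/andP; split; lra.
have mT : t - tau \in `[0, T] by rewrite in_itv/=; apply/andP; split; lra.
have Lw s : s \in `[0, T] -> inL2 (w ^~ s).
  by move=> sT; apply/continuous_inL2/(continuous_rect_x _ sT)/(Cx.2 0%N).
have Lwxx s : s \in `[0, T] -> inL2 (Dx (Dx w) ^~ s).
  by move=> sT; apply/continuous_inL2/(continuous_rect_x _ sT)/(Cx.2 2%N).
have Lwtt : inL2 (Dt (Dt w) ^~ t).
  by apply/continuous_inL2/(continuous_rect_x _ tT)/(Ct.2 2%N).
pose r : R -> R := (tau ^- 2 *: ((w ^~ (t + tau)) - 2 *: (w ^~ t) + (w ^~ (t - tau)))
  - (Dt (Dt w) ^~ t))
  - kappa *: (2^-1 *: ((Dx (Dx w) ^~ (t + tau)) + (Dx (Dx w) ^~ (t - tau)))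
    - (Dx (Dx w) ^~ t))
  + d *: (2^-1 *: ((w ^~ (t + tau)) + (w ^~ (t - tau))) - (w ^~ t)).
have rE x : r x = ((w x (t + tau) - 2 * w x t + w x (t - tau)) / tau ^+ 2 - Dt (Dt w) x t)
  - kappa * ((Dx (Dx w) x (t + tau) + Dx (Dx w) x (t - tau)) / 2 - Dx (Dx w) x t)
  + d * ((w x (t + tau) + w x (t - tau)) / 2 - w x t).
  rewrite /r !fctE /GRing.scale /=; congr (_ - _ * _ + _ * _); last 2 first.
  - by rewrite mulrC.
  - by rewrite mulrC.
  - by congr (_ - _); rewrite mulrC.
have Lr : inL2 r.
  have L1 := Lw _ tT; have L2 := Lw _ pT; have L3 := Lw _ mT.
  have L4 := Lwxx _ tT; have L5 := Lwxx _ pT; have L6 := Lwxx _ mT.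
  by rewrite /r; repeat first [assumption | apply: inL2D | apply: inL2Z | apply: inL2N].
exists r; split => //.
- rewrite mulrAC; apply: normL2_le_bound => //; first exact: ltW.
    by rewrite mulr_ge0 ?sqr_ge0// !addr_ge0// mulr_ge0.
  move=> x /andP[x0 xl]; have xcc : x \in `[0, ell] by rewrite in_itv/= !ltW.
  rewrite rE.
  have h1 := H1 x t tau xcc tau0 tm tp.
  have h2 := H2 x t tau xcc tau0 tm tp.
  have h3 := H3 x t tau xcc tau0 tm tp.
  rewrite (le_trans (ler_normD _ _))// [leRHS]mulrDl lerD//.
    by rewrite (le_trans (ler_normB _ _))// [leRHS]mulrDl lerD// normrM -mulrA ler_pM.
  by rewrite normrM -mulrA ler_wpM2l.
- by move=> x _; rewrite rE; ring.
Qed.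

(** The error [h] of the starting function at the first level vanishes at
    both ends, is [O(tau^3)] because [p0], [p1], [p2] are the Taylor
    coefficients of [w] at [t = 0], and its derivative is [O(tau^2)] because
    [p1'] is the first Taylor coefficient of [w_x]. *)
Lemma start_consistency w p0 p1 p2 : Ck_x ell T 2 w -> Ck_t ell T 3 w ->
  Ck_t ell T 2 (Dx w) ->
  (forall t, t \in `[0, T] -> w 0 t = 0 /\ w ell t = 0) ->
  Ck_on `[0, ell] 1 p0 -> Ck_on `[0, ell] 1 p1 -> Ck_on `[0, ell] 1 p2 ->
  (forall x, x \in `[0, ell] -> p0 x = w x 0) ->
  (forall x, x \in `[0, ell] -> p1 x = Dt w x 0) ->
  (forall x, x \in `]0, ell[ -> p2 x = Dt (Dt w) x 0) ->
  exists2 C, 0 <= C & forall tau, 0 < tau <= T ->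
    let h x := w x tau - (p0 x + tau * p1 x + tau ^+ 2 / 2 * p2 x) in
    exists h', [/\ has_deriv 0 ell h h', {within `[0, ell], continuous h'},
      h 0 = 0 /\ h ell = 0, norm2 h <= C * tau ^+ 3 & norm2 h' <= C * tau ^+ 2].
Proof.
move=> Cx Ct Cxt bd Cp0 Cp1 Cp2 e0 e1 e2.
have [C1 C10 H1] := start_error2 T_gt0 Ct.
have [C2 C20 H2] := start_error1 T_gt0 Cxt.
have mixed := mixed_derivative (Ck_xW (isT : (1 <= 2)%N) Cx)
  (Ck_tW (isT : (2 <= 3)%N) Ct) Cxt Cp1 e1.
(* both sides are continuous up to the endpoints *)
have e2' : forall x, x \in `[0, ell] -> p2 x = Dt (Dt w) x 0.
  move=> x xl; apply/eqP; rewrite -subr_eq0; apply/eqP; move: x xl.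
  apply: (within_continuous0 ell_gt0).
    have c1 := continuous_rect_x (Ct.2 2%N isT) T0.
    exact: (within_continuousB (Cp2.2 0%N isT) c1).
  by move=> x xl; rewrite e2// subrr.
have [M M0 M2] : exists2 M, 0 <= M & forall x, x \in `[0, ell] -> `|deriv p2 x| <= M.
  have cn : {within `[0, ell], continuous (fun x => `|deriv p2 x|)}.
    by move=> x; apply: continuous_comp;
      [exact: (Cp2.2 1%N (leqnn 1))|exact: norm_continuous].
  have [c _ Hc] := EVT_max (ltW ell_gt0) cn.
  by exists `|deriv p2 c|.
have l0 : 0 \in `[0, ell] by rewrite in_itv/= lexx ltW.
have ll : ell \in `[0, ell] by rewrite in_itv/= lexx ltW.
exists ((C1 + C2 + M) * Num.sqrt ell).
  by rewrite mulr_ge0 ?sqrtr_ge0// !addr_ge0.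
move=> tau /andP[tau0 tauT] h.
have tT : tau \in `[0, T] by rewrite in_itv/= (ltW tau0).
have tT' : 0 <= tau <= T by rewrite (ltW tau0).
pose h' x := Dx w x tau - deriv p0 x - tau * deriv p1 x - tau ^+ 2 / 2 * deriv p2 x.
have hE : h = fun x => w x tau - p0 x - tau * p1 x - tau ^+ 2 / 2 * p2 x.
  by apply/funext => x; rewrite /h; ring.
have hd : has_deriv 0 ell h h'.
  have d1 := Ck_on_has_deriv (Ck_x_slice Cx tT) (ltn0Sn 1).
  have d2 := Ck_on_has_deriv Cp0 (ltn0Sn 0).
  have d3 := has_derivZ tau (Ck_on_has_deriv Cp1 (ltn0Sn 0)).
  have d4 := has_derivZ (tau ^+ 2 / 2) (Ck_on_has_deriv Cp2 (ltn0Sn 0)).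
  by rewrite hE; exact: (has_derivB (has_derivB (has_derivB d1 d2) d3) d4).
have ch' : {within `[0, ell], continuous h'}.
  have c1 := continuous_rect_x (Cx.2 1%N isT) tT.
  have c2 := within_continuousZ (c := tau) (Cp1.2 1%N (leqnn 1)).
  have c3 := within_continuousZ (c := tau ^+ 2 / 2) (Cp2.2 1%N (leqnn 1)).
  exact: (within_continuousB (within_continuousB (within_continuousB c1 (Cp0.2 1%N
    (leqnn 1))) c2) c3).
exists h'; split => //.
- have z0 := @dt_zero w 0 (fun t tT => (bd t tT).1);
  have zl := @dt_zero w ell (fun t tT => (bd t tT).2).
  have z0' := @dt_zero (Dt w) 0 z0; have zl' := @dt_zero (Dt w) ell zl.
  have [b1 b2] := bd _ tT; have [b3 b4] := bd _ T0.
  rewrite /h !e0// !e1// !e2'// b1 b2 b3 b4 z0// zl// z0'// zl'//.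
  by rewrite !mulr0 !addr0 subrr.
- have Lh := continuous_inL2 hd.1.
  apply: (@le_trans _ _ (C1 * tau ^+ 3 * Num.sqrt ell)).
    apply: normL2_le_bound => //; [exact: ltW|by rewrite mulr_ge0// exprn_ge0// ltW|].
    move=> x /andP[x0 xl]; have xcc : x \in `[0, ell] by rewrite in_itv/= !ltW.
    by rewrite /h e0// e1// e2'//; exact: H1.
  rewrite mulrAC ler_wpM2r ?exprn_ge0// ?(ltW tau0)// ler_wpM2r ?sqrtr_ge0//; lra.
- have Lh := continuous_inL2 ch'.
  apply: (@le_trans _ _ ((C2 + M) * tau ^+ 2 * Num.sqrt ell)).
    apply: normL2_le_bound => //; [exact: ltW|by rewrite mulr_ge0 ?sqr_ge0// addr_ge0|].
    move=> x /andP[x0 xl]; have xcc : x \in `[0, ell] by rewrite in_itv/= !ltW.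
    have xoo : x \in `]0, ell[ by rewrite in_itv/= x0.
    rewrite /h' mixed//.
    have -> : deriv p0 x = Dx w x 0.
      by apply: eq_derive_in => // y; rewrite inE => yl; exact: e0.
    have m1 := H2 x tau xcc tT'; have m2 := M2 x xcc.
    rewrite -[_ - Dx w x 0 - _]addrA -opprD.
    rewrite (le_trans (ler_normB _ _))// mulrDl lerD//.
    rewrite normrM ger0_norm ?divr_ge0 ?sqr_ge0// mulrC ler_pM// ?divr_ge0 ?sqr_ge0//.
    have := sqr_ge0 tau; lra.
  rewrite mulrAC ler_wpM2r ?exprn_ge0// ?(ltW tau0)// ler_wpM2r ?sqrtr_ge0//; lra.
Qed.

Lemma normL2_sqr_diff (f g : R -> R) : inL2 f -> inL2 g ->
  `|norm2 f ^+ 2 - norm2 g ^+ 2| <= norm2 (f - g) * (2 * norm2 f + norm2 (f - g)).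
Proof.
move=> Lf Lg; have Lfg := inL2B Lf Lg.
have h1 : norm2 f <= norm2 g + norm2 (f - g).
  by rewrite -[X in norm2 X <= _](subrK g) addrC normL2_leD.
have h2 : norm2 g <= norm2 f + norm2 (f - g).
  by rewrite -[X in norm2 X <= _](subKr f) normL2_leB.
have n1 := normL2_ge0 ell f; have n2 := normL2_ge0 ell g; have n3 := normL2_ge0 ell (f - g).
rewrite subr_sqr normrM (ger0_norm (addr_ge0 n1 n2)) ler_pM ?addr_ge0//; last lra.
by rewrite ler_norml; apply/andP; split; lra.
Qed.

End GenericSolution.

(** * The coupled scheme *)

Lemma interior_index (k n : nat) : (0 < k < n)%N ->
  [/\ (1 <= k <= n.-1)%N, (k.+1 <= n)%N, (k <= n)%N & (k.-1 <= n)%N].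
Proof. by move=> kn; split; lia. Qed.

Lemma ltn_interior (k n : nat) : (k.+2 <= n)%N -> (1 <= k.+1 <= n.-1)%N.
Proof. lia. Qed.

Lemma last_interior (k n : nat) : (2 < n)%N -> (k <= n)%N -> (n < k.+2)%N -> exists2 j,
  k = j.+1 & (1 <= j <= n.-1)%N.
Proof. by move=> n2 kn nk; exists k.-1; lia. Qed.

(** The error equation is the equation of the exact solution minus that of
    the scheme. The discrete coefficient [q] is kept in front of the error, and
    the perturbation [Q - q] falls on the exact [u_xx], which is bounded. *)
Lemma error_equation_u (R : realType)
    (i q Q a F r up u0 um Up U0 Um xp x0 xm Ap Am utt vx BV : R) :
  (Up - 2 * U0 + Um) * i + q * ((Ap + Am) / 2) = F - a * BV ->
  (up - 2 * u0 + um) * i - Q * ((xp + xm) / 2) + 0 * ((up + um) / 2)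
    = utt - Q * x0 + 0 * u0 + r ->
  utt - Q * x0 + a * vx = F ->
  (up - Up - 2 * (u0 - U0) + (um - Um)) * i + q * ((- xp - Ap + (- xm - Am)) / 2)
    = r + (Q - q) / 2 * (xp + xm) - a * (vx - BV).
Proof. by move=> hU hr pde; lra. Qed.

Lemma error_equation_v (R : realType)
    (i c d a F r vp v0 vm Vp V0 Vm xp x0 xm Ap Am Ep Em vtt ux BU : R) :
  (Vp - 2 * V0 + Vm) * i + (c * Ap + d * Vp + (c * Am + d * Vm)) / 2 = F + a * BU ->
  (vp - 2 * v0 + vm) * i - c * ((xp + xm) / 2) + d * ((vp + vm) / 2)
    = vtt - c * x0 + d * v0 + r ->
  vtt - c * x0 + d * v0 - a * ux = F ->
  Ep + Em = - xp - Ap + (- xm - Am) ->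
  (vp - Vp - 2 * (v0 - V0) + (vm - Vm)) * i
    + 1 * ((c * Ep + d * (vp - Vp) + (c * Em + d * (vm - Vm))) / 2)
    = r + a * (ux - BU).
Proof.
move=> hV hr pde hE; have hE' : c * Ep + c * Em = c * (- xp - Ap + (- xm - Am)).
  by rewrite -mulrDr hE.
lra.
Qed.

Lemma sqr_perturbation (R : realType) (N s : R) : 0 <= N -> 0 <= s ->
  s * (2 * N + s) <= (2 * N + 1) * (s + s ^+ 2).
Proof. by move=> N0 s0; have := mulr_ge0 N0 (mulr_ge0 s0 s0); lra. Qed.

Section Scheme.
Context {R : realType}.
Variables (ell T alpha beta gamma delta a1 a2 : R).
Variables (f1 f2 : R -> R -> R) (phi0 phi1 psi0 psi1 : R -> R).
Variables (A Ahalf : operator (R := R)) (u v : R -> R -> R).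
Hypotheses (ell_gt0 : 0 < ell) (T_gt0 : 0 < T).
Hypotheses (alpha_gt0 : 0 < alpha) (beta_gt0 : 0 < beta).
Hypotheses (gamma_gt0 : 0 < gamma) (delta_gt0 : 0 < delta).
Hypotheses (a1_gt0 : 0 < a1) (a2_gt0 : 0 < a2).
Hypothesis A_extends_A0 : extends ell A (opA0 ell).
Hypothesis A_self_adjoint : self_adjoint ell A.
Hypothesis A_positive_definite : positive_definite ell A.
Hypothesis Ahalf_sqrt : is_sqrt ell Ahalf A.
Hypothesis sol : classical_solution ell T alpha beta gamma delta a1 a2
          f1 f2 phi0 phi1 psi0 psi1 u v.
Hypotheses (phi0_D : dom (opA0 ell) phi0) (psi0_D : dom (opA0 ell) psi0).
Hypotheses (phi1_C1 : Ck_on `[0, ell] 1 phi1) (psi1_C1 : Ck_on `[0, ell] 1 psi1).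
Hypothesis phi2_C1 : Ck_on `[0, ell] 1 (phi2 ell alpha beta a1 f1 phi0 psi0 Ahalf).
Hypothesis psi2_C1 : Ck_on `[0, ell] 1 (psi2 ell gamma delta a2 f2 phi0 psi0).
Hypotheses (ux_C2t : Ck_t ell T 2 (dx ell u)) (vx_C2t : Ck_t ell T 2 (dx ell v)).
Hypotheses (f1_C1x : Ck_x ell T 1 f1) (f2_C1x : Ck_x ell T 1 f2).
Hypotheses (u_C3t : Ck_t ell T 3 u) (v_C3t : Ck_t ell T 3 v).
Hypothesis uttt_lip : lipschitz_t ell T (dt T (dt T (dt T u))).
Hypothesis vttt_lip : lipschitz_t ell T (dt T (dt T (dt T v))).
Hypotheses (uxx_C1t : Ck_t ell T 1 (dx ell (dx ell u))).
Hypotheses (vxx_C1t : Ck_t ell T 1 (dx ell (dx ell v))).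
Hypothesis uxxt_lip : lipschitz_t ell T (dt T (dx ell (dx ell u))).
Hypothesis vxxt_lip : lipschitz_t ell T (dt T (dx ell (dx ell v))).

Local Notation Dx := (dx ell).
Local Notation Dt := (dt T).
Local Notation inL2 := (inL2 ell).
Local Notation eqL2 := (eqL2 ell).
Local Notation dot := (dotL2 ell).
Local Notation norm2 := (normL2 ell).
Local Notation deriv := (derive_in `[0, ell]).
Local Notation q_of := (q_of ell alpha beta Ahalf).

Let lA : linear_operator ell A. Proof. by case: A_self_adjoint. Qed.

Let u_C2x : Ck_x ell T 2 u. Proof. by have [[]] := sol. Qed.
Let v_C2x : Ck_x ell T 2 v. Proof. by have [[]] := sol. Qed.

Let T0 : 0 \in `[0, T]. Proof. by rewrite in_itv/= lexx ltW. Qed.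

Let u_bd t : t \in `[0, T] -> u 0 t = 0 /\ u ell t = 0.
Proof. by rewrite in_itv/= => tT; have [_ _ _ _ H] := sol; have [] := H t tT. Qed.

Let v_bd t : t \in `[0, T] -> v 0 t = 0 /\ v ell t = 0.
Proof. by rewrite in_itv/= => tT; have [_ _ _ _ H] := sol; have [] := H t tT. Qed.

Lemma slice_domA0 (w : R -> R -> R) t : Ck_x ell T 2 w ->
  (forall t, t \in `[0, T] -> w 0 t = 0 /\ w ell t = 0) ->
  t \in `[0, T] -> dom (opA0 ell) (w ^~ t).
Proof. by move=> Cw bd tT; have [? ?] := bd t tT; split => //; exact: Ck_x_slice tT. Qed.

(** The nonlocal coefficient of the first equation along the exact
    solution. *)
Definition diffusion (t : R) : R := alpha + beta * norm2 (Dx u ^~ t) ^+ 2.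

Lemma slice_inL2 (w : R -> R -> R) t : continuous_rect ell T w -> t \in `[0,
  T] -> inL2 (w ^~ t).
Proof. by move=> cw tT; apply/continuous_inL2/(continuous_rect_x cw tT). Qed.

Lemma pde_u x t : 0 < x < ell -> 0 < t <= T ->
  Dt (Dt u) x t - diffusion t * Dx (Dx u) x t + a1 * Dx v x t = f1 x t.
Proof.
move=> xl tT; have [_ <-// _ _ _] := sol.
congr (_ - (_ + _ * _) * _ + _); rewrite normL2_sqr.
by apply: eq_Rintegral => y _; rewrite expr2.
Qed.

Lemma pde_v x t : 0 < x < ell -> 0 < t <= T ->
  Dt (Dt v) x t - gamma * Dx (Dx v) x t + delta * v x t - a2 * Dx u x t = f2 x t.
Proof. by move=> xl tT; have [_ _ H _ _] := sol; exact: H. Qed.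

Lemma ux_norm_bounded : exists2 N, 0 <= N &
  forall t, t \in `[0, T] -> norm2 (Dx u ^~ t) <= N.
Proof.
have [M M0 HM] := continuous_rect_bounded (u_C2x.2 1%N isT).
exists (M * Num.sqrt ell); first by rewrite mulr_ge0// sqrtr_ge0.
move=> t tT; apply: normL2_le_bound => //; first exact: ltW.
  exact: (slice_inL2 (u_C2x.2 1%N isT) tT).
by move=> x /andP[x0 xl]; apply: HM => //; rewrite in_itv/= !ltW.
Qed.

Lemma diffusion_lipschitz : exists2 C, 0 <= C &
  forall s t, s \in `[0, T] -> t \in `[0, T] ->
    `|diffusion s - diffusion t| <= C * `|s - t|.
Proof.
have [N N0 HN] := ux_norm_bounded.
have [K K0 HK] := lipschitz_Ck_t (Ck_tW (isT : (1 <= 2)%N) ux_C2t).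
pose l := Num.sqrt ell; have l0 : 0 <= l by exact: sqrtr_ge0.
exists (beta * (K * l * (2 * N + K * T * l))).
  by rewrite mulr_ge0 ?(ltW beta_gt0)// mulr_ge0 ?addr_ge0 ?mulr_ge0// ltW.
move=> s t sT tT.
have Ls := slice_inL2 (u_C2x.2 1%N isT) sT; have Lt := slice_inL2 (u_C2x.2 1%N isT) tT.
have dN : norm2 ((Dx u ^~ s) - (Dx u ^~ t)) <= K * `|s - t| * l.
  apply: normL2_le_bound; [exact: ltW|exact: inL2B|by rewrite mulr_ge0|].
  by move=> x /andP[x0 xl]; apply: HK => //; rewrite in_itv/= !ltW.
have stT : `|s - t| <= T.
  by move: sT tT; rewrite !in_itv/= ler_norml => *; apply/andP; split; lra.
have -> : diffusion s - diffusion t =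
    beta * (norm2 (Dx u ^~ s) ^+ 2 - norm2 (Dx u ^~ t) ^+ 2).
  by rewrite /diffusion opprD addrACA subrr add0r -mulrBr.
rewrite normrM (gtr0_norm beta_gt0) -[leRHS]mulrA ler_pM2l//.
apply: (le_trans (normL2_sqr_diff Ls Lt)).
have -> : K * l * (2 * N + K * T * l) * `|s - t| = (K * `|s - t| * l)
  * (2 * N + K * T * l) by ring.
have n0 := normL2_ge0 ell ((Dx u ^~ s) - (Dx u ^~ t)).
rewrite ler_pM ?addr_ge0 ?mulr_ge0 ?normL2_ge0// lerD//.
  by rewrite ler_pM2l// HN.
by rewrite (le_trans dN)// ler_wpM2r// ler_wpM2l.
Qed.

Lemma sqrt_slice t : t \in `[0, T] -> norm2 (Ahalf (u ^~ t)) = norm2 (Dx u ^~ t).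
Proof.
move=> tT; exact: (normL2_sqrt_domA0 ell_gt0 A_self_adjoint A_extends_A0 Ahalf_sqrt
  (slice_domA0 u_C2x u_bd tT)).
Qed.

Let phi0E x : x \in `[0, ell] -> phi0 x = u x 0.
Proof. by rewrite in_itv/= => xl; have [_ _ _ H _] := sol; have [] := H x xl. Qed.
Let psi0E x : x \in `[0, ell] -> psi0 x = v x 0.
Proof. by rewrite in_itv/= => xl; have [_ _ _ H _] := sol; have [] := H x xl. Qed.
Let phi1E x : x \in `[0, ell] -> phi1 x = Dt u x 0.
Proof. by rewrite in_itv/= => xl; have [_ _ _ H _] := sol; have [] := H x xl. Qed.
Let psi1E x : x \in `[0, ell] -> psi1 x = Dt v x 0.
Proof. by rewrite in_itv/= => xl; have [_ _ _ H _] := sol; have [] := H x xl. Qed.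

Lemma deriv_initial (p : R -> R) (w : R -> R -> R) :
  (forall x, x \in `[0, ell] -> p x = w x 0) -> forall x, x \in `[0, ell] ->
  deriv p x = Dx w x 0 /\ deriv (deriv p) x = Dx (Dx w) x 0.
Proof.
move=> pE; have e1 : {in `[0, ell]%classic, deriv p =1 Dx w ^~ 0}.
  move=> x; rewrite inE => xl; apply: eq_derive_in => // y; rewrite inE; exact: pE.
by move=> x xl; split; [apply: e1; rewrite inE|exact: eq_derive_in].
Qed.

Lemma q_initial : q_of phi0 = diffusion 0.
Proof.
rewrite /Defs.q_of (normL2_sqrt_domA0 ell_gt0 A_self_adjoint A_extends_A0 Ahalf_sqrt
  phi0_D).
congr (_ + _ * _ ^+ 2); apply: eqL2_norm.
- by have [_ _ /continuous_inL2] := domA0_has_deriv phi0_D.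
- exact: slice_inL2 (u_C2x.2 1%N isT) T0.
- apply: eqL2_on => x /andP[x0 xl].
  by have [] := deriv_initial phi0E (_ : x \in `[0, ell]);
    rewrite ?in_itv/= ?(ltW x0) ?(ltW xl).
Qed.

(** The second starting datum is [u_tt] at time [0]. The equation with its
    coefficient frozen at time [0] holds up to
    [|diffusion t - diffusion 0| |u_xx| = O(t)] for [t > 0]; let [t] tend
    to [0]. *)
Lemma phi2E x : x \in `]0, ell[ ->
  phi2 ell alpha beta a1 f1 phi0 psi0 Ahalf x = Dt (Dt u) x 0.
Proof.
rewrite in_itv/= => /andP[x0 xl].
have xcc : x \in `[0, ell] by rewrite in_itv/= !ltW.
have [C C0 HC] := diffusion_lipschitz.
have [M M0 HM] := continuous_rect_bounded (u_C2x.2 2%N isT).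
have c1 := continuous_rect_t (u_C3t.2 2%N isT) xcc.
have c2 := continuous_rect_t (u_C2x.2 2%N isT) xcc.
have c3 := continuous_rect_t (v_C2x.2 1%N isT) xcc.
have c4 := continuous_rect_t (f1_C1x.2 0%N isT) xcc.
have c1' := within_continuousB c1 (within_continuousZ (c := diffusion 0) c2).
have c1'' := within_continuousB c1' (within_continuousZ (c := - a1) c3).
have := within_continuous_left0 (K := C * M) T_gt0 (within_continuousB c1'' c4).
rewrite /= /phi2 q_initial (deriv_initial phi0E xcc).2 (deriv_initial psi0E xcc).1.
move=> H; suff : Dt (Dt u) x 0 - diffusion 0 * Dx (Dx u) x 0 - - a1 * Dx v x 0 - f1 x 0 = 0.
  by move=> h; lra.
apply: H => t tT; have tcc : t \in `[0, T]
  by rewrite in_itv/= (ltW (andP tT).1) (andP tT).2.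
rewrite -(pde_u (introT andP (conj x0 xl)) tT).
have alg (X Y Z q q' : R) :
    X - q * Y - - a1 * Z - (X - q' * Y + a1 * Z) = (q' - q) * Y by ring.
rewrite alg.
have t0 : 0 < t by case/andP: tT.
have := HC t 0 tcc T0; rewrite subr0 (gtr0_norm t0) => h.
rewrite normrM (_ : C * M * t = C * t * M); last by ring.
by rewrite ler_pM// HM.
Qed.

Lemma psi2E x : x \in `]0, ell[ ->
  psi2 ell gamma delta a2 f2 phi0 psi0 x = Dt (Dt v) x 0.
Proof.
rewrite in_itv/= => /andP[x0 xl].
have xcc : x \in `[0, ell] by rewrite in_itv/= !ltW.
have c1 := continuous_rect_t (v_C3t.2 2%N isT) xcc.
have c2 := continuous_rect_t (v_C2x.2 2%N isT) xcc.
have c3 := continuous_rect_t (u_C2x.2 1%N isT) xcc.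
have c4 := continuous_rect_t (f2_C1x.2 0%N isT) xcc.
have c5 := continuous_rect_t (v_C2x.2 0%N isT) xcc.
have c1' := within_continuousB c1 (within_continuousZ (c := gamma) c2).
have c1'' := within_continuousB c1' (within_continuousZ (c := a2) c3).
have c1''' := within_continuousB c1'' c4.
have := within_continuous_left0 (K := 0) T_gt0
  (within_continuousB c1''' (within_continuousZ (c := - delta) c5)).
rewrite /= /psi2 (deriv_initial phi0E xcc).1 (deriv_initial psi0E xcc).2 psi0E//.
move=> H.
suff : Dt (Dt v) x 0 - gamma * Dx (Dx v) x 0 - a2 * Dx u x 0 - f2 x 0
    - - delta * v x 0 = 0.
  by move=> h; lra.
apply: H => t tT.
rewrite -(pde_v (introT andP (conj x0 xl)) tT).
have alg (X Y Z W : R) : X - gamma * Y - a2 * Z - (X - gamma * Y + delta * W - a2 * Z)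
  - - delta * W = 0 by ring.
by rewrite alg normr0 mul0r.
Qed.

Section OneStep.
Variables (n : nat) (U V : nat -> R -> R).
Hypothesis n_gt2 : (2 < n)%N.
Hypothesis UV : scheme ell T alpha beta gamma delta a1 a2
            f1 f2 phi0 phi1 psi0 psi1 A Ahalf n U V.

Local Notation tau := (step T n).
Local Notation t_ k := (k%:R * step T n).

Local Notation err_u := (error T u U n).
Local Notation err_v := (error T v V n).

Lemma steps_gt0 : 0 < n%:R :> R. Proof. by rewrite ltr0n (ltn_trans _ n_gt2). Qed.

Lemma step_gt0 : 0 < tau. Proof. by rewrite divr_gt0// steps_gt0. Qed.

Lemma t_in k : (k <= n)%N -> t_ k \in `[0, T].
Proof.
move=> kn; rewrite in_itv/= mulr_ge0 ?(ltW step_gt0)//= /step mulrA ler_pdivrMr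
  ?steps_gt0//.
by rewrite mulrC ler_pM2l// ler_nat.
Qed.

(** The scheme puts the levels [k + 1] and [k - 1] with [1 <= k <= n - 1] in
    the domain of [A]; level [1] is among them as soon as [n > 2]. *)
Lemma scheme_dom k : (k <= n)%N -> dom A (U k) /\ dom A (V k).
Proof.
move=> kn; have [_ _ _ _ H] := UV.
have [kn2|kn2] := leqP k.+2 n.
  by have [[_ d1 _ _] [_ d2 _] _ _] := H k.+1 (ltn_interior kn2).
have [j -> jn] := last_interior n_gt2 kn kn2.
by have [[d1 _ _ _] [d2 _ _] _ _] := H j jn.
Qed.

Lemma scheme_domB k : (0 < k < n)%N -> dom (opB ell) (U k) /\ dom (opB ell) (V k).
Proof.
move=> kn; have [_ _ _ _ H] := UV.
have [kn1 _ _ _] := interior_index kn.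
by have [[_ _ _ d1] [_ _ d2] _ _] := H k kn1.
Qed.

Lemma errorE (w : R -> R -> R) (W : nat -> R -> R) k :
  error T w W n k = (w ^~ (t_ k)) - W k.
Proof. by []. Qed.

Lemma slice_app (w : R -> R -> R) t : Ck_x ell T 2 w ->
  (forall t, t \in `[0, T] -> w 0 t = 0 /\ w ell t = 0) -> t \in `[0, T] ->
  dom A (w ^~ t) /\ eqL2 (A (w ^~ t)) (- (Dx (Dx w) ^~ t)).
Proof. by move=> Cw bd tT; exact: (A_extends_A0 (slice_domA0 Cw bd tT)). Qed.

Lemma error_app (w : R -> R -> R) (W : nat -> R -> R) k : Ck_x ell T 2 w ->
  (forall t, t \in `[0, T] -> w 0 t = 0 /\ w ell t = 0) -> (k <= n)%N -> dom A (W k) ->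
  dom A (error T w W n k) /\
  eqL2 (A (error T w W n k)) (- (Dx (Dx w) ^~ (t_ k)) - A (W k)).
Proof.
move=> Cw bd kn dW; have [dw ew] := slice_app Cw bd (t_in kn).
have [d e] := dom_appB lA dw dW; split; first by rewrite errorE.
by rewrite errorE; apply: (eqL2_trans e); apply: eqL2B => //; exact: eqL2_refl.
Qed.

Lemma err_u_app k : (k <= n)%N -> dom A (err_u k) /\
  eqL2 (A (err_u k)) (- (Dx (Dx u) ^~ (t_ k)) - A (U k)).
Proof. by move=> kn; apply: error_app => //; exact: (scheme_dom kn).1. Qed.

Lemma err_v_app k : (k <= n)%N -> dom A (err_v k) /\
  eqL2 (A (err_v k)) (- (Dx (Dx v) ^~ (t_ k)) - A (V k)).
Proof. by move=> kn; apply: error_app => //; exact: (scheme_dom kn).2. Qed.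

Lemma error_graph (w : R -> R -> R) (W : nat -> R -> R) k : Ck_x ell T 2 w ->
  (k <= n)%N -> dom (opB ell) (W k) ->
  closure_graph ell (opB0 ell) (error T w W n k) ((Dx w ^~ (t_ k)) - opB ell (W k)).
Proof.
move=> Cw kn dW; rewrite errorE; apply: (closure_graphB ell_gt0); last exact: opB_graph.
by apply: closure_graph_C1; exact: Ck_onW (isT : (1 <= 2)%N) (Ck_x_slice Cw (t_in kn)).
Qed.

Lemma err_u_graph k : (0 < k < n)%N ->
  closure_graph ell (opB0 ell) (err_u k) ((Dx u ^~ (t_ k)) - opB ell (U k)).
Proof.
by move=> kn; apply: error_graph; [|case/andP: kn => _ /ltnW|exact: (scheme_domB kn).1].
Qed.

Lemma err_v_graph k : (0 < k < n)%N ->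
  closure_graph ell (opB0 ell) (err_v k) ((Dx v ^~ (t_ k)) - opB ell (V k)).
Proof.
by move=> kn; apply: error_graph; [|case/andP: kn => _ /ltnW|exact: (scheme_domB kn).2].
Qed.

Lemma err_deriv_le z w : dom A z -> closure_graph ell (opB0 ell) z w ->
  norm2 w <= norm2 (Ahalf z).
Proof.
move=> dz; exact: (closure_deriv_le_sqrt ell_gt0 A_self_adjoint A_extends_A0
  A_positive_definite Ahalf_sqrt dz).
Qed.

(** Since [q] depends on the square of [|A^(1/2) U|], its error is linear in
    [|A^(1/2) (u - U)|] up to a quadratic term. *)
Lemma q_error k N : (k <= n)%N -> (forall t, t \in `[0, T] -> norm2 (Dx u ^~ t) <= N) ->
  `|q_of (U k) - diffusion (t_ k)| <=
  beta * (norm2 (Ahalf (err_u k)) * (2 * N + norm2 (Ahalf (err_u k)))).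
Proof.
move=> kn HN; have tk := t_in kn; have [dU _] := scheme_dom kn.
have [du _] := slice_app u_C2x u_bd tk.
have LU := sqrt_inL2 Ahalf_sqrt dU; have Lu := sqrt_inL2 Ahalf_sqrt du.
rewrite distrC /diffusion -(sqrt_slice tk) /Defs.q_of.
rewrite opprD addrACA subrr add0r -mulrBr.
rewrite normrM (gtr0_norm beta_gt0) ler_pM2l// errorE (normL2_sqrtB Ahalf_sqrt du dU).
apply: (le_trans (normL2_sqr_diff Lu LU)).
by rewrite ler_wpM2l ?normL2_ge0// lerD2r ler_pM2l// sqrt_slice// HN.
Qed.

Lemma energy_u k Kmax Cu M : (0 < k < n)%N ->
  `|diffusion (t_ k)| <= Kmax -> 0 <= M ->
  (forall x t, x \in `[0, ell] -> t \in `[0, T] -> `|Dx (Dx u) x t| <= M) ->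
  consistent ell T u Kmax 0 Cu ->
  (norm2 (err_u k.+1 - err_u k) / tau) ^+ 2 - (norm2 (err_u k - err_u k.-1) / tau) ^+ 2
  + q_of (U k) / 2 * (norm2 (Ahalf (err_u k.+1)) ^+ 2 - norm2 (Ahalf (err_u k.-1)) ^+ 2)
  <= tau * (Cu * tau ^+ 2 + `|q_of (U k) - diffusion (t_ k)| * (M * Num.sqrt ell)
            + a1 * norm2 (Ahalf (err_v k)))
     * (norm2 (err_u k.+1 - err_u k) / tau + norm2 (err_u k - err_u k.-1) / tau).
Proof.
move=> kn Kq M0 HM Hcons; set Q := diffusion _ in Kq *; set q := q_of _.
have [kn1 k1n k0n kmn] := interior_index kn.
have tk := t_in k0n; have tp := t_in k1n; have tm := t_in kmn.
have Ep : t_ k.+1 = t_ k + tau by rewrite -natr1 mulrDl mul1r.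
have Em : t_ k.-1 = t_ k - tau.
  by case: k kn {kn1 k0n kmn k1n tk tp tm Kq Q q Ep} => // k _ /=; rewrite -natr1; ring.
have [||r [Lr nr Hr]] := Hcons Q (t_ k) tau Kq step_gt0.
- by rewrite -Em; move: tm; rewrite in_itv/= => /andP[].
- by rewrite -Ep; move: tp; rewrite in_itv/= => /andP[].
rewrite -Ep -Em in Hr.
have [dp ep] := err_u_app k1n; have [d0 _] := err_u_app k0n; have [dm em] := err_u_app kmn.
have [dv _] := err_v_app k0n.
have [_ _ _ _ /(_ k kn1) [_ _ eU _]] := UV.
have graphV := err_v_graph kn.
set W := _ - _ in graphV; have LW : inL2 W by case: graphV.
have nW := err_deriv_le dv graphV.
have Lxx t : t \in `[0, T] -> inL2 (Dx (Dx u) ^~ t).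
  by move=> tT; exact: slice_inL2 (u_C2x.2 2%N isT) tT.
pose h : R -> R := (Dx (Dx u) ^~ (t_ k.+1)) + (Dx (Dx u) ^~ (t_ k.-1)).
have Lh : inL2 h by apply: inL2D; exact: Lxx.
pose g : R -> R := r + ((Q - q) / 2) *: h - a1 *: W.
have Lg : inL2 g by apply: inL2B; [apply: inL2D => //|]; exact: inL2Z.
have tk0 : 0 < t_ k <= T.
  by move: tk; rewrite in_itv/= => /andP[_ ->]; rewrite mulr_gt0 ?step_gt0// ltr0n;
    case/andP: kn.
have eg : eqL2 (fun x => (err_u k.+1 x - 2 * err_u k x + err_u k.-1 x) / tau ^+ 2
    + q * ((A (err_u k.+1) x + A (err_u k.-1) x) / 2)) g.
  have eA := eqL2D ep em.
  apply: (@filterS2 _ _ (ae_filter_ringOfSetsType lebesgue_measure) _ _ _ _ eA eU).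
  move=> x hA hU Dxl; have {}hA := hA Dxl; have {}hU := hU Dxl.
  move: Dxl; rewrite /= in_itv/= => xl.
  have hr := Hr x xl; have pde := pde_u xl tk0; rewrite -/Q in pde.
  rewrite [LHS](_ : _ = (err_u k.+1 x - 2 * err_u k x + err_u k.-1 x) / tau ^+ 2
    + q * ((A (err_u k.+1) + A (err_u k.-1)) x / 2)); last by [].
  rewrite hA; exact: (error_equation_u hU hr pde).
have LAp := app_inL2 lA dp; have LAm := app_inL2 lA dm.
have sym : dot (A (err_u k.+1)) (err_u k.-1) = dot (A (err_u k.-1)) (err_u k.+1).
  by rewrite (self_adjoint_sym A_self_adjoint dp dm) dotL2C.
have := energy_step step_gt0 (dom_inL2 lA dm) (dom_inL2 lA d0) (dom_inL2 lA dp)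
  LAm LAp Lg eg sym.
rewrite -(normL2_sqrt_sqr A_self_adjoint Ahalf_sqrt dp)
  -(normL2_sqrt_sqr A_self_adjoint Ahalf_sqrt dm).
move=> /le_trans; apply.
have n1 := normL2_ge0 ell (err_u k.+1 - err_u k);
  have n2 := normL2_ge0 ell (err_u k - err_u k.-1).
apply: ler_wpM2r; first by rewrite addr_ge0// divr_ge0// (ltW step_gt0).
rewrite ler_pM2l ?step_gt0//.
rewrite (le_trans (normL2_leB (inL2D Lr (inL2Z _ Lh)) (inL2Z _ LW)))// lerD//; last first.
  by rewrite normL2Z// (gtr0_norm a1_gt0) ler_pM2l.
rewrite (le_trans (normL2_leD Lr (inL2Z _ Lh)))// lerD// normL2Z//
  normrM distrC -mulrA ler_wpM2l//.
have nh : norm2 h <= 2 * M * Num.sqrt ell.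
  apply: normL2_le_bound => //; [exact: ltW|by rewrite mulr_ge0|].
  move=> x /andP[x0 xl]; have xcc : x \in `[0, ell] by rewrite in_itv/= !ltW.
  rewrite /h fctE (le_trans (ler_normD _ _))//.
  by have := HM x _ xcc tp; have := HM x _ xcc tm; lra.
rewrite ger0_norm ?invr_ge0//; lra.
Qed.

Lemma energy_v k Cv : (0 < k < n)%N ->
  consistent ell T v gamma delta Cv ->
  (norm2 (err_v k.+1 - err_v k) / tau) ^+ 2 - (norm2 (err_v k - err_v k.-1) / tau) ^+ 2
  + (gamma * (norm2 (Ahalf (err_v k.+1)) ^+ 2 - norm2 (Ahalf (err_v k.-1)) ^+ 2)
     + delta * (norm2 (err_v k.+1) ^+ 2 - norm2 (err_v k.-1) ^+ 2)) / 2
  <= tau * (Cv * tau ^+ 2 + a2 * norm2 (Ahalf (err_u k)))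
     * (norm2 (err_v k.+1 - err_v k) / tau + norm2 (err_v k - err_v k.-1) / tau).
Proof.
move=> kn Hcons.
have [kn1 k1n k0n kmn] := interior_index kn.
have tk := t_in k0n; have tp := t_in k1n; have tm := t_in kmn.
have Ep : t_ k.+1 = t_ k + tau by rewrite -natr1 mulrDl mul1r.
have Em : t_ k.-1 = t_ k - tau.
  by case: k kn {kn1 k0n kmn k1n tk tp tm Ep} => // k _ /=; rewrite -natr1; ring.
have [|||r [Lr nr Hr]] := Hcons gamma (t_ k) tau _ step_gt0.
- by rewrite gtr0_norm.
- by rewrite -Em; move: tm; rewrite in_itv/= => /andP[].
- by rewrite -Ep; move: tp; rewrite in_itv/= => /andP[].
rewrite -Ep -Em in Hr.
have [dp ep] := err_v_app k1n; have [d0 _] := err_v_app k0n; have [dm em] := err_v_app kmn.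
have [du _] := err_u_app k0n.
have [_ _ _ _ /(_ k kn1) [_ _ _ eV]] := UV.
have graphU := err_u_graph kn.
set W := _ - _ in graphU; have LW : inL2 W by case: graphU.
have nW := err_deriv_le du graphU.
pose L := opL gamma delta A.
pose g : R -> R := r + a2 *: W.
have Lg : inL2 g by apply: inL2D => //; exact: inL2Z.
have tk0 : 0 < t_ k <= T.
  by move: tk; rewrite in_itv/= => /andP[_ ->]; rewrite mulr_gt0 ?step_gt0// ltr0n;
    case/andP: kn.
have eg : eqL2 (fun x => (err_v k.+1 x - 2 * err_v k x + err_v k.-1 x) / tau ^+ 2
    + 1 * ((L (err_v k.+1) x + L (err_v k.-1) x) / 2)) g.
  have eA := eqL2D ep em.
  apply: (@filterS2 _ _ (ae_filter_ringOfSetsType lebesgue_measure) _ _ _ _ eA eV).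
  move=> x hA hV Dxl; have {}hA := hA Dxl; have {}hV := hV Dxl.
  move: Dxl; rewrite /= in_itv/= => xl.
  have hr := Hr x xl; have pde := pde_v xl tk0.
  exact: (error_equation_v hV hr pde hA).
have LAp := app_inL2 lA dp; have LAm := app_inL2 lA dm.
have Lp := dom_inL2 lA dp; have Lm := dom_inL2 lA dm.
have LLp : inL2 (L (err_v k.+1)) by apply: inL2D; exact: inL2Z.
have LLm : inL2 (L (err_v k.-1)) by apply: inL2D; exact: inL2Z.
have dotL z w : inL2 z -> inL2 w -> inL2 (A z) ->
    dot (L z) w = gamma * dot (A z) w + delta * dot z w.
  by move=> Lz Lw LAz; rewrite /L /= dotL2Dl ?dotL2Zl//; exact: inL2Z.
have sym : dot (L (err_v k.+1)) (err_v k.-1) = dot (L (err_v k.-1)) (err_v k.+1).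
  rewrite !dotL// (self_adjoint_sym A_self_adjoint dp dm) dotL2C.
  by rewrite (dotL2C _ (err_v k.+1) (err_v k.-1)).
have := energy_step step_gt0 Lm (dom_inL2 lA d0) Lp LLm LLp Lg eg sym.
rewrite !dotL//.
rewrite -(normL2_sqrt_sqr A_self_adjoint Ahalf_sqrt dp)
  -(normL2_sqrt_sqr A_self_adjoint Ahalf_sqrt dm).
rewrite -!normL2_sqr => H.
apply: (@le_trans _ _ _ _ _ (le_trans _ H)).
  by rewrite le_eqVlt; apply/orP; left; apply/eqP; field; rewrite gt_eqF// step_gt0.
have n1 := normL2_ge0 ell (err_v k.+1 - err_v k);
  have n2 := normL2_ge0 ell (err_v k - err_v k.-1).
apply: ler_wpM2r; first by rewrite addr_ge0// divr_ge0// (ltW step_gt0).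
rewrite ler_pM2l ?step_gt0//.
rewrite (le_trans (normL2_leD Lr (inL2Z _ LW)))// lerD//.
by rewrite normL2Z// (gtr0_norm a2_gt0) ler_pM2l.
Qed.

Lemma null_error z : dom A z -> eqL2 z 0 -> norm2 z = 0 /\ norm2 (Ahalf z) = 0.
Proof.
move=> dz z0; have Lz := dom_inL2 lA dz; have d0 : dom A 0 by case: lA.
have L0 := dom_inL2 lA d0; have LAz := app_inL2 lA dz.
split; first by rewrite (eqL2_norm Lz L0 z0) normL2_0.
apply/eqP; rewrite -[_ == 0](@expf_eq0 _ _ 2)
  (normL2_sqrt_sqr A_self_adjoint Ahalf_sqrt dz).
rewrite (eqL2_dotr Lz L0 LAz z0) -normr_le0.
by rewrite (le_trans (dotL2_le_normL2 LAz L0))// normL2_0 mulr0.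
Qed.

Lemma initial_error (w : R -> R -> R) (W : nat -> R -> R) (w0 w1 h' : R -> R) C :
  Ck_x ell T 2 w -> (forall t, t \in `[0, T] -> w 0 t = 0 /\ w ell t = 0) ->
  (forall k, (k <= n)%N -> dom A (W k)) ->
  (forall x, x \in `[0, ell] -> w0 x = w x 0) -> eqL2 (W 0%N) w0 -> eqL2 (W 1%N) w1 ->
  let h x := w x tau - w1 x in
  has_deriv 0 ell h h' -> {within `[0, ell], continuous h'} -> h 0 = 0 /\ h ell = 0 ->
  norm2 h <= C * tau ^+ 3 -> norm2 h' <= C * tau ^+ 2 ->
  let e := error T w W n in
  [/\ norm2 (e 0%N) = 0, norm2 (Ahalf (e 0%N)) = 0, norm2 (e 1%N) <= C * tau ^+ 3,
      norm2 (Ahalf (e 1%N)) <= C * tau ^+ 2 & norm2 (e 1%N - e 0%N) / tau <= C * tau ^+ 2].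
Proof.
move=> Cw bd dW w0E e0 e1 h dh ch' [h0 hl] nh nh' e.
have n1 : (1 <= n)%N by rewrite (ltn_trans _ n_gt2).
have [d0 _] := error_app Cw bd (leq0n n) (dW _ (leq0n n)).
have [d1 _] := error_app Cw bd n1 (dW _ n1).
have [z0 s0] : norm2 (e 0%N) = 0 /\ norm2 (Ahalf (e 0%N)) = 0.
  apply: null_error => //; apply: (@eqL2_trans _ _ _ ((w ^~ 0) - w0)).
    by rewrite /e errorE mul0r; apply: eqL2B => //; exact: eqL2_refl.
  apply: eqL2_on => x /andP[x0 xl]; rewrite !fctE w0E ?subrr//.
  by rewrite in_itv/= !ltW.
have eh : eqL2 (e 1%N) h.
  by rewrite /e errorE mul1r; apply: eqL2B => //; exact: eqL2_refl.
have L0 := dom_inL2 lA d0; have L1 := dom_inL2 lA d1.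
have z1 : norm2 (e 1%N) <= C * tau ^+ 3.
  by rewrite (eqL2_norm L1 (continuous_inL2 dh.1) eh).
split => //.
  apply: le_trans nh'.
  exact: (sqrt_le_deriv ell_gt0 A_self_adjoint A_extends_A0 A_positive_definite
    Ahalf_sqrt d1 eh dh ch' h0 hl).
rewrite ler_pdivrMr ?step_gt0// -mulrA -exprSr (le_trans (normL2_leB L1 L0))//.
by rewrite z0 addr0.
Qed.

Lemma dt_error_le (w : R -> R -> R) (W : nat -> R -> R) k c :
  inL2 (error T w W n k) -> inL2 (error T w W n k.-1) ->
  norm2 (error T w W n k - error T w W n k.-1) / tau <= c * tau ^+ 2 ->
  dt_error_bounded ell T w W n k c.
Proof.
move=> L1 L0 H; rewrite /dt_error_bounded.
have -> : (fun x => (error T w W n k x - error T w W n k.-1 x) / tau) =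
    tau^-1 *: (error T w W n k - error T w W n k.-1).
  by apply/funext => x; rewrite !fctE /GRing.scale /= mulrC.
by rewrite normL2Z ?gtr0_norm ?invr_gt0 ?step_gt0// 1?mulrC//; exact: inL2B.
Qed.

End OneStep.

(** Every constant is fixed before the number of steps. The choice
    [Tbar <= T / 3] ensures that at least three steps are made whenever there
    is a level to estimate. *)
Lemma scheme_convergence :
  exists Tbar c1 c2 c1' c2' : R,
    [/\ 0 < Tbar <= T,
        [/\ 0 < c1, 0 < c2, 0 < c1' & 0 < c2'] &
        forall (n : nat) (U V : nat -> R -> R), (1 < n)%N ->
          scheme ell T alpha beta gamma delta a1 a2
            f1 f2 phi0 phi1 psi0 psi1 A Ahalf n U V ->
          forall k : nat, (1 <= k <= Num.truncn (Tbar / step T n))%N ->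
            [/\ dx_error_bounded ell T u U n k c1,
                dx_error_bounded ell T v V n k c2,
                dt_error_bounded ell T u U n k c1' &
                dt_error_bounded ell T v V n k c2']].
Proof.
have [N N0 HN] := ux_norm_bounded.
have [M M0 HM] := continuous_rect_bounded (u_C2x.2 2%N isT).
have [CQ CQ0 HCQ] := diffusion_lipschitz.
pose Kmax := alpha + beta * N ^+ 2.
have b0 := ltW beta_gt0.
have Kmax0 : 0 <= Kmax by exact: (addr_ge0 (ltW alpha_gt0) (mulr_ge0 b0 (sqr_ge0 N))).
have HK t : t \in `[0, T] -> `|diffusion t| <= Kmax.
  move=> tT; rewrite ger0_norm /diffusion; last first.
    exact: (addr_ge0 (ltW alpha_gt0) (mulr_ge0 b0 (sqr_ge0 _))).
  by rewrite lerD2l ler_pM2l// lerXn2r ?nnegrE ?normL2_ge0// HN.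
have [Cu Cu0 Hcu] := consistency ell_gt0 0 Kmax0 u_C2x u_C3t uttt_lip uxx_C1t uxxt_lip.
have [Cv Cv0 Hcv] :=
  consistency ell_gt0 delta (ltW gamma_gt0) v_C2x v_C3t vttt_lip vxx_C1t vxxt_lip.
have [Cphi0 _ _] := phi0_D; have [Cpsi0 _ _] := psi0_D.
have [Su Su0 Hsu] := start_consistency ell_gt0 T_gt0 u_C2x u_C3t ux_C2t u_bd
  (Ck_onW (isT : (1 <= 2)%N) Cphi0) phi1_C1 phi2_C1 phi0E phi1E phi2E.
have [Sv Sv0 Hsv] := start_consistency ell_gt0 T_gt0 v_C2x v_C3t vx_C2t v_bd
  (Ck_onW (isT : (1 <= 2)%N) Cpsi0) psi1_C1 psi2_C1 psi0E psi1E psi2E.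
pose l := Num.sqrt ell; have l0 : 0 <= l by exact: sqrtr_ge0.
pose cq := beta * (2 * N + 1).
have cq0 : 0 <= cq by rewrite mulr_ge0// addr_ge0// mulr_ge0.
have cM0 : 0 <= cq * (M * l) by exact: mulr_ge0 cq0 (mulr_ge0 M0 l0).
have [C [C0 [CuC CvC a1C] [a2C cqC cqMC CQC]]] : exists C, [/\ 0 <= C,
    [/\ Cu <= C, Cv <= C & a1 <= C] & [/\ a2 <= C, cq <= C, cq * (M * l) <= C & CQ <= C]].
  exists (Cu + Cv + a1 + a2 + cq + cq * (M * l) + CQ).
  by have := (ltW a1_gt0, ltW a2_gt0) => -[? ?]; do !split; move: cM0; set c := cq * _; lra.
have [Tb [B [Tb0 B0 bound]]] := energy_system_bound alpha_gt0 gamma_gt0 (ltW delta_gt0) C0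
  (addr_ge0 Su0 Sv0) Kmax0.
have T30 : 0 < T / 3 by rewrite divr_gt0.
exists (Num.min 1 (Num.min (T / 3) Tb)), B, B, B, B; split => //.
  by rewrite !lt_min ltr01 T30 Tb0 !ge_min ler_pdivrMr// ler_peMr ?orbT ?(ltW T_gt0)//
    ler1n.
move=> n U V n1 UV k /andP[k1 km].
have n0 : 0 < n%:R :> R by rewrite ltr0n (ltn_trans _ n1).
set tau := step T n in km.
have tau0 : 0 < tau by rewrite divr_gt0.
set Tbar := Num.min 1 _ in km; set m := Num.truncn _ in km.
have Tbar0 : 0 < Tbar by rewrite !lt_min ltr01 T30 Tb0.
have [Tbar1 TbarT TbarTb] : [/\ Tbar <= 1, Tbar <= T / 3 & Tbar <= Tb].
  by rewrite /Tbar; split; rewrite !ge_min lexx ?orbT.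
have mT : m%:R * tau <= Tbar by rewrite -ler_pdivlMr// truncn_le divr_ge0// ltW.
have tauT : tau <= Tbar.
  by apply: le_trans mT; rewrite ler_peMl ?(ltW tau0)// ler1n (leq_trans k1 km).
have nT : n%:R * tau = T by rewrite /tau /step mulrC divfK// gt_eqF.
(* three steps of length [tau <= Tbar] fit into [0, T] *)
have n3 : (2 < n)%N.
  rewrite -(@ler_nat R) -(ler_pM2r tau0) nT mulrC -ler_pdivlMr//.
  exact: le_trans tauT TbarT.
have mn : (m < n)%N.
  rewrite -(@ltr_nat R) -(ltr_pM2r tau0) nT (le_lt_trans mT)// (le_lt_trans TbarT)//.
  by rewrite ltr_pdivrMr// ltr_pMr// ltr1n.
have tT : 0 < tau <= T.
  by rewrite tau0 -[leLHS]mul1r -nT ler_pM2r// ler1n ltnW.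
have dU j : (j <= n)%N -> dom A (U j) by move=> /(scheme_dom n3 UV)[].
have dV j : (j <= n)%N -> dom A (V j) by move=> /(scheme_dom n3 UV)[].
have deU j : (j <= n)%N -> dom A (error T u U n j) by move=> /(err_u_app n3 UV)[].
have deV j : (j <= n)%N -> dom A (error T v V n j) by move=> /(err_v_app n3 UV)[].
have LU j : (j <= n)%N -> inL2 (error T u U n j) by move=> h;
  exact: (dom_inL2 lA (deU _ h)).
have LV j : (j <= n)%N -> inL2 (error T v V n j) by move=> h;
  exact: (dom_inL2 lA (deV _ h)).
have [eU0 eU1 eV0 eV1 _] := UV.
have [hu' [dhu chu bhu nhu nhu']] := Hsu tau tT.
have [hv' [dhv chv bhv nhv nhv']] := Hsv tau tT.
have [zu0 su0 zu1 su1 du1] :=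
  initial_error n3 u_C2x u_bd dU phi0E eU0 eU1 dhu chu bhu nhu nhu'.
have [zv0 sv0 zv1 sv1 dv1] :=
  initial_error n3 v_C2x v_bd dV psi0E eV0 eV1 dhv chv bhv nhv nhv'.
pose D j := norm2 (error T u U n j.+1 - error T u U n j) / tau.
pose F j := norm2 (error T v V n j.+1 - error T v V n j) / tau.
pose s j := norm2 (Ahalf (error T u U n j)).
pose p j := norm2 (Ahalf (error T v V n j)).
pose y j := norm2 (error T v V n j).
pose q j := q_of (U j).
pose Q j := diffusion (j%:R * tau).
pose G j := Cu * tau ^+ 2 + `|q j - Q j| * (M * l) + a1 * p j.
pose H j := Cv * tau ^+ 2 + a2 * s j.
have t2 := sqr_ge0 tau.
have s0 j : 0 <= s j by exact: normL2_ge0.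
have p0 j : 0 <= p j by exact: normL2_ge0.
have Dn j : 0 <= D j by exact: divr_ge0 (normL2_ge0 _ _) (ltW tau0).
have Fn j : 0 <= F j by exact: divr_ge0 (normL2_ge0 _ _) (ltW tau0).
have ss0 j : 0 <= s j + s j ^+ 2 by rewrite addr_ge0// sqr_ge0.
have tk j : (j <= n)%N -> j%:R * tau \in `[0, T] by move=> jn; exact: (t_in n3).
have qQ j : (j <= n)%N -> `|q j - Q j| <= cq * (s j + s j ^+ 2).
  move=> jn; apply: (le_trans (q_error n3 UV jn HN)).
  by rewrite -mulrA ler_pM2l//; exact: (sqr_perturbation N0 (s0 j)).
have sys : energy_system alpha gamma delta C tau m D F s p y q Q G H.
  split.
  - by move=> j; split.
  - by move=> j; rewrite lerDl; exact: mulr_ge0 b0 (sqr_ge0 _).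
  - move=> j /andP[j0 jm]; have jn : (0 < j < n)%N by rewrite j0 (ltn_trans jm).
    have [_ _ jn' _] := interior_index jn.
    have := energy_u n3 UV jn (HK _ (tk _ jn')) M0 HM Hcu.
    by rewrite -/tau /D /= (prednK j0).
  - move=> j /andP[j0 jm]; have jn : (0 < j < n)%N by rewrite j0 (ltn_trans jm).
    have := energy_v n3 UV jn Hcv.
    by rewrite -/tau /F /= (prednK j0).
  - move=> j /andP[j0 jm]; have jn := ltnW (ltn_trans jm mn).
    rewrite /G -[tau ^+ 2 + s j + _]addrA !mulrDr lerD//; last by rewrite ler_wpM2r.
    rewrite lerD//; first by rewrite ler_wpM2r.
    rewrite -mulrDr (le_trans (ler_wpM2r (mulr_ge0 M0 l0) (qQ j jn)))//.
    by rewrite mulrAC ler_wpM2r.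
  - by move=> j _; rewrite /H mulrDr lerD// ler_wpM2r.
  - move=> j jm; apply: (le_trans (qQ j (ltnW (ltn_trans jm mn)))).
    by rewrite ler_wpM2r.
  - move=> j /andP[j0 jm]; have jn := ltnW (ltn_trans jm mn).
    have jn1 : (j.-1 <= n)%N by exact: leq_trans (leq_pred j) jn.
    apply: (le_trans (HCQ _ _ (tk _ jn) (tk _ jn1))).
    rewrite -mulrBl -{1}(prednK j0) -natr1 addrAC subrr add0r mul1r (gtr0_norm tau0).
    by rewrite ler_wpM2r// ltW.
have q0K : q 0%N <= Kmax.
  rewrite /q (_ : q_of (U 0%N) = Q 0%N).
    by rewrite (le_trans (ler_norm _))// HK// tk.
  apply/eqP; rewrite -subr_eq0 -normr_le0 (le_trans (qQ 0%N (leq0n n)))//.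
  by rewrite /s su0 expr0n/= addr0 mulr0.
have Sle x : x <= Su * tau ^+ 2 \/ x <= Sv * tau ^+ 2 -> x <= (Su + Sv) * tau ^+ 2.
  by move=> [h|h]; apply: (le_trans h); rewrite ler_wpM2r// ?lerDl ?lerDr.
have y1 : y 1%N <= Sv * tau ^+ 2.
  apply: (le_trans zv1); rewrite ler_wpM2l// exprSr ler_piMr//.
  exact: le_trans tauT Tbar1.
have concl := bound m tau D F s p y q Q G H tau0 (le_trans tauT TbarTb) (le_trans mT TbarTb)
  sys q0K su0 sv0 zv0 (normL2_ge0 _ _) (Sle _ (or_introl du1)) (Sle _ (or_intror dv1))
  (Sle _ (or_introl su1)) (Sle _ (or_intror sv1)) (Sle _ (or_intror y1)).
have kn : (0 < k < n)%N by rewrite k1 (leq_ltn_trans km mn).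
have [_ _ kn' kn1] := interior_index kn.
have [|c1 c2 c3 c4] := concl k.-1; first by rewrite prednK.
rewrite /D /F prednK// in c1 c2 c3 c4.
split.
- have du : dom (opB ell) (error T u U n k) by eexists; exact: (err_u_graph n3 UV kn).
  split; first exact: du.
  exact: (le_trans (err_deriv_le (deU _ kn') (opB_graph du)) c1).
- have dv : dom (opB ell) (error T v V n k) by eexists; exact: (err_v_graph n3 UV kn).
  split; first exact: dv.
  exact: (le_trans (err_deriv_le (deV _ kn') (opB_graph dv)) c2).
- exact: (dt_error_le n3 (LU _ kn') (LU _ kn1) c3).
- exact: (dt_error_le n3 (LV _ kn') (LV _ kn1) c4).
Qed.

End Scheme.

Theorem theorem7p3 (R : realType)
  (ell T alpha beta gamma delta a1 a2 : R)
  (f1 f2 : R -> R -> R) (phi0 phi1 psi0 psi1 : R -> R)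
  (A Ahalf : operator (R := R)) (u v : R -> R -> R)
  (ell_gt0 : 0 < ell) (T_gt0 : 0 < T)
  (alpha_gt0 : 0 < alpha) (beta_gt0 : 0 < beta)
  (gamma_gt0 : 0 < gamma) (delta_gt0 : 0 < delta)
  (a1_gt0 : 0 < a1) (a2_gt0 : 0 < a2)
  (A_extends_A0 : extends ell A (opA0 ell))
  (A_self_adjoint : self_adjoint ell A)
  (A_positive_definite : positive_definite ell A)
  (Ahalf_sqrt : is_sqrt ell Ahalf A)
  (phi0_cont : {within `[0, ell], continuous phi0})
  (phi1_cont : {within `[0, ell], continuous phi1})
  (psi0_cont : {within `[0, ell], continuous psi0})
  (psi1_cont : {within `[0, ell], continuous psi1})
  (phi0_bd : phi0 0 = 0 /\ phi0 ell = 0)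
  (psi0_bd : psi0 0 = 0 /\ psi0 ell = 0)
  (wp : well_posed_with_solution ell T alpha beta gamma delta a1 a2
          f1 f2 phi0 phi1 psi0 psi1 u v)
  (* (a) *)
  (phi0_D : dom (opA0 ell) phi0) (psi0_D : dom (opA0 ell) psi0)
  (phi1_C1 : Ck_on `[0, ell] 1 phi1) (psi1_C1 : Ck_on `[0, ell] 1 psi1)
  (phi2_C1 : Ck_on `[0, ell] 1 (phi2 ell alpha beta a1 f1 phi0 psi0 Ahalf))
  (psi2_C1 : Ck_on `[0, ell] 1 (psi2 ell gamma delta a2 f2 phi0 psi0))
  (ux_C2t : Ck_t ell T 2 (dx ell u)) (vx_C2t : Ck_t ell T 2 (dx ell v))
  (f1_C1x : Ck_x ell T 1 f1) (f2_C1x : Ck_x ell T 1 f2)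
  (f1_bd : forall t : R, 0 <= t <= T -> f1 0 t = 0 /\ f1 ell t = 0)
  (f2_bd : forall t : R, 0 <= t <= T -> f2 0 t = 0 /\ f2 ell t = 0)
  (* (b) *)
  (u_C3t : Ck_t ell T 3 u) (v_C3t : Ck_t ell T 3 v)
  (uttt_lip : lipschitz_t ell T (dt T (dt T (dt T u))))
  (vttt_lip : lipschitz_t ell T (dt T (dt T (dt T v))))
  (* (c) *)
  (uxx_C1t : Ck_t ell T 1 (dx ell (dx ell u)))
  (vxx_C1t : Ck_t ell T 1 (dx ell (dx ell v)))
  (uxxt_lip : lipschitz_t ell T (dt T (dx ell (dx ell u))))
  (vxxt_lip : lipschitz_t ell T (dt T (dx ell (dx ell v)))) :
  exists Tbar c1 c2 c1' c2' : R,
    [/\ 0 < Tbar <= T,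
        [/\ 0 < c1, 0 < c2, 0 < c1' & 0 < c2'] &
        forall (n : nat) (U V : nat -> R -> R), (1 < n)%N ->
          scheme ell T alpha beta gamma delta a1 a2
            f1 f2 phi0 phi1 psi0 psi1 A Ahalf n U V ->
          forall k : nat, (1 <= k <= Num.truncn (Tbar / step T n))%N ->
            [/\ dx_error_bounded ell T u U n k c1,
                dx_error_bounded ell T v V n k c2,
                dt_error_bounded ell T u U n k c1' &
                dt_error_bounded ell T v V n k c2']].
Proof.
have [sol _] := wp.
exact: (@scheme_convergence R ell T alpha beta gamma delta a1 a2 f1 f2
  phi0 phi1 psi0 psi1 A Ahalf u v ell_gt0 T_gt0 alpha_gt0 beta_gt0 gamma_gt0
  delta_gt0 a1_gt0 a2_gt0 A_extends_A0 A_self_adjoint A_positive_definite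
  Ahalf_sqrt sol phi0_D psi0_D phi1_C1 psi1_C1 phi2_C1 psi2_C1 ux_C2t vx_C2t
  f1_C1x f2_C1x u_C3t v_C3t uttt_lip vttt_lip uxx_C1t vxx_C1t uxxt_lip
  vxxt_lip).
Qed.
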